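(* Let $\rho$ be a faithful state on $M_n(\mathbb{C})$, let $\Psi:M_n(\mathbb{C})\to M_n(\mathbb{C})$ be a unital completely positive map with $\Psi^*(D_\rho)=D_\rho$ that is KMS-symmetric with respect to $\rho$, let $\gamma>0$, and suppose that $\mathcal{L}=\gamma(\mathrm{Id}-\Psi)$ is the generator of a primitive KMS-symmetric (with respect to $\rho$) quantum Markov semigroup. Then $$\alpha_{\mathrm{CMLSI}}(\mathcal{L})\;\ge\;\frac{s_-^2}{4n\gamma s_+}\,\lambda_{\mathrm{KMS}}^2\;\ge\;\frac{h_\rho(\mathcal{L})^4\,s_-^6}{16\,n\,\gamma\, s_+^5\,\|\mathcal{L}\|_{\mathrm{KMS},\rho}^2}.$$
   Context: Throughout $n\ge 2$ and $M_n(\mathbb{C})$ carries the unnormalized trace $\mathrm{Tr}$. A quantum Markov semigroup is a norm-continuous semigroup $\{\Phi_t\}_{t\ge0}$ of unital completely positive linear maps on $M_n(\mathbb{C})$ with $\Phi_0=\mathrm{Id}$; its generator $\mathcal{L}$ is defined by $\Phi_t=e^{-t\mathcal{L}}$. A faithful state $\rho$ has positive definite density matrix $D_\rho$, $\rho(X)=\mathrm{Tr}(D_\rho X)$; $s_-$ and $s_+$ are the smallest and largest eigenvalues of $D_\rho$. The KMS inner product is $\langle X,Y\rangle_{\mathrm{KMS},\rho}=\mathrm{Tr}(X^*D_\rho^{1/2}YD_\rho^{1/2})$, with norm $\|X\|_{\mathrm{KMS},\rho}$; for a linear map, $\|\mathcal{L}\|_{\mathrm{KMS},\rho}=\sup_{X\ne0}\|\mathcal{L}(X)\|_{\mathrm{KMS},\rho}/\|X\|_{\mathrm{KMS},\rho}$.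 A linear map is KMS-symmetric with respect to $\rho$ if it is self-adjoint for $\langle\cdot,\cdot\rangle_{\mathrm{KMS},\rho}$; a semigroup is KMS-symmetric if every $\Phi_t$ is. It is primitive if it admits a faithful invariant state and $\ker\mathcal{L}=\mathbb{C}I$; $\rho$ is then the unique invariant state. For a linear map $\mathcal{T}$, $\mathcal{T}^*$ is the adjoint for the Hilbert–Schmidt inner product $\mathrm{Tr}(X^*Y)$. Projection Dirichlet conductance: $h_\rho(\mathcal{L})=\inf_{P}\dfrac{\langle P,\mathcal{L}(P)\rangle_{\mathrm{KMS},\rho}}{\min\{\rho(P),1-\rho(P)\}}$, the infimum over all orthogonal projections $P\in M_n(\mathbb{C})$ with $P\ne0,I$. Spectral gap: $\lambda_{\mathrm{KMS}}=\inf\left\{\dfrac{\langle X,\mathcal{L}(X)\rangle_{\mathrm{KMS},\rho}}{\|X\|_{\mathrm{KMS},\rho}^2}: 0\ne X=X^*\in M_n(\mathbb{C}),\ \rho(X)=0\right\}$. Relative entropy: $H(D_1\|D_2)=\mathrm{Tr}(D_1(\log D_1-\log D_2))$. For a primitive semigroup with invariant density $D_\rho$, $\alpha_{\mathrm{CMLSI}}(\mathcal{L})$ is the supremum of all $\beta\ge0$ such that for every $m\in\mathbb{N}$, $m\ge1$, and every faithful (positive definite) density matrix $D\in M_n(\mathbb{C})\otimes M_m(\mathbb{C})$, $$\mathrm{Tr}\big((\mathcal{L}^*\otimes\mathrm{Id}_m)(D)\,(\log D-\log(D_\rho\otimes D_R))\big)\ge2\beta\,H(D\|D_\rho\otimes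 D_R),\qquad D_R=(\mathrm{Tr}_{M_n}\otimes\mathrm{Id}_m)(D).$$ *)

(* Defs.v *)
From HB Require Import structures.
From mathcomp Require Import all_boot all_order all_algebra.
From mathcomp Require Import complex mxtens.
From mathcomp Require Import boolp classical_sets reals ereal topology.
From mathcomp Require Import normedtype sequences exp.

Set Implicit Arguments.
Unset Strict Implicit.
Unset Printing Implicit Defensive.

Import Order.TTheory GRing.Theory Num.Theory.
Import numFieldNormedType.Exports.

Local Open Scope classical_set_scope.
Local Open Scope ring_scope.
Local Open Scope sesquilinear_scope.
Local Open Scope complex_scope.

(* M_n(C) is 'M[R[i]]_n for R : realType, and linear maps on it are elements
   of 'End('M[R[i]]_n).  A state is represented by its density matrix.
   complex.Re is only applied to quantities that are real in all uses below
   (trace of a product of two Hermitian matrices, quadratic form of a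
   self-adjoint map, trace pairing of a state with a projection). *)

Section Matrices.
Context {R : realType}.
Local Notation C := R[i].

Definition posdefmx n (A : 'M[C]_n) : Prop :=
  A \is hermsymmx /\
  forall v : 'rV[C]_n, v != 0 -> 0 < (v *m A *m v ^t*) 0 0.

Definition psdmx n (A : 'M[C]_n) : Prop :=
  A \is hermsymmx /\
  forall v : 'rV[C]_n, 0 <= (v *m A *m v ^t*) 0 0.

Definition faithful_density n (D : 'M[C]_n) : Prop :=
  posdefmx D /\ \tr D = 1.

Definition state n (D X : 'M[C]_n) : C := \tr (D *m X).

(* f(A) for Hermitian A, whose spectral decomposition is
   A = invmx P *m diag_mx (spectral_diag A) *m P with P := spectralmx A. *)
Definition funcalc (f : R -> R) n (A : 'M[C]_n) : 'M[C]_n :=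
  invmx (spectralmx A)
  *m diag_mx (map_mx (fun z : C => (f (complex.Re z))%:C) (spectral_diag A))
  *m spectralmx A.

Definition sqrtmx n (A : 'M[C]_n) : 'M[C]_n := funcalc Num.sqrt A.

Definition logmx n (A : 'M[C]_n) : 'M[C]_n := funcalc (@ln R) A.

Definition min_eigenvalue n (A : 'M[C]_n) : R :=
  inf [set x : R | eigenvalue A x%:C].

Definition max_eigenvalue n (A : 'M[C]_n) : R :=
  sup [set x : R | eigenvalue A x%:C].

Definition hs_inner m n (X Y : 'M[C]_(m, n)) : C := \tr (X ^t* *m Y).

Definition hs_norm m n (X : 'M[C]_(m, n)) : R :=
  Num.sqrt (complex.Re (hs_inner X X)).

Definition kms_inner n (D X Y : 'M[C]_n) : C :=
  \tr (X ^t* *m sqrtmx D *m Y *m sqrtmx D).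

Definition kms_norm n (D X : 'M[C]_n) : R :=
  Num.sqrt (complex.Re (kms_inner D X X)).

Definition opnorm (U V : zmodType) (nU : U -> R) (nV : V -> R) (f : U -> V) : R :=
  sup [set nV (f x) / nU x | x in [set x : U | x != 0]].

(* For a column vector, hs_norm is the Euclidean norm. *)
Definition cstar_norm n (X : 'M[C]_n) : R :=
  opnorm (@hs_norm n 1) (@hs_norm n 1) (mulmx X).

Definition is_projection n (P : 'M[C]_n) : Prop := P ^t* = P /\ P *m P = P.

(* The block of D in M_n (x) M_m at position (j, l) of the second factor, so
   that D = \sum_(j, l) mxtens_block D j l *t delta_mx j l. *)
Definition mxtens_block n m (D : 'M[C]_(n * m)) (j l : 'I_m) : 'M[C]_n :=
  \matrix_(i, k) D (mxtens_index (i, j)) (mxtens_index (k, l)).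

(* (T (x) Id_m)(D) *)
Definition ampliation n m (T : 'M[C]_n -> 'M[C]_n) (D : 'M[C]_(n * m)) :
    'M[C]_(n * m) :=
  \sum_(j < m) \sum_(l < m) T (mxtens_block D j l) *t delta_mx j l.

(* (Tr (x) Id_m)(D) *)
Definition partial_trace n m (D : 'M[C]_(n * m)) : 'M[C]_m :=
  \matrix_(j, l) \tr (mxtens_block D j l).

Definition relative_entropy n (D1 D2 : 'M[C]_n) : R :=
  complex.Re (\tr (D1 *m (logmx D1 - logmx D2))).

End Matrices.

Section Superoperators.
Context {R : realType} {n : nat}.
Local Notation C := R[i].
Local Notation Mn := 'M[C]_n.
Implicit Types (D : Mn) (T L : 'End(Mn)) (Phi : R -> 'End(Mn)).

Definition hs_adjoint T (X : Mn) : Mn :=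
  \matrix_(i, j) hs_inner (T (delta_mx i j)) X.

Lemma hs_adjointP T (X Y : Mn) :
  hs_inner (hs_adjoint T X) Y = hs_inner X (T Y).
Proof.
have hsE (A B : Mn) : hs_inner A B = \sum_i \sum_j (A i j)^* * B i j.
  rewrite /hs_inner /mxtrace [RHS]exchange_big /=; apply: eq_bigr => j _.
  by rewrite mxE; apply: eq_bigr => i _; rewrite !mxE.
rewrite hsE [in RHS](matrix_sum_delta Y) /hs_inner linear_sum mulmx_sumr.
rewrite raddf_sum; apply: eq_bigr => i _.
rewrite linear_sum mulmx_sumr raddf_sum; apply: eq_bigr => j _.
rewrite linearZ /= -scalemxAr mxtraceZ mulrC; congr (_ * _).
rewrite -/(hs_inner _ _) mxE !hsE rmorph_sum; apply: eq_bigr => k _.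
rewrite rmorph_sum; apply: eq_bigr => l _.
by rewrite rmorphM /= conjCK mulrC.
Qed.

Definition unital T : Prop := T 1%:M = 1%:M.

Definition completely_positive T : Prop :=
  forall (m : nat) (A : 'M[C]_(n * m)), psdmx A -> psdmx (ampliation T A).

Definition kms_symmetric D T : Prop :=
  forall X Y : Mn, kms_inner D (T X) Y = kms_inner D X (T Y).

Definition superop_norm T : R :=
  opnorm (@cstar_norm R n) (@cstar_norm R n) T.

Definition kms_opnorm D T : R := opnorm (kms_norm D) (kms_norm D) T.

(* Only the values Phi t with 0 <= t are relevant. *)
Definition quantum_markov_semigroup Phi : Prop :=
  [/\ forall t, 0 <= t -> unital (Phi t) /\ completely_positive (Phi t),
      Phi 0 = \1%VF,
      forall s t, 0 <= s -> 0 <= t -> Phi (s + t) = (Phi s \o Phi t)%VF &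
      forall s, 0 <= s ->
        superop_norm (Phi t - Phi s)
          @[t --> within [set t | 0 <= t] (nbhs s)] --> (0 : R)].

Definition exp_partial_sum T (N : nat) : 'End(Mn) :=
  \sum_(k < N) (k`!%:R)^-1 *: iter k (comp_lfun T) \1%VF.

(* Phi t = exp(- t L) for all t >= 0 *)
Definition is_generator Phi L : Prop :=
  forall t, 0 <= t ->
    superop_norm (Phi t - exp_partial_sum ((- t)%:C *: L) N)
      @[N --> \oo] --> (0 : R).

Definition kms_symmetric_semigroup D Phi : Prop :=
  forall t, 0 <= t -> kms_symmetric D (Phi t).

Definition invariant_state D Phi : Prop :=
  forall t, 0 <= t -> forall X, state D (Phi t X) = state D X.

(* L is meant to be the generator of Phi. *)
Definition primitive_semigroup Phi L : Prop :=
  (exists D, faithful_density D /\ invariant_state D Phi) /\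
  lker L = <[1%:M : Mn]>%VS.

Definition dirichlet D L (X : Mn) : R := complex.Re (kms_inner D X (L X)).

Definition conductance D L : R :=
  inf [set dirichlet D L P /
           Num.min (complex.Re (state D P)) (1 - complex.Re (state D P))
      | P in [set P : Mn | [/\ is_projection P, P != 0 & P != 1%:M]]].

Definition spectral_gap D L : R :=
  inf [set dirichlet D L X / kms_norm D X ^+ 2
      | X in [set X : Mn | [/\ X != 0, X ^t* = X & state D X = 0]]].

(* The supremum is taken in the extended reals. *)
Definition alpha_CMLSI D L : \bar R :=
  ereal_sup [set beta%:E | beta in [set beta : R | 0 <= beta /\
    forall (m : nat) (E : 'M[C]_(n * m)), (0 < m)%N -> faithful_density E ->
      let ref := D *t partial_trace E in
      2 * beta * relative_entropy E ref <=
        complex.Re (\tr (ampliation (hs_adjoint L) E *m (logmx E - logmx ref)))]].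

End Superoperators.

(* Main.v *)
(* Diagonalise D_rho = W^* diag(d) W and write Psi in Kraus form.

   Functional inequality.  Since D_R is preserved by the dual semigroup, the
   entropy production of E relative to sigma := D_rho (x) D_R is, with
   T := Psi^* (x) Id and up to gamma,
     H(E|sigma) - H(T E|sigma) + H(T E|E) >= H(T E|E),
   the inequality being monotonicity of the relative entropy under T.  The
   relative entropy is an integral of resolvent terms, each a maximum of affine
   functionals; this gives monotonicity, a quadratic lower bound of H(T E|E) in
   T E - E weighted by inverse logarithmic means of the spectrum of n (1 (x) D_R)
   (which dominates E and T E), and a quadratic upper bound of H(E|sigma) in
   E - sigma weighted by those of the spectrum of sigma.  In a product eigenbasis
   the two weights are comparable block by block, so that the claim reduces to
   the Hilbert-Schmidt gap of Id - Psi^* on traceless matrices, which follows from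
   the spectral gap by Psi^*(D^(1/2) X D^(1/2)) = D^(1/2) Psi(X) D^(1/2).

   Cheeger inequality.  By KMS symmetry and positivity of the Cauchy kernel
   1/(x + y), there are matrices V_c with
   <X, X - Psi X>_KMS = sum_c |[V_c, X]|_KMS^2.  In an eigenbasis of a Hermitian X
   the right-hand side is comparable to the energy of the eigenvalues on a
   weighted graph, whose conductance is controlled by the spectral projections,
   and the discrete Cheeger argument applies. *)

Require Import Defs.
From mathcomp Require Import all_boot all_order all_algebra.
From mathcomp Require Import complex mxtens.
From mathcomp Require Import boolp classical_sets reals ereal topology.
From mathcomp Require Import normedtype sequences exp.
From mathcomp Require Import functions derive realfun.
From mathcomp Require Import ring lra.

Set Implicit Arguments.
Unset Strict Implicit.
Unset Printing Implicit Defensive.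

Import Order.TTheory GRing.Theory Num.Theory.
Import numFieldNormedType.Exports.
Local Open Scope ring_scope.
Local Open Scope sesquilinear_scope.
Local Open Scope complex_scope.

(** The obstacle is uniformity in m: the spectrum of D_R may come arbitrarily close to 0, so no
    fixed norm compares the two entropies. Both quadratic bounds are therefore weighted by the
    spectrum of D_R itself, which the dual map preserves. Homogeneity of the logarithmic mean
    removes D_rho from the weights at the price of 1/s_-, and the domination by n (1 (x) D_R)
    involves only the dimension of the first factor. Since H(T E|E) is quadratic in (Id - T)(E -
    sigma), the gap lambda/gamma of Id - Psi enters squared; hence gamma (lambda/gamma)^2. The
    factor 4n collects 2n from the lower bound and 2 from 2 beta; s_-/s_+ is the loss between the
    KMS and Hilbert-Schmidt norms. In the Cheeger part the KMS norm is not diagonal in an eigenbasis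
    of X. Commutators are measured in the Frobenius norm instead: the graph has conductance at least
    h/s_+ and degree constant at most ||L||/s_-, and returning to the KMS energy costs another s_-,
    which gives h^2 s_-^2 / (2 s_+^2 ||L||). *)

Local Notation Re := complex.Re.
Local Notation Im := complex.Im.

Local Notation "z ^cj" := (@conjc _ z) (at level 1, format "z ^cj").

(** * Complex numbers, adjoints and the Frobenius norm *)

Section ComplexNumbers.
Context {R : realType}.
Implicit Types (x y : R) (z w : R[i]).

Definition normsq z : R := Re z ^+ 2 + Im z ^+ 2.

Lemma normsq_ge0 z : 0 <= normsq z.
Proof. by rewrite addr_ge0 ?sqr_ge0. Qed.

Lemma mulzJ z : z * z^cj = (normsq z)%:C.
Proof.
by case: z => a b; apply/eqP; rewrite eq_complex /normsq /=; apply/andP; split; apply/eqP; ring.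
Qed.

Lemma ReD z w : Re (z + w) = Re z + Re w.
Proof. by case: z w => [a b] [c d]. Qed.

Lemma ReN z : Re (- z) = - Re z.
Proof. by case: z. Qed.

Lemma ReB z w : Re (z - w) = Re z - Re w.
Proof. by rewrite ReD ReN. Qed.

Lemma ReZ x z : Re (x%:C * z) = x * Re z.
Proof. by case: z => a b /=; rewrite mul0r subr0. Qed.

Lemma Re_sum (I : Type) (r : seq I) (P : pred I) (F : I -> R[i]) :
  Re (\sum_(i <- r | P i) F i) = \sum_(i <- r | P i) Re (F i).
Proof. by apply: (big_morph _ ReD). Qed.

Lemma ReJ z : Re z^cj = Re z.
Proof. by case: z. Qed.

Lemma normsqE z : normsq z = Re (z^cj * z).
Proof. by rewrite mulrC mulzJ. Qed.

Lemma normsqM z w : normsq (z * w) = normsq z * normsq w.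
Proof. by case: z w => [a b] [c d]; rewrite /normsq /=; ring. Qed.

Lemma normsqJ z : normsq z^cj = normsq z.
Proof. by case: z => [a b]; rewrite /normsq /= sqrrN. Qed.

Lemma normsqN z : normsq (- z) = normsq z.
Proof. by case: z => [a b]; rewrite /normsq /= !sqrrN. Qed.

Lemma normsqR x : normsq x%:C = x ^+ 2.
Proof. by rewrite /normsq /= expr0n /= addr0. Qed.

Lemma normsq_eq0 z : (normsq z == 0) = (z == 0).
Proof. by rewrite eq_complex /= paddr_eq0 ?sqr_ge0 // !sqrf_eq0. Qed.

Lemma Re_mulJ_le z w : 2 * Re (z^cj * w) <= normsq z + normsq w.
Proof.
case: z w => [a b] [c d]; rewrite /normsq /=.
have := sqr_ge0 (a - c); have := sqr_ge0 (b - d).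
nra.
Qed.

Lemma conjcM z w : (z * w)^cj = z^cj * w^cj.
Proof. exact: (rmorphM (@conjc R)). Qed.

Lemma conjc_sum (I : Type) (r : seq I) (F : I -> R[i]) :
  (\sum_(i <- r) F i)^cj = \sum_(i <- r) (F i)^cj.
Proof. exact: (rmorph_sum (@conjc R)). Qed.

End ComplexNumbers.

(* Same as [^t*], whose output type is over the closed field structure of R[i]
   and makes unification of products of matrices expensive. *)
Definition adj {R : realType} m n (A : 'M[R[i]]_(m, n)) : 'M[R[i]]_(n, m) :=
  (A ^t*).
Local Notation "A ^H" := (adj A) (at level 30).

Section Adjoint.
Context {R : realType}.
Local Notation C := R[i].

Lemma adjE m n (A : 'M[C]_(m, n)) : A ^t* = A ^H.
Proof. by []. Qed.

Lemma adjmxK m n (A : 'M[C]_(m, n)) : A ^H ^H = A.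
Proof. exact: trmxCK. Qed.

Lemma adjmxE m n (A : 'M[C]_(m, n)) i j : (A ^H) i j = (A j i)^cj.
Proof. by rewrite /adj !mxE. Qed.

Lemma adjmxM m n p (A : 'M[C]_(m, n)) (B : 'M_(n, p)) :
  (A *m B) ^H = B ^H *m A ^H.
Proof. by rewrite /adj trmx_mul map_mxM. Qed.

Lemma adjmxD m n (A B : 'M[C]_(m, n)) : (A + B) ^H = A ^H + B ^H.
Proof. by rewrite /adj raddfD /= map_mxD. Qed.

Lemma adjmxN m n (A : 'M[C]_(m, n)) : (- A) ^H = - A ^H.
Proof. by rewrite /adj raddfN /= map_mxN. Qed.

Lemma adjmxB m n (A B : 'M[C]_(m, n)) : (A - B) ^H = A ^H - B ^H.
Proof. by rewrite adjmxD adjmxN. Qed.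

Lemma adjmxZ m n (a : C) (A : 'M[C]_(m, n)) : (a *: A) ^H = a^cj *: A ^H.
Proof. by rewrite /adj linearZ /= map_mxZ. Qed.

Lemma adjmx1 n : (1%:M : 'M[C]_n) ^H = 1%:M.
Proof. by rewrite /adj trmx1 map_mx1. Qed.

Lemma adjmx_sum (I : Type) (r : seq I) (P : pred I) m n (F : I -> 'M[C]_(m, n)) :
  (\sum_(i <- r | P i) F i) ^H = \sum_(i <- r | P i) (F i) ^H.
Proof.
by apply: (big_morph (fun A : 'M[C]_(m, n) => A ^H)); [exact: adjmxD | rewrite /adj trmx0 map_mx0].
Qed.

Lemma mxtrace_adj n (A : 'M[C]_n) : \tr (A ^H) = (\tr A)^cj.
Proof.
by rewrite /mxtrace [RHS](rmorph_sum (@conjc R)); apply: eq_bigr => i _; rewrite adjmxE.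
Qed.

Lemma hermP n (A : 'M[C]_n) : reflect (A ^H = A) (A \is hermsymmx).
Proof. by rewrite is_hermitianmxE expr0 scale1r eq_sym; apply: eqP. Qed.

Definition unitary n (U : 'M[C]_n) : Prop :=
  U *m U ^H = 1%:M /\ U ^H *m U = 1%:M.

Lemma unitary_spectralmx n (A : 'M[C]_n) : unitary (spectralmx A).
Proof.
have /unitarymxP := spectral_unitarymx A; rewrite adjE => UU.
by split; [exact: UU | exact: mulmx1C].
Qed.

Lemma unitary_adj n (U : 'M[C]_n) : unitary U -> unitary (U ^H).
Proof. by move=> [U1 U2]; split; rewrite adjmxK. Qed.

Lemma unitaryM n (U V : 'M[C]_n) : unitary U -> unitary V -> unitary (U *m V).
Proof.
move=> [U1 U2] [V1 V2]; split; rewrite adjmxM !mulmxA.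
  by rewrite -(mulmxA U) V1 mulmx1.
by rewrite -(mulmxA (V ^H)) U2 mulmx1.
Qed.

Lemma mulmxE m n p (A : 'M[C]_(m, n)) (B : 'M[C]_(n, p)) i j :
  (A *m B) i j = \sum_k A i k * B k j.
Proof. by rewrite mxE. Qed.

Lemma mxtraceE n (A : 'M[C]_n) : \tr A = \sum_i A i i.
Proof. by []. Qed.

Lemma posdefP n (A : 'M[C]_n) : posdefmx A <->
  A ^H = A /\ forall v : 'rV_n, v != 0 -> 0 < (v *m A *m v ^H) 0 0.
Proof. by split=> -[/hermP hA A0]; split=> //; apply/hermP. Qed.

Lemma psdP n (A : 'M[C]_n) : psdmx A <->
  A ^H = A /\ forall v : 'rV_n, 0 <= (v *m A *m v ^H) 0 0.
Proof. by split=> -[/hermP hA A0]; split=> //; apply/hermP. Qed.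

Definition frobsq m n (A : 'M[C]_(m, n)) : R := \sum_i \sum_j normsq (A i j).

Lemma frobsq_ge0 m n (A : 'M[C]_(m, n)) : 0 <= frobsq A.
Proof. by do 2!apply: sumr_ge0 => ? _; apply: normsq_ge0. Qed.

Lemma mxtrace_adjM m n (A B : 'M[C]_(m, n)) :
  \tr (A ^H *m B) = \sum_i \sum_j (A i j)^cj * B i j.
Proof.
rewrite /mxtrace [RHS]exchange_big /=; apply: eq_bigr => j _.
by rewrite mxE; apply: eq_bigr => i _; rewrite adjmxE.
Qed.

Lemma frobsqE m n (A : 'M[C]_(m, n)) : frobsq A = Re (\tr (A ^H *m A)).
Proof.
rewrite mxtrace_adjM Re_sum; apply: eq_bigr => i _.
by rewrite Re_sum; apply: eq_bigr => j _; rewrite normsqE.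
Qed.

Lemma frobsq_unitary n (U V A : 'M[C]_n) : unitary U -> unitary V ->
  frobsq (U *m A *m V ^H) = frobsq A.
Proof.
move=> [_ U1] [_ V1].
rewrite !frobsqE !adjmxM adjmxK -!mulmxA mxtrace_mulC -!mulmxA V1 mulmx1.
by rewrite (mulmxA (U ^H)) U1 mul1mx.
Qed.

Lemma frobsqN m n (A : 'M[C]_(m, n)) : frobsq (- A) = frobsq A.
Proof. by do 2![apply: eq_bigr => ? _]; rewrite mxE normsqN. Qed.

Lemma frobsq_eq0 m n (A : 'M[C]_(m, n)) : frobsq A = 0 -> A = 0.
Proof.
move=> /eqP; rewrite psumr_eq0 => [/allP A0|i _]; last first.
  by apply: sumr_ge0 => j _; apply: normsq_ge0.
apply/matrixP => i j; rewrite mxE; have := A0 i (mem_index_enum i).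
rewrite psumr_eq0 => [/allP/(_ j (mem_index_enum j))|k _]; last exact: normsq_ge0.
by rewrite /= normsq_eq0 => /eqP.
Qed.

Lemma mxtrace_nondeg n (A B : 'M[C]_n) :
  (forall Z, \tr (A ^H *m Z) = \tr (B ^H *m Z)) -> A = B.
Proof.
move=> AB; apply/eqP; rewrite -subr_eq0; apply/eqP/frobsq_eq0.
by rewrite frobsqE adjmxB mulmxBl raddfB /= AB subrr.
Qed.

Lemma frob_AMGM m n (A B : 'M[C]_(m, n)) :
  2 * Re (\tr (A ^H *m B)) <= frobsq A + frobsq B.
Proof.
rewrite mxtrace_adjM Re_sum mulr_sumr -big_split /=; apply: ler_sum => i _.
rewrite Re_sum mulr_sumr -big_split /=; apply: ler_sum => j _.
exact: Re_mulJ_le.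
Qed.

End Adjoint.

(** * Spectral representations of Hermitian matrices *)

Section Spectral.
Context {R : realType}.
Local Notation C := R[i].

Definition diagR n (a : 'I_n -> R) : 'M[C]_n := diag_mx (\row_i (a i)%:C).

(** The eigenvalues form a function on indices, neither sorted nor distinct, so functional calculus
    is composition and several matrices can share one basis [U], including product bases. *)
Definition specmx n (U : 'M[C]_n) (a : 'I_n -> R) : 'M[C]_n :=
  U ^H *m diagR a *m U.

Lemma diagRE n (a : 'I_n -> R) i j : diagR a i j = (a i)%:C *+ (i == j).
Proof. by rewrite !mxE. Qed.

Lemma mul_diagR m n (a : 'I_m -> R) (A : 'M[C]_(m, n)) i j :
  (diagR a *m A) i j = (a i)%:C * A i j.
Proof. by rewrite mul_diag_mx !mxE. Qed.

Lemma mul_mx_diagR m n (a : 'I_n -> R) (A : 'M[C]_(m, n)) i j :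
  (A *m diagR a) i j = (a j)%:C * A i j.
Proof. by rewrite mul_mx_diag !mxE mulrC. Qed.

Lemma diagR_adj n (a : 'I_n -> R) : (diagR a) ^H = diagR a.
Proof.
apply/matrixP => i j; rewrite adjmxE !diagRE eq_sym.
by case: (eqVneq i j) => [->|_]; rewrite ?mulr1n ?mulr0n ?conjc0 ?conjc_real.
Qed.

Lemma diagRM n (a b : 'I_n -> R) : diagR a *m diagR b = diagR (fun i => a i * b i).
Proof.
apply/matrixP => i j; rewrite mul_diagR !diagRE.
by case: eqP => _; rewrite /= ?mulr1n ?mulr0n ?mulr0 // rmorphM.
Qed.

Lemma diagR1 n : diagR (fun _ : 'I_n => 1) = 1%:M.
Proof. by apply/matrixP => i j; rewrite diagRE !mxE. Qed.

Lemma specmx_adj n (U : 'M[C]_n) a : (specmx U a) ^H = specmx U a.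
Proof. by rewrite /specmx !adjmxM diagR_adj adjmxK mulmxA. Qed.

Lemma specmxM n (U : 'M[C]_n) a b : unitary U ->
  specmx U a *m specmx U b = specmx U (fun i => a i * b i).
Proof.
move=> [UU _].
rewrite /specmx -diagRM; move: (diagR a) (diagR b) => A B.
by rewrite !mulmxA -(mulmxA _ U) UU mulmx1.
Qed.

Lemma specmx1 n (U : 'M[C]_n) : unitary U -> specmx U (fun=> 1) = 1%:M.
Proof. by move=> [_ UU]; rewrite /specmx diagR1 mulmx1 UU. Qed.

Lemma specmx_comb n (U : 'M[C]_n) a b (x y : R) :
  specmx U (fun i => x * a i + y * b i) = x%:C *: specmx U a + y%:C *: specmx U b.
Proof.
rewrite /specmx.
have -> : diagR (fun i => x * a i + y * b i) = x%:C *: diagR a + y%:C *: diagR b.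
  apply/matrixP => i j; rewrite [RHS]mxE !(mxE, diagRE).
  by case: (i == j); rewrite ?mulr1n ?mulr0n ?mulr0 ?addr0 // rmorphD !rmorphM.
move: (diagR a) (diagR b) (x%:C) (y%:C) => A B {}x {}y.
by rewrite mulmxDr mulmxDl -!scalemxAr -!scalemxAl.
Qed.

Lemma eq_specmx n (U : 'M[C]_n) a b : a =1 b -> specmx U a = specmx U b.
Proof.
move=> ab; rewrite /specmx; suff -> : diagR a = diagR b by [].
by apply/matrixP => i j; rewrite !diagRE ab.
Qed.

Lemma specmxE n (U : 'M[C]_n) a : specmx U a = U ^H *m diagR a *m U.
Proof. by []. Qed.

Lemma conj_specmx n (U : 'M[C]_n) a : unitary U ->
  U *m specmx U a *m U ^H = diagR a.
Proof.
move=> [UU _].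
by rewrite /specmx !mulmxA UU mul1mx -mulmxA UU mulmx1.
Qed.

Lemma mxtrace_specmx_mul n (U X : 'M[C]_n) a :
  \tr (X *m specmx U a) = \sum_i (a i)%:C * (U *m X *m U ^H) i i.
Proof.
rewrite /specmx !mulmxA mxtrace_mulC !mulmxA /mxtrace.
by apply: eq_bigr => i _; rewrite mul_mx_diagR.
Qed.

Lemma mxtrace_specmx n (U : 'M[C]_n) a : unitary U ->
  \tr (specmx U a) = \sum_i (a i)%:C.
Proof.
move=> uU; rewrite -[specmx U a]mul1mx mxtrace_specmx_mul mulmx1.
by case: uU => -> _; apply: eq_bigr => i _; rewrite mxE eqxx mulr1.
Qed.

(** [funcalc] is tied to the basis [spectralmx A]. Packaging this basis with its eigenvalues and
    with every [funcalc f A] lets later proofs speak of [specmx] alone. *)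
Lemma herm_specmx n (A : 'M[C]_n) : A ^H = A ->
  exists U a, [/\ unitary U, A = specmx U a &
    forall f, funcalc f A = specmx U (f \o a)].
Proof.
move=> /hermP hA; have uU' := spectral_unitarymx A; have uU := unitary_spectralmx A.
pose a i := Re (spectral_diag A 0 i); exists (spectralmx A), a.
have realA i : (a i)%:C = spectral_diag A 0 i.
  rewrite RRe_real //.
  by have /mxOverP := hermitian_spectral_diag_real hA; apply.
split; [exact: uU| |move=> f]; last first.
  rewrite /funcalc /specmx (invmx_unitary uU') adjE.
  suff -> : map_mx (fun z => (f (Re z))%:C) (spectral_diag A) =
    \row_i ((f \o a) i)%:C by [].
  by apply/rowP => i; rewrite !mxE.
have /orthomx_spectralP {1}-> := hermitian_normalmx hA.
rewrite /specmx (invmx_unitary uU') adjE /diagR.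
suff <- : spectral_diag A = \row_i (a i)%:C by [].
by apply/rowP => i; rewrite mxE realA.
Qed.

Lemma quad_specmx n (U : 'M[C]_n) a (v : 'rV[C]_n) :
  (v *m specmx U a *m v ^H) 0 0 = (\sum_i a i * normsq ((v *m U ^H) 0 i))%:C.
Proof.
rewrite /specmx !mulmxA -(mulmxA _ U) mxE rmorph_sum; apply: eq_bigr => i _.
rewrite mul_mx_diagR -[U *m _]adjmxK adjmxM adjmxK adjmxE rmorphM /= -mulzJ.
by rewrite mulrA.
Qed.

Lemma specmx_eigen n (U : 'M[C]_n) a i : unitary U ->
  let v := row i U in v != 0 /\ (v *m specmx U a *m v ^H) 0 0 = (a i)%:C.
Proof.
move=> uU v; have [UU _] := uU.
have vU : v *m U ^H = row i 1%:M by rewrite -row_mul UU.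
split; last first.
  rewrite quad_specmx (bigD1 i) //= vU !mxE eqxx normsqR expr1n mulr1.
  rewrite big1 ?addr0 // => j ji; rewrite !mxE eq_sym (negbTE ji).
  by rewrite /normsq /= expr0n /= addr0 mulr0.
apply/eqP => v0; move: vU; rewrite v0 mul0mx => /rowP/(_ i).
by rewrite !mxE eqxx => /eqP; rewrite eq_sym oner_eq0.
Qed.

Lemma posdef_specmx n (A : 'M[C]_n) : posdefmx A ->
  exists U a, [/\ unitary U, A = specmx U a, forall i, 0 < a i &
    forall f, funcalc f A = specmx U (f \o a)].
Proof.
move=> /posdefP[hA posA]; have [U [a [uU AE fE]]] := herm_specmx hA.
exists U, a; split=> // i; have [v0 vE] := specmx_eigen a i uU.
by have := posA _ v0; rewrite AE vE ltcR.
Qed.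

Lemma psd_specmx n (A : 'M[C]_n) : psdmx A ->
  exists U a, [/\ unitary U, A = specmx U a & forall i, 0 <= a i].
Proof.
move=> /psdP[hA posA]; have [U [a [uU AE fE]]] := herm_specmx hA.
exists U, a; split=> // i; have [v0 vE] := specmx_eigen a i uU.
by have := posA (row i U); rewrite AE vE lecR.
Qed.

Lemma specmx_posdef n (U : 'M[C]_n) a : unitary U -> (forall i, 0 < a i) ->
  posdefmx (specmx U a).
Proof.
move=> uU a0; apply/posdefP; split; first exact: specmx_adj.
move=> v v0; rewrite quad_specmx ltcR; rewrite lt_def sumr_ge0 ?andbT; last first.
  by move=> i _; rewrite mulr_ge0 ?normsq_ge0 // ltW.
apply: contra_neq v0 => /eqP; rewrite psumr_eq0 => [/allP v0|i _]; last first.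
  by rewrite mulr_ge0 ?normsq_ge0 // ltW.
have [_ U1] := uU.
rewrite -[v]mulmx1 -U1 mulmxA; suff -> : v *m U ^H = 0 by rewrite mul0mx.
apply/rowP => i; have := v0 i (mem_index_enum i).
by rewrite mulf_eq0 gt_eqF //= normsq_eq0 => /eqP ->; rewrite mxE.
Qed.

Lemma psd_factor n (A : 'M[C]_n) : psdmx A -> exists B : 'M[C]_n, A = B ^H *m B.
Proof.
move=> /psd_specmx[U [a [uU -> a0]]]; exists (diagR (Num.sqrt \o a) *m U).
rewrite adjmxM diagR_adj mulmxA -(mulmxA (U ^H)) diagRM.
by apply: eq_specmx => i /=; rewrite -expr2 sqr_sqrtr.
Qed.

Lemma posdef_psd n (A : 'M[C]_n) : posdefmx A -> psdmx A.
Proof.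
move=> /posdefP[hA A0]; apply/psdP; split=> // v; have [->|v0] := eqVneq v 0; last exact/ltW/A0.
by rewrite mul0mx mul0mx mxE.
Qed.

Lemma factor_psd m n (B : 'M[C]_(m, n)) : psdmx (B ^H *m B).
Proof.
apply/psdP; split; first by rewrite adjmxM adjmxK.
move=> v; rewrite mulmxA -mulmxA -[B *m v ^H]adjmxK adjmxM adjmxK mxE.
by apply: sumr_ge0 => i _; rewrite adjmxE mulzJ lecR normsq_ge0.
Qed.

Lemma psd_trace_ge0 m n (A : 'M[C]_n) (Z : 'M[C]_(n, m)) : psdmx A ->
  0 <= Re (\tr (Z ^H *m A *m Z)).
Proof.
move=> /psd_factor[B ->]; rewrite mulmxA -mulmxA -adjmxM -frobsqE.
exact: frobsq_ge0.
Qed.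

End Spectral.

Local Opaque mulmx mxtrace adj specmx diagR.

(** * Integrals over [0, 1] through antiderivatives *)

Section NewtonIntegral.
Context {R : realType}.
Implicit Types (f g F : R -> R) (a b t v w x : R).

(* v is the integral of f over [0, 1], by way of an antiderivative. *)
Definition newton_int f v := exists F : R -> R,
  (forall t, 0 <= t <= 1 -> is_derive t 1 F (f t)) /\ F 1 - F 0 = v.

(** The mean value theorem exhibits the integral as a value of [f], so positivity, and with it
    monotonicity, needs no measure theory. *)
Lemma newton_int_ge0 f v : newton_int f v ->
  (forall t, 0 <= t <= 1 -> 0 <= f t) -> 0 <= v.
Proof.
move=> [F [dF <-]] f0.
have [c c01 ->] : exists2 c, c \in `[0, 1]%R & F 1 - F 0 = f c * (1 - 0).
  apply: MVT_segment => [|x|]; first exact: ler01.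
    by rewrite in_itv /= => /andP[x0 x1]; apply: dF; rewrite !ltW.
  apply: derivable_within_continuous => x; rewrite in_itv /= => x01.
  by have [] := dF x x01.
by rewrite subr0 mulr1; apply: f0; move: c01; rewrite in_itv.
Qed.

Lemma eq_newton_int f g v : newton_int f v ->
  (forall t, 0 <= t <= 1 -> f t = g t) -> newton_int g v.
Proof. by move=> [F [dF Fv]] fg; exists F; split=> // t t01; rewrite -fg //; apply: dF. Qed.

Lemma newton_int0 : newton_int (fun=> 0) 0.
Proof. by exists (cst 0); split=> [t _|]; [exact: is_derive_cst | rewrite subrr]. Qed.

Lemma newton_intD f g v w : newton_int f v -> newton_int g w ->
  newton_int (fun t => f t + g t) (v + w).
Proof.
move=> [F [dF <-]] [G [dG <-]]; exists (F + G); split=> [t t01|].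
  by apply: is_deriveD; [exact: dF | exact: dG].
by rewrite !fctE; ring.
Qed.

Lemma newton_intZ k f v : newton_int f v -> newton_int (fun t => k * f t) (k * v).
Proof.
move=> [F [dF <-]]; exists (k \*: F); split=> [t t01|].
  by apply: is_deriveZ; exact: dF.
by rewrite /= mulrBr.
Qed.

Lemma newton_intB f g v w : newton_int f v -> newton_int g w ->
  newton_int (fun t => f t - g t) (v - w).
Proof.
move=> fv /(newton_intZ (-1)) gw; rewrite -mulN1r.
by apply: eq_newton_int (newton_intD fv gw) _ => t _; rewrite mulN1r.
Qed.

Lemma newton_int_sum (I : Type) (r : seq I) (f : I -> R -> R) (v : I -> R) :
  (forall i, newton_int (f i) (v i)) ->
  newton_int (fun t => \sum_(i <- r) f i t) (\sum_(i <- r) v i).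
Proof.
move=> fv; elim: r => [|i r IHr].
  by rewrite big_nil; apply: eq_newton_int newton_int0 _ => t _; rewrite big_nil.
rewrite big_cons; apply: eq_newton_int (newton_intD (fv i) IHr) _ => t _.
by rewrite big_cons.
Qed.

Lemma newton_int_le f g v w : newton_int f v -> newton_int g w ->
  (forall t, 0 <= t <= 1 -> f t <= g t) -> v <= w.
Proof.
move=> fv gw fg; rewrite -subr_ge0; apply: newton_int_ge0 (newton_intB gw fv) _.
by move=> t t01; rewrite subr_ge0 fg.
Qed.

Lemma newton_int_cst v : newton_int (fun=> v) v.
Proof.
exists (v \*: id); split=> [t _|]; last by rewrite /= [v *: 1]mulr1 [v *: 0]mulr0 subr0.
by apply: is_derive_eq (is_deriveZ _ (is_derive_id _ _)) _; rewrite [LHS]mulr1.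
Qed.

Lemma newton_int_id : newton_int id (2^-1).
Proof.
exists (2^-1 \*: (id * id)); split=> [t _|].
  apply: is_derive_eq; rewrite /GRing.scale /=.
  by field.
rewrite !fctE; change (2^-1 * (1 * 1) - 2^-1 * (0 * 0) = 2^-1 :> R); by field.
Qed.

Lemma affine_gt0 a b t : 0 < a -> 0 < b -> 0 <= t <= 1 -> 0 < (1 - t) * a + t * b.
Proof.
move=> a0 b0 /andP[t0 t1].
have [->|t0'] := eqVneq t 0; first by nra.
have : 0 < t * b by rewrite mulr_gt0 // lt_def t0' t0.
have : 0 <= (1 - t) * a by rewrite mulr_ge0 ?subr_ge0 // ltW.
lra.
Qed.

Lemma is_derive_affine a b t :
  is_derive t 1 (fun t => (1 - t) * a + t * b) (b - a).
Proof.
have -> : (fun t => (1 - t) * a + t * b) = cst a + (b - a) \*: id.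
  apply/funext => s; rewrite !fctE.
  change ((1 - s) * a + s * b = a + (b - a) * s :> R); by ring.
apply: is_derive_eq.
by rewrite add0r; exact: mulr1.
Qed.

Lemma newton_int_ln a b : 0 < a -> 0 < b ->
  newton_int (fun t => (b - a) / ((1 - t) * a + t * b)) (ln b - ln a).
Proof.
move=> a0 b0; exists (fun t => ln ((1 - t) * a + t * b)); split=> [t t01|]; last first.
  by rewrite subrr subr0 mul0r add0r !mul1r mul0r addr0.
have dln := is_derive1_ln (affine_gt0 a0 b0 t01).
have d := @is_derive1_comp _ _ (fun t => (1 - t) * a + t * b) _ _ _ dln (is_derive_affine a b t).
by apply: is_derive_eq d _; rewrite mulrC.
Qed.

End NewtonIntegral.

(** * Integral formulas for the inverse logarithmic mean *)

Section LogMean.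
Context {R : realType}.
Implicit Types (a b c t v w x : R).

(** The divided difference of [ln], with its limit on the diagonal. It is the matrix of the
    derivative of the logarithm in an eigenbasis. *)
Definition inv_logmean a b := if a == b then a^-1 else (ln b - ln a) / (b - a).

Lemma newton_int_logmean a b : 0 < a -> 0 < b ->
  newton_int (fun t => ((1 - t) * a + t * b)^-1) (inv_logmean a b).
Proof.
move=> a0 b0; rewrite /inv_logmean; case: (eqVneq a b) => [<-|ab].
  by apply: eq_newton_int (newton_int_cst _) _ => t _; congr (_^-1); ring.
have ba0 : b - a != 0 by rewrite subr_eq0 eq_sym.
rewrite mulrC; apply: eq_newton_int (newton_intZ (b - a)^-1 (newton_int_ln a0 b0)) _.
by move=> t _; rewrite mulrA mulVf // mul1r.
Qed.

Lemma inv_logmean_ge0 a b : 0 < a -> 0 < b -> 0 <= inv_logmean a b.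
Proof.
move=> a0 b0; apply: newton_int_ge0 (newton_int_logmean a0 b0) _ => t t01.
by rewrite invr_ge0 ltW // affine_gt0.
Qed.

(** The integrand is antitone in both endpoints and homogeneous of degree -1. With [c] below the
    spectrum of the density, this strips the density from the weights of the product state and
    leaves those of the second factor. *)
Lemma inv_logmean_le a b a' b' c : 0 < a -> 0 < b -> 0 < c ->
  c * a <= a' -> c * b <= b' -> inv_logmean a' b' <= c^-1 * inv_logmean a b.
Proof.
move=> a0 b0 c0 aa bb.
have a'0 : 0 < a' by apply: lt_le_trans aa; rewrite mulr_gt0.
have b'0 : 0 < b' by apply: lt_le_trans bb; rewrite mulr_gt0.
apply: newton_int_le (newton_int_logmean a'0 b'0)
  (newton_intZ _ (newton_int_logmean a0 b0)) _ => t t01.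
rewrite -invfM lef_pV2 ?posrE ?mulr_gt0 ?affine_gt0 // mulrDr !(mulrCA c).
by case/andP: t01 => t0 t1; rewrite lerD // ler_wpM2l // subr_ge0.
Qed.

(** Reflecting t to 1 - t in the second term turns the integrand into 1/((1 - t) a + t b). The
    weight t is the one of the entropy formula; symmetrising in [a] and [b] recovers the logarithmic
    mean. *)
Lemma newton_int_sym a b : 0 < a -> 0 < b ->
  newton_int (fun t => t / ((1 - t) * a + t * b) + t / ((1 - t) * b + t * a))
    (inv_logmean a b).
Proof.
move=> a0 b0; have [<-|ab] := eqVneq a b.
  rewrite /inv_logmean eqxx -[a^-1](_ : (2 / a) * 2^-1 = _); last by field; rewrite gt_eqF.
  apply: eq_newton_int (newton_intZ _ newton_int_id) _ => t _ /=.
  have -> : (1 - t) * a + t * a = a by ring.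
  by field; rewrite gt_eqF.
have ab0 : a - b != 0 by rewrite subr_eq0.
have ba0 : b - a != 0 by rewrite subr_eq0 eq_sym.
(* Partial fractions in t: the constant parts 1/(b - a) and 1/(a - b) of the two terms cancel. *)
have I1 := newton_intZ (- a / (b - a)) (newton_int_logmean a0 b0).
have I2 := newton_intZ (- b / (a - b)) (newton_int_logmean b0 a0).
have E : inv_logmean b a = inv_logmean a b.
  rewrite /inv_logmean eq_sym (negbTE ab); field.
  by rewrite ab0 ba0.
rewrite -[inv_logmean a b](_ : - a / (b - a) * inv_logmean a b
  + - b / (a - b) * inv_logmean b a = _); last by rewrite E; field; rewrite ab0 ba0.
apply: eq_newton_int (newton_intD I1 I2) _ => t t01.
have := affine_gt0 a0 b0 t01; have := affine_gt0 b0 a0 t01.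
move=> /lt0r_neq0 h1 /lt0r_neq0 h2; field.
by rewrite ab0 ba0 h1 h2.
Qed.

(** This is the integral of 1/((s + a)(s + b)) over s > 0 after the substitution s = (1 - t)/t. *)
Lemma newton_int_resolvent a b : 0 < a -> 0 < b ->
  newton_int (fun t => (((1 - t) * 1 + t * a) * ((1 - t) * 1 + t * b))^-1)
    (inv_logmean a b).
Proof.
move=> a0 b0; have [<-|ab] := eqVneq a b; last first.
  have ab0 : a - b != 0 by rewrite subr_eq0.
  have ba0 : b - a != 0 by rewrite subr_eq0 eq_sym.
  have I := newton_intZ (b - a)^-1
    (newton_intB (newton_int_ln ltr01 b0) (newton_int_ln ltr01 a0)).
  rewrite /inv_logmean (negbTE ab) mulrC.
  rewrite -[ln b - ln a](_ : ln b - ln 1 - (ln a - ln 1) = _); last by ring.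
  apply: eq_newton_int I _ => t t01.
  have /lt0r_neq0 := affine_gt0 ltr01 a0 t01; have /lt0r_neq0 := affine_gt0 ltr01 b0 t01.
  by rewrite !mulr1 => h1 h2; field; rewrite ba0 h1 h2.
rewrite /inv_logmean eqxx; exists (fun t => t * ((1 - t) * 1 + t * a)^-1).
split=> [t t01|]; last by rewrite mul0r subr0 subrr mul0r add0r !mul1r.
have /lt0r_neq0 h := affine_gt0 ltr01 a0 t01.
have dV := @is_deriveV _ (fun t => (1 - t) * 1 + t * a) t _ _ h (is_derive_affine 1 a t).
have d := is_deriveM (is_derive_id t 1) dV.
apply: is_derive_eq d _.
set u := _ + t * a in h *.
change (t * (- u ^- 2 * (a - 1)) + u^-1 * 1 = (u * u)^-1 :> R).
have -> : t * (- u ^- 2 * (a - 1)) = (1 - u) * u ^- 2 by rewrite /u; ring.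
by field.
Qed.

(** With u = (1 - t) a + t b, the plain integrand is (a - b)(a - u)/u, and a - u = t (a - b)
    produces both the square and the weight t. *)
Lemma newton_int_entropy a b : 0 < a -> 0 < b ->
  newton_int (fun t => t * ((a - b) ^+ 2 / ((1 - t) * a + t * b)))
    (a * (ln a - ln b) - (a - b)).
Proof.
move=> a0 b0.
have I := newton_intB (newton_intZ (- a) (newton_int_ln a0 b0)) (newton_int_cst (a - b)).
rewrite -[a * (ln a - ln b)](_ : - a * (ln b - ln a) = _); last by ring.
apply: eq_newton_int I _ => t t01.
by have /lt0r_neq0 h := affine_gt0 a0 b0 t01; field.
Qed.

End LogMean.

(** * Maps in Kraus form and their Hilbert-Schmidt duals *)

Section Kraus.
Context {R : realType} {n : nat} {J : finType}.
Local Notation C := R[i].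
Implicit Types (K : J -> 'M[C]_n) (X Z A : 'M[C]_n).

Definition kraus K X : 'M[C]_n := \sum_j K j *m X *m (K j) ^H.

Definition kraus_dual K X : 'M[C]_n := \sum_j (K j) ^H *m X *m K j.

Lemma krausD K X Z : kraus K (X + Z) = kraus K X + kraus K Z.
Proof. by rewrite /kraus -big_split; apply: eq_bigr => j _; rewrite mulmxDr mulmxDl. Qed.

Lemma kraus_dualB K X Z : kraus_dual K (X - Z) = kraus_dual K X - kraus_dual K Z.
Proof. by rewrite /kraus_dual -sumrB; apply: eq_bigr => j _; rewrite mulmxBr mulmxBl. Qed.

Lemma kraus_adj K X : kraus K (X ^H) = (kraus K X) ^H.
Proof.
by rewrite /kraus adjmx_sum; apply: eq_bigr => j _; rewrite !adjmxM adjmxK mulmxA.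
Qed.

Lemma kraus_dual_adj K X : kraus_dual K (X ^H) = (kraus_dual K X) ^H.
Proof.
by rewrite /kraus_dual adjmx_sum; apply: eq_bigr => j _; rewrite !adjmxM adjmxK mulmxA.
Qed.

Lemma kraus_dualP K X Z : \tr (kraus_dual K X *m Z) = \tr (X *m kraus K Z).
Proof.
rewrite /kraus_dual /kraus mulmx_suml mulmx_sumr !raddf_sum; apply: eq_bigr => j _.
by rewrite /= -!mulmxA [LHS]mxtrace_mulC !mulmxA.
Qed.

Lemma mxtrace_kraus_dual K X : kraus K 1%:M = 1%:M -> \tr (kraus_dual K X) = \tr X.
Proof. by move=> K1; rewrite -[kraus_dual K X]mulmx1 kraus_dualP K1 mulmx1. Qed.

(** The Kadison-Schwarz inequality with an explicit remainder. When the squares are expanded, each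
    cross term and the last term sum to [P *m P ^H] up to sign, by unitality, and one negative copy
    survives. *)
Lemma kraus_defect K Z : kraus K 1%:M = 1%:M ->
  kraus K (Z *m Z ^H) - kraus K Z *m (kraus K Z) ^H =
  \sum_j (K j *m Z - kraus K Z *m K j) *m (K j *m Z - kraus K Z *m K j) ^H.
Proof.
move=> K1; set P := kraus K Z.
have K1' : \sum_j K j *m (K j) ^H = 1%:M.
  by rewrite -[RHS]K1; apply: eq_bigr => j _; rewrite mulmx1.
have E1 : \sum_j P *m (K j *m (K j) ^H) *m P ^H = P *m P ^H.
  by rewrite -mulmx_suml -mulmx_sumr K1' mulmx1.
have E2 : \sum_j P *m (K j *m Z ^H *m (K j) ^H) = P *m P ^H.
  by rewrite -mulmx_sumr -kraus_adj.
have E3 : \sum_j (K j *m Z *m (K j) ^H) *m P ^H = P *m P ^H.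
  by rewrite -mulmx_suml.
transitivity (kraus K (Z *m Z ^H) - P *m P ^H - P *m P ^H + P *m P ^H).
  by rewrite subrK.
rewrite -{1}E2 -{1}E3 -E1 /kraus -!sumrB -big_split; apply: eq_bigr => j _ /=.
rewrite adjmxB !adjmxM mulmxBl !mulmxBr !mulmxA.
move: (K j *m Z *m Z ^H *m (K j) ^H) (P *m K j *m Z ^H *m (K j) ^H).
move: (K j *m Z *m (K j) ^H *m P ^H) (P *m K j *m (K j) ^H *m P ^H).
by move=> x y z w; rewrite opprD opprK addrA (addrAC z).
Qed.

End Kraus.

(** * Relative entropy: variational formula, monotonicity and quadratic bounds *)

Section Entropy.
Context {R : realType} {n : nat}.
Local Notation C := R[i].
Implicit Types (A B D U V X Y Z : 'M[C]_n).

Lemma psd_mul_trace_ge0 A B : psdmx A -> psdmx B -> 0 <= Re (\tr (A *m B)).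
Proof.
move=> psdA /psd_factor[F ->].
rewrite mulmxA mxtrace_mulC mulmxA -{1}[F]adjmxK.
exact: psd_trace_ge0.
Qed.

Lemma kraus_schwarz {J : finType} (K : J -> 'M[C]_n) A Z : psdmx A ->
  kraus K 1%:M = 1%:M ->
  Re (\tr (A *m (kraus K Z *m (kraus K Z) ^H))) <= Re (\tr (A *m kraus K (Z *m Z ^H))).
Proof.
move=> psdA K1; rewrite -subr_ge0 -ReB -raddfB /= -mulmxBr kraus_defect //.
rewrite mulmx_sumr (raddf_sum (@mxtrace _ _)) /= Re_sum; apply: sumr_ge0 => j _.
apply: psd_mul_trace_ge0 => //.
by rewrite -{1}[_ - _]adjmxK; apply: factor_psd.
Qed.

(** For unitary [U] and [V] the squared overlaps of the two eigenbases are doubly stochastic; with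
    them as weights, quantum quantities become classical double sums. *)
Lemma mxtrace_specmx2 U V (f g : 'I_n -> R) :
  Re (\tr (specmx U f *m specmx V g)) =
  \sum_i \sum_j f i * g j * normsq ((U *m V ^H) i j).
Proof.
rewrite mxtrace_specmx_mul Re_sum exchange_big /=; apply: eq_bigr => j _.
rewrite ReZ specmxE !mulmxA -(mulmxA _ U) mulmxE Re_sum mulr_sumr.
apply: eq_bigr => i _; rewrite mul_mx_diagR -[V *m U ^H]adjmxK adjmxM adjmxK.
by rewrite adjmxE -mulrA ReZ -normsqE; ring.
Qed.

Lemma unitary_row_sum U i : unitary U -> \sum_j normsq (U i j) = 1.
Proof.
move=> [/matrixP/(_ i i) + _]; rewrite mulmxE mxE eqxx => /(congr1 (@complex.Re R)).
rewrite Re_sum => UU; rewrite -[RHS]UU; apply: eq_bigr => j _.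
by rewrite adjmxE mulzJ.
Qed.

Lemma mxtrace_specmxl U V (f : 'I_n -> R) : unitary U -> unitary V ->
  Re (\tr (specmx U f)) = \sum_i \sum_j f i * normsq ((U *m V ^H) i j).
Proof.
move=> uU uV; rewrite (mxtrace_specmx f uU) Re_sum; apply: eq_bigr => i _.
have uUV : unitary (U *m V ^H) by apply: unitaryM => //; apply: unitary_adj.
by rewrite -mulr_sumr (unitary_row_sum i uUV) mulr1.
Qed.

Lemma mxtrace_specmxr U V (f : 'I_n -> R) : unitary U -> unitary V ->
  Re (\tr (specmx V f)) = \sum_i \sum_j f j * normsq ((U *m V ^H) i j).
Proof.
move=> uU uV; rewrite (mxtrace_specmxl f uV uU) exchange_big /=.
apply: eq_bigr => i _; apply: eq_bigr => j _; congr (_ * _).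
by rewrite -[V *m _]adjmxK adjmxM adjmxK adjmxE normsqJ.
Qed.

(** The quadratic terms are the form of (1 - t) times left multiplication by [A] plus t times right
    multiplication by [B]. The maximum over [Z] is a chi-square divergence, and linearity in (A, B)
    is what makes it interact well with Kraus maps. *)
Definition chi_val t A B Z : R :=
  2 * Re (\tr (Z ^H *m (A - B))) - (1 - t) * Re (\tr (A *m (Z *m Z ^H)))
  - t * Re (\tr (B *m (Z ^H *m Z))).

Lemma mxtrace_specmx_left U V (f : 'I_n -> R) X : unitary V ->
  unitary U ->
  Re (\tr (specmx U f *m ((U ^H *m X *m V) *m (U ^H *m X *m V) ^H))) = \sum_i \sum_j f i * normsq (X i j).
Proof.
move=> [VV _] [UU _].
rewrite mxtrace_mulC mxtrace_specmx_mul.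
have -> : U *m (U ^H *m X *m V *m (U ^H *m X *m V) ^H) *m U ^H = X *m X ^H.
  rewrite !adjmxM adjmxK !mulmxA UU mul1mx -(mulmxA X) VV mulmx1.
  by rewrite -(mulmxA _ U) UU mulmx1.
rewrite Re_sum; apply: eq_bigr => i _; rewrite ReZ mulmxE Re_sum mulr_sumr.
by apply: eq_bigr => j _; rewrite adjmxE mulzJ.
Qed.

Lemma mxtrace_specmx_right U V (f : 'I_n -> R) X : unitary V ->
  unitary U ->
  Re (\tr (specmx V f *m ((U ^H *m X *m V) ^H *m (U ^H *m X *m V)))) = \sum_i \sum_j f j * normsq (X i j).
Proof.
move=> uV uU; set Z := U ^H *m X *m V.
have := mxtrace_specmx_left f (X ^H) uU uV.
have -> : V ^H *m X ^H *m U = Z ^H by rewrite /Z !adjmxM adjmxK mulmxA.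
rewrite adjmxK => ->; rewrite exchange_big; apply: eq_bigr => i _.
by apply: eq_bigr => j _; rewrite adjmxE normsqJ.
Qed.

(** With rows in the eigenbasis of the first matrix and columns in that of the second, the
    functional decouples into one scalar quadratic per entry, each maximised on its own. *)
Lemma chi_valE t U V (a b : 'I_n -> R) X : unitary U -> unitary V ->
  chi_val t (specmx U a) (specmx V b) (U ^H *m X *m V) =
  \sum_i \sum_j (2 * ((a i - b j) * Re ((X i j)^cj * (U *m V ^H) i j))
     - ((1 - t) * a i + t * b j) * normsq (X i j)).
Proof.
move=> uU uV; have [[UU _] [VV _]] := (uU, uV).
rewrite /chi_val (mxtrace_specmx_left a X uV uU) (mxtrace_specmx_right b X uV uU).
have -> : \tr ((U ^H *m X *m V) ^H *m (specmx U a - specmx V b)) =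
    \tr (X ^H *m (diagR a *m (U *m V ^H) - (U *m V ^H) *m diagR b)).
  rewrite !adjmxM adjmxK -mulmxA mxtrace_mulC -!mulmxA.
  have -> : U *m ((specmx U a - specmx V b) *m V ^H) =
      diagR a *m (U *m V ^H) - U *m (V ^H *m diagR b); last by [].
  rewrite mulmxBl mulmxBr !specmxE !mulmxA UU mul1mx.
  by rewrite -(mulmxA _ V) VV mulmx1.
rewrite mxtrace_adjM Re_sum !mulr_sumr -!sumrB; apply: eq_bigr => i _.
rewrite Re_sum !mulr_sumr -!sumrB; apply: eq_bigr => j _.
have -> : (diagR a *m (U *m V ^H) - U *m V ^H *m diagR b) i j =
    (a i - b j)%:C * (U *m V ^H) i j.
  by rewrite rmorphB mulrBl -mul_diagR -mul_mx_diagR !mxE.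
by rewrite mulrCA ReZ; ring.
Qed.

Lemma quad_max_le (x m : R) (z w : C) : 0 < m ->
  2 * (x * Re (z^cj * w)) - m * normsq z <= x ^+ 2 / m * normsq w.
Proof.
move=> m0; case: z w => [p q] [u v]; rewrite /normsq /=.
rewrite -(ler_pM2l m0).
have -> : m * (x ^+ 2 / m * (u ^+ 2 + v ^+ 2)) = x ^+ 2 * (u ^+ 2 + v ^+ 2).
  by field; rewrite gt_eqF.
have := sqr_ge0 (m * p - x * u); have := sqr_ge0 (m * q - x * v).
nra.
Qed.

Lemma quad_max_eq (x m : R) (w : C) : 0 < m ->
  let z := (x / m)%:C * w in
  2 * (x * Re (z^cj * w)) - m * normsq z = x ^+ 2 / m * normsq w.
Proof.
move=> m0 z; case: w @z => [u v] z; rewrite /normsq /=.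
by field; rewrite gt_eqF.
Qed.

Lemma unitary_conjK U V Z : unitary U -> unitary V ->
  U ^H *m (U *m Z *m V ^H) *m V = Z.
Proof.
move=> [_ UU] [_ VV].
by rewrite !mulmxA UU mul1mx -mulmxA VV mulmx1.
Qed.

(* With x = b/a, [a (ln a - ln b)] is the integral over [0, 1] of
   [t (a - b)^2 / ((1 - t) a + t b)] up to a linear term, and the sum of these
   resolvent terms is the maximum over Z of a functional linear in (A, B). *)
Lemma entropy_variational A B : posdefmx A -> posdefmx B -> \tr A = \tr B ->
  exists c : R -> R, newton_int (fun t => t * c t) (relative_entropy A B) /\
    forall t, 0 <= t <= 1 ->
      (forall Z, chi_val t A B Z <= c t) /\ exists Z, chi_val t A B Z = c t.
Proof.
move=> posA posB trAB.
have [U [a [uU AE a0 fA]]] := posdef_specmx posA.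
have [V [b [uV BE b0 fB]]] := posdef_specmx posB.
pose m t i j := (1 - t) * a i + t * b j.
have m0 t i j : 0 <= t <= 1 -> 0 < m t i j by move=> t01; apply: affine_gt0.
pose W := U *m V ^H.
exists (fun t => \sum_i \sum_j (a i - b j) ^+ 2 / m t i j * normsq (W i j)).
split; last first.
  move=> t t01; split=> [Z|].
    rewrite -(unitary_conjK Z uU uV) AE BE (chi_valE _ _ _ _ uU uV).
    by do 2![apply: ler_sum => ? _]; apply: quad_max_le; apply: m0.
  exists (U ^H *m (\matrix_(i, j) (((a i - b j) / m t i j)%:C * W i j)) *m V).
  rewrite AE BE (chi_valE _ _ _ _ uU uV); apply: eq_bigr => i _; apply: eq_bigr => j _.
  by rewrite mxE quad_max_eq //; apply: m0.
have -> : relative_entropy A B =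
    \sum_i \sum_j normsq (W i j) * (a i * (ln (a i) - ln (b j)) - (a i - b j)).
  rewrite /relative_entropy /logmx fA fB mulmxBr raddfB /= ReB.
  rewrite [A in X in X - _ = _]AE (specmxM _ _ uU) AE mxtrace_specmx2.
  rewrite (mxtrace_specmxl _ uU uV).
  (* The vanishing difference of the traces is inserted because it supplies the linear correction of
     [newton_int_entropy]. *)
  transitivity (\sum_i \sum_j normsq (W i j) * (a i * (ln (a i) - ln (b j)))
      - (Re (\tr A) - Re (\tr B))).
    rewrite trAB subrr subr0 -sumrB; apply: eq_bigr => i _.
    by rewrite -sumrB; apply: eq_bigr => j _ /=; rewrite -/W; ring.
  rewrite [in X in _ - (X - _)]AE BE (mxtrace_specmxl _ uU uV) (mxtrace_specmxr _ uU uV) -!sumrB.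
  by apply: eq_bigr => i _; rewrite -!sumrB; apply: eq_bigr => j _; rewrite -/W; ring.
apply: eq_newton_int.
  apply: newton_int_sum => i; apply: newton_int_sum => j.
  exact: newton_intZ (newton_int_entropy (a0 i) (b0 j)).
move=> t _ /=; rewrite mulr_sumr; apply: eq_bigr => i _.
by rewrite mulr_sumr; apply: eq_bigr => j _; rewrite /m; ring.
Qed.

(** Duality moves the map onto [Z] exactly in the linear term, and up to Kadison-Schwarz in the
    quadratic ones: for [Z] against [A] and for [Z ^H] against [B]. *)
Lemma chi_val_kraus_le {J : finType} (K : J -> 'M[C]_n) t A B Z :
  psdmx A -> psdmx B -> kraus K 1%:M = 1%:M -> 0 <= t <= 1 ->
  chi_val t (kraus_dual K A) (kraus_dual K B) Z <= chi_val t A B (kraus K Z).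
Proof.
move=> psdA psdB K1 /andP[t0 t1]; rewrite /chi_val.
have -> : \tr (Z ^H *m (kraus_dual K A - kraus_dual K B)) =
    \tr ((kraus K Z) ^H *m (A - B)).
  by rewrite -kraus_dualB mxtrace_mulC kraus_dualP kraus_adj mxtrace_mulC.
rewrite !kraus_dualP; apply: lerB; first apply: lerB => //.
  by apply: ler_wpM2l; [rewrite subr_ge0 | apply: kraus_schwarz].
apply: ler_wpM2l => //.
have := kraus_schwarz (Z ^H) psdB K1.
by rewrite kraus_adj !adjmxK.
Qed.

(** Data processing at each level t: an optimal [Z] for the image pair yields the competitor
    [kraus K Z] for the original pair. *)
Lemma entropy_monotone {J : finType} (K : J -> 'M[C]_n) A B :
  posdefmx A -> posdefmx B -> \tr A = \tr B -> kraus K 1%:M = 1%:M ->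
  posdefmx (kraus_dual K A) -> posdefmx (kraus_dual K B) ->
  relative_entropy (kraus_dual K A) (kraus_dual K B) <= relative_entropy A B.
Proof.
move=> posA posB trAB K1 posKA posKB.
have trK : \tr (kraus_dual K A) = \tr (kraus_dual K B).
  by rewrite !mxtrace_kraus_dual.
have [c [Ic cP]] := entropy_variational posA posB trAB.
have [k [Ik kP]] := entropy_variational posKA posKB trK.
apply: newton_int_le Ik Ic _ => t t01; have /andP[t0 _] := t01.
apply: ler_wpM2l => //; have [_ [Z <-]] := kP t t01.
apply: le_trans (proj1 (cP t t01) (kraus K Z)).
by apply: chi_val_kraus_le => //; apply: posdef_psd.
Qed.

(** The last two hypotheses say that [A] and [B] are at most [c] times [specmx U w]. The variational
    formula is tested at the [Z] that would be optimal if both quadratic terms carried this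
    dominating matrix, so that level t contributes |Y_ij|^2 / (c m_ij). As |Y_ij| is symmetric, the
    weight t symmetrises to half a logarithmic mean, whence the 2 in [(2 * c)^-1]. *)
Lemma entropy_lower U (w : 'I_n -> R) (c : R) A B (Y := U *m (A - B) *m U ^H) :
  posdefmx A -> posdefmx B -> \tr A = \tr B ->
  unitary U -> (forall i, 0 < w i) -> 0 < c ->
  (forall Z, Re (\tr (A *m (Z *m Z ^H))) <= c * Re (\tr (specmx U w *m (Z *m Z ^H)))) ->
  (forall Z, Re (\tr (B *m (Z *m Z ^H))) <= c * Re (\tr (specmx U w *m (Z *m Z ^H)))) ->
  (2 * c)^-1 * \sum_i \sum_j normsq (Y i j) * inv_logmean (w i) (w j)
    <= relative_entropy A B.
Proof.
move=> posA posB trAB uU w0 c0 Ac Bc.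
have [k [Ik kP]] := entropy_variational posA posB trAB.
pose m t i j := (1 - t) * w i + t * w j.
have m0 t i j : 0 <= t <= 1 -> 0 < m t i j by move=> t01; apply: affine_gt0.
have Ysym i j : normsq (Y i j) = normsq (Y j i).
  suff YH : Y ^H = Y by rewrite -normsqJ -adjmxE YH.
  have [/posdefP[hA _] /posdefP[hB _]] := (posA, posB).
  by rewrite /Y !adjmxM adjmxK adjmxB hA hB mulmxA.
have I := newton_intZ (2 * c)^-1 (newton_int_sum (index_enum _) (fun i =>
  newton_int_sum (index_enum _) (fun j =>
    newton_intZ (normsq (Y i j)) (newton_int_sym (w0 i) (w0 j))))).
apply: newton_int_le I Ik _ => t t01; have /andP[t0 t1] := t01.
have -> : (2 * c)^-1 * \sum_i \sum_j normsq (Y i j) * (t / ((1 - t) * w i + t * w j)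
      + t / ((1 - t) * w j + t * w i)) =
    t * \sum_i \sum_j (c^-1) ^+ 2 * (c / m t i j * normsq (Y i j)).
  have E : \sum_i \sum_j normsq (Y i j) * (t / m t j i) =
      \sum_i \sum_j normsq (Y i j) * (t / m t i j).
    by rewrite exchange_big; do 2![apply: eq_bigr => ? _]; rewrite Ysym.
  transitivity ((2 * c)^-1 * (\sum_i \sum_j normsq (Y i j) * (t / m t i j)
      + \sum_i \sum_j normsq (Y i j) * (t / m t j i))).
    congr (_ * _); rewrite -big_split; apply: eq_bigr => i _.
    by rewrite -big_split; apply: eq_bigr => j _ /=; rewrite mulrDr.
  rewrite E; have -> x : (2 * c)^-1 * (x + x) = c^-1 * x.
    by field; rewrite gt_eqF.
  rewrite !mulr_sumr; apply: eq_bigr => i _.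
  rewrite !mulr_sumr; apply: eq_bigr => j _.
  have /lt0r_neq0 mij := m0 t i j t01.
  by field; rewrite mij gt_eqF.
apply: ler_wpM2l => //.
pose X : 'M[C]_n := \matrix_(i, j) ((c^-1 / m t i j)%:C * Y i j).
apply: le_trans (proj1 (kP t t01) (U ^H *m X *m U)).
have [UU U1] := uU.
set Z := U ^H *m X *m U.
have EY : \tr (Z ^H *m (A - B)) = \tr (X ^H *m Y).
  rewrite /Z /Y !adjmxM adjmxK -!mulmxA mxtrace_mulC.
  by rewrite -!mulmxA.
have lower : 2 * Re (\tr (X ^H *m Y)) - c * ((1 - t) * (\sum_i \sum_j w i * normsq (X i j))
    + t * (\sum_i \sum_j w j * normsq (X i j))) <= chi_val t A B Z.
  have hA : Re (\tr (A *m (Z *m Z ^H))) <= c * (\sum_i \sum_j w i * normsq (X i j)).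
    by rewrite -(mxtrace_specmx_left w X uU uU); apply: Ac.
  have hB : Re (\tr (B *m (Z ^H *m Z))) <= c * (\sum_i \sum_j w j * normsq (X i j)).
    by rewrite -(mxtrace_specmx_right w X uU uU) -{2}[Z]adjmxK -{2}[U ^H *m X *m U]adjmxK; apply: Bc.
  rewrite /chi_val EY; move: hA hB.
  have t1' : 0 <= 1 - t by rewrite subr_ge0.
  have gen (x y z x' y' : R) : y <= c * x' -> z <= c * y' ->
      x - c * ((1 - t) * x' + t * y') <= x - (1 - t) * y - t * z.
    by move=> /(ler_wpM2l t1') h1 /(ler_wpM2l t0) h2; lra.
  exact: gen.
apply: le_trans lower; rewrite le_eqVlt; apply/orP; left; apply/eqP.
rewrite mxtrace_adjM Re_sum !mulr_sumr -big_split !mulr_sumr -sumrB.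
apply: eq_bigr => i _ /=; rewrite Re_sum !mulr_sumr -big_split !mulr_sumr -sumrB.
apply: eq_bigr => j _ /=.
have -> : X i j = (c^-1 / m t i j)%:C * Y i j by rewrite mxE.
have /lt0r_neq0 mij := m0 t i j t01.
case: (Y i j) => p q; rewrite /normsq /=; rewrite /m in mij *.
by field; rewrite mij gt_eqF.
Qed.

Lemma resolvent_specmx U (a : 'I_n -> R) t : unitary U -> (forall i, 0 < a i) ->
  0 <= t <= 1 ->
  let r i := ((1 - t) * 1 + t * a i)^-1 in
  (1%:M + t%:C *: (specmx U a - 1%:M)) *m specmx U r = 1%:M /\
  specmx U r *m (1%:M + t%:C *: (specmx U a - 1%:M)) = 1%:M.
Proof.
move=> uU a0 t01 r.
have -> : 1%:M + t%:C *: (specmx U a - 1%:M) = specmx U (fun i => (1 - t) * 1 + t * a i).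
  rewrite (specmx_comb U (fun=> 1) a) (specmx1 uU) rmorphB rmorph1.
  by rewrite scalerBl scale1r scalerBr addrA (addrAC _ (t%:C *: _)).
have r1 i : ((1 - t) * 1 + t * a i) * r i = 1.
  by rewrite /r divff // lt0r_neq0 // affine_gt0.
rewrite !(specmxM _ _ uU); split; rewrite -(specmx1 uU); apply: eq_specmx => i.
  exact: r1.
by rewrite mulrC r1.
Qed.

(** The logarithm is the integral of (A - 1)(1 + t (A - 1))^-1, here tested against [X]. The
    resolvent comes with its inverse property and its positivity, the facts that [resolvent_tangent]
    takes as input. *)
Lemma newton_int_logmx A : posdefmx A -> exists S : R -> 'M[C]_n,
  (forall t, 0 <= t <= 1 -> [/\ (1%:M + t%:C *: (A - 1%:M)) *m S t = 1%:M,
     S t *m (1%:M + t%:C *: (A - 1%:M)) = 1%:M & psdmx (S t)]) /\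
  forall X, newton_int (fun t => Re (\tr (X *m ((A - 1%:M) *m S t))))
    (Re (\tr (X *m logmx A))).
Proof.
move=> /posdef_specmx[U [a [uU AE a0 fA]]].
pose r t i := ((1 - t) * 1 + t * a i)^-1.
exists (fun t => specmx U (r t)); split=> [t t01|X].
  have [r1 r2] := resolvent_specmx uU a0 t01; rewrite AE; split=> //.
  apply/posdef_psd/(specmx_posdef uU) => i.
  by rewrite invr_gt0 affine_gt0.
rewrite /logmx fA mxtrace_specmx_mul Re_sum.
have I i : newton_int (fun t => Re ((U *m X *m U ^H) i i) * ((a i - 1) * r t i))
    (Re ((ln (a i))%:C * (U *m X *m U ^H) i i)).
  rewrite ReZ mulrC -[ln _]subr0 -ln1; apply: newton_intZ.
  exact: newton_int_ln.
apply: eq_newton_int (newton_int_sum _ I) _ => t _.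
have -> : (A - 1%:M) *m specmx U (r t) = specmx U (fun i => (a i - 1) * r t i).
  rewrite -(specmxM (fun i => a i - 1) _ uU); congr (_ *m _).
  rewrite -(eq_specmx U (_ : (fun i => 1 * a i + (-1) * 1) =1 _)) => [|i]; last by ring.
  by rewrite (specmx_comb U a (fun=> 1)) (specmx1 uU) AE rmorphN rmorph1 scale1r scaleN1r.
rewrite mxtrace_specmx_mul Re_sum; apply: eq_bigr => i _.
by rewrite ReZ mulrC.
Qed.

(* The tangent inequality for the operator concave function ln, at the level
   of resolvents: the difference of both sides is [t S_B Y S_A Y S_B >= 0],
   where [Y = A - B]. *)
Lemma resolvent_tangent t A B SA SB : 0 <= t -> psdmx A -> psdmx SA -> SB ^H = SB ->
  let Y := A - B in
  (1%:M + t%:C *: (A - 1%:M)) *m SA = 1%:M ->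
  SA *m (1%:M + t%:C *: (A - 1%:M)) = 1%:M ->
  (1%:M + t%:C *: (B - 1%:M)) *m SB = 1%:M ->
  SB *m (1%:M + t%:C *: (B - 1%:M)) = 1%:M -> Y ^H = Y ->
  Re (\tr (A *m ((A - 1%:M) *m SA))) - Re (\tr (A *m ((B - 1%:M) *m SB)))
    <= Re (\tr (A *m (SB *m Y *m SB))).
Proof.
move=> t0 psdA psdSA hSB Y.
have YE : A - 1%:M = B - 1%:M + Y by rewrite /Y [RHS]addrC addrA subrK.
set B1 := B - 1%:M in YE *; set A1 := A - 1%:M in YE *.
clearbody A1 B1 Y; set At := 1%:M + t%:C *: A1; set Bt := 1%:M + t%:C *: B1 => A1S SA1 B1S SB1 hY.
have AB : At = Bt + t%:C *: Y by rewrite /At YE scalerDr addrA.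
have BS : B1 *m SB = SB *m B1.
  have comm : B1 *m Bt = Bt *m B1.
    by rewrite /Bt mulmxDr mulmxDl mulmx1 mul1mx -scalemxAl -scalemxAr.
  by rewrite -[B1 *m SB]mul1mx -SB1 -mulmxA (mulmxA Bt) -comm -(mulmxA B1) B1S mulmx1.
(* A resolvent identity: in [Bt *m A1 - B1 *m At] the terms of order t cancel and [Y] remains. [E2]
   then shows that exchanging [SA] for [SB] costs another factor t Y, which completes the square. *)
have E1 : A1 *m SA - B1 *m SB = SB *m Y *m SA.
  have -> : Y = Bt *m A1 - B1 *m At.
    rewrite /Bt /At mulmxDl mulmxDr mul1mx mulmx1 -scalemxAl -scalemxAr.
    by rewrite opprD addrACA subrr addr0 YE addrC addKr.
  by rewrite mulmxBr mulmxBl !mulmxA SB1 mul1mx BS -!mulmxA A1S mulmx1.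
have E2 : SB - SA = t%:C *: (SA *m Y *m SB).
  have -> : t%:C *: (SA *m Y *m SB) = SA *m (t%:C *: Y) *m SB.
    by rewrite -scalemxAr -scalemxAl.
  have -> : t%:C *: Y = At - Bt by rewrite AB addrC addKr.
  by rewrite mulmxBr mulmxBl SA1 mul1mx -mulmxA B1S mulmx1.
rewrite -ReB -(raddfB (@mxtrace _ _)) /= -mulmxBr E1 -subr_ge0 -ReB.
rewrite -(raddfB (@mxtrace _ _)) /= -mulmxBr -mulmxBr E2 -!scalemxAr mxtraceZ ReZ.
apply: mulr_ge0 => //; apply: psd_mul_trace_ge0 => //.
have [F ->] := psd_factor psdSA.
have -> : SB *m Y *m (F ^H *m F *m Y *m SB) = (F *m Y *m SB) ^H *m (F *m Y *m SB).
  by rewrite !adjmxM hSB hY !mulmxA.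
exact: factor_psd.
Qed.

(** Concavity bounds the difference of logarithms, paired with [D], by the derivative of the
    logarithm at [specmx U s] in the direction of the difference. Splitting [D] into difference plus
    [specmx U s], the first part is the weighted square sum; in the second, s_i cancels against the
    diagonal weight 1/s_i and leaves the trace of [Y], which is 0. *)
Lemma entropy_upper U (s : 'I_n -> R) D (Y := U *m (D - specmx U s) *m U ^H) :
  unitary U -> (forall i, 0 < s i) -> posdefmx D -> \tr D = \tr (specmx U s) ->
  relative_entropy D (specmx U s)
    <= \sum_i \sum_j normsq (Y i j) * inv_logmean (s i) (s j).
Proof.
move=> uU s0 posD trD; set B := specmx U s in Y trD *.
have posB : posdefmx B by apply: specmx_posdef.
have [SD [SDP ID]] := newton_int_logmx posD.
have [SB [SBP IB]] := newton_int_logmx posB.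
pose r t i := ((1 - t) * 1 + t * s i)^-1.
have SBE t : 0 <= t <= 1 -> SB t = specmx U (r t).
  move=> t01; have [B1 _ _] := SBP t t01; have [_ B2] := resolvent_specmx uU s0 t01.
  by rewrite -[SB t]mul1mx -B2 -mulmxA B1 mulmx1.
have trY : \sum_i Re (Y i i) = 0.
  rewrite -Re_sum -mxtraceE /Y mxtrace_mulC mulmxA.
  by case: uU => _ ->; rewrite mul1mx raddfB /= trD subrr.
have YH : (D - B) ^H = D - B.
  have [/posdefP[hD _] /posdefP[hB _]] := (posD, posB).
  by rewrite adjmxB hD hB.
rewrite /relative_entropy mulmxBr raddfB /= ReB.
have I := newton_intD
  (newton_int_sum (index_enum _) (fun i => newton_int_sum (index_enum _) (fun j =>
     newton_intZ (normsq (Y i j)) (newton_int_resolvent (s0 i) (s0 j)))))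
  (newton_int_sum (index_enum _) (fun i =>
     newton_intZ (s i * Re (Y i i)) (newton_int_resolvent (s0 i) (s0 i)))).
have E : \sum_i s i * Re (Y i i) * inv_logmean (s i) (s i) = 0.
  rewrite -[RHS]trY; apply: eq_bigr => i _.
  by rewrite /inv_logmean eqxx mulrAC mulfV ?mul1r // gt_eqF.
rewrite -[leRHS]addr0 -[X in _ <= _ + X]E.
apply: newton_int_le (newton_intB (ID D) (IB D)) I _ => t t01 /=.
have [D1 D2 D3] := SDP t t01; have [B1 B2 B3] := SBP t t01.
have /andP[t0 t1] := t01.
have hSB : SB t ^H = SB t by have /psdP[] := B3.
apply: le_trans (resolvent_tangent t0 (posdef_psd posD) D3 hSB D1 D2 B1 B2 YH) _.
have [UU U1] := uU.
have -> : \tr (D *m (SB t *m (D - B) *m SB t)) =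
    \tr ((Y + diagR s) *m (diagR (r t) *m Y *m diagR (r t))).
  have -> : D *m (SB t *m (D - B) *m SB t) =
     U ^H *m ((Y + diagR s) *m (diagR (r t) *m Y *m diagR (r t)) *m U).
    have DBE : D - B = U ^H *m Y *m U by rewrite /Y unitary_conjK.
    have DE : D = U ^H *m (Y + diagR s) *m U.
      by rewrite mulmxDr mulmxDl -DBE -specmxE subrK.
    have UK m (X : 'M[C]_(n, m)) : U *m (U ^H *m X) = X by rewrite mulmxA UU mul1mx.
    by rewrite (SBE t t01) DBE {1}DE specmxE -!mulmxA !UK.
  move: ((Y + diagR s) *m _) => M.
  by rewrite mxtrace_mulC -mulmxA UU mulmx1.
rewrite le_eqVlt; apply/orP; left; apply/eqP.
have YH2 : Y ^H = Y by rewrite /Y !adjmxM adjmxK YH mulmxA.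
rewrite mulmxDl raddfD /= ReD; congr (_ + _).
  rewrite -{1}YH2 mxtrace_adjM Re_sum; apply: eq_bigr => i _.
  rewrite Re_sum; apply: eq_bigr => j _.
  rewrite mul_mx_diagR mul_diagR mulrCA ReZ mulrCA ReZ -normsqE invfM /r.
  by ring.
rewrite mxtraceE Re_sum; apply: eq_bigr => i _.
by rewrite mul_diagR mul_mx_diagR mul_diagR !ReZ invfM /r; ring.
Qed.

End Entropy.

(** * Ampliations and the Choi-Kraus decomposition *)

Section KrausDecomposition.
Context {R : realType} {n : nat}.
Local Notation C := R[i].

Lemma mxtens_sum m p (V : nmodType) (F : 'I_(m * p) -> V) :
  \sum_k F k = \sum_i \sum_a F (mxtens_index (i, a)).
Proof.
rewrite pair_big (reindex (@mxtens_index m p)) /=; last first.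
  by exists (@mxtens_unindex m p) => k _; rewrite (mxtens_indexK, mxtens_unindexK).
by apply: eq_bigr => -[i a].
Qed.

Lemma ampliationE m (T : 'M[C]_n -> 'M[C]_n) (A : 'M[C]_(n * m)) i j k l :
  ampliation T A (mxtens_index (i, j)) (mxtens_index (k, l)) =
  T (mxtens_block A j l) i k.
Proof.
rewrite /ampliation summxE (bigD1 j) //= summxE (bigD1 l) //= tensmxE mxE !eqxx mulr1.
rewrite big1 => [|l' ll']; last by rewrite tensmxE mxE eqxx eq_sym (negbTE ll') mulr0.
rewrite addr0 big1 ?addr0 // => j' jj'; rewrite summxE big1 // => l' _.
by rewrite tensmxE mxE eq_sym (negbTE jj') mulr0.
Qed.

Lemma linear_mx_delta (T : 'End('M[C]_n)) X :
  T X = \sum_i \sum_j X i j *: T (delta_mx i j).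
Proof.
rewrite {1}[X]matrix_sum_delta linear_sum; apply: eq_bigr => i _.
by rewrite linear_sum; apply: eq_bigr => j _; rewrite linearZ.
Qed.

Lemma kraus_delta {J : finType} (K : J -> 'M[C]_n) i j k l :
  (kraus K (delta_mx j l)) i k = \sum_c K c i j * (K c k l)^cj.
Proof.
rewrite /kraus summxE; apply: eq_bigr => c _.
rewrite mulmxE (bigD1 l) //= big1 => [|l' ll']; last first.
  rewrite mulmxE big1 ?mul0r // => j' _.
  by rewrite mxE (negbTE ll') andbF mulr0.
rewrite addr0 adjmxE mulmxE (bigD1 j) //= mxE !eqxx mulr1 big1 ?addr0 // => j' jj'.
by rewrite mxE (negbTE jj') mulr0.
Qed.

Lemma krausZ {J : finType} (K : J -> 'M[C]_n) a X : kraus K (a *: X) = a *: kraus K X.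
Proof.
by rewrite /kraus scaler_sumr; apply: eq_bigr => j _; rewrite -scalemxAr -scalemxAl.
Qed.

Lemma kraus0 {J : finType} (K : J -> 'M[C]_n) : kraus K 0 = 0.
Proof. by rewrite /kraus big1 // => j _; rewrite mulmx0 mul0mx. Qed.

Lemma kraus_sum {J : finType} (K : J -> 'M[C]_n) (I : Type) (r : seq I) F :
  kraus K (\sum_(i <- r) F i) = \sum_(i <- r) kraus K (F i).
Proof. by apply: (big_morph (kraus K)); [exact: krausD | exact: kraus0]. Qed.

(* The Kraus operators are the rows of a factor of the Choi matrix. *)
Lemma kraus_of_cp (T : 'End('M[C]_n)) : completely_positive T ->
  exists K : 'I_(n * n) -> 'M[C]_n, forall X, T X = kraus K X.
Proof.
move=> cpT.
(* The unnormalised maximally entangled vector: the blocks of [w ^H *m w] are the matrix units, so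
   its ampliation is the Choi matrix. *)
pose w : 'rV[C]_(n * n) :=
  \row_k ((mxtens_unindex k).1 == (mxtens_unindex k).2)%:R.
have [B BE] := psd_factor (cpT n _ (factor_psd w)).
exists (fun c => \matrix_(i, j) (B c (mxtens_index (i, j)))^cj) => X.
rewrite linear_mx_delta {2}[X]matrix_sum_delta kraus_sum; apply: eq_bigr => j _.
rewrite kraus_sum; apply: eq_bigr => l _; rewrite krausZ; congr (_ *: _).
apply/matrixP => i k; rewrite kraus_delta.
have -> : delta_mx j l = mxtens_block (w ^H *m w) j l.
  apply/matrixP => i' k'; rewrite [RHS]mxE mulmxE big_ord1 adjmxE !mxE !mxtens_indexK /=.
  by rewrite conjc_nat -natrM mulnb.
rewrite -ampliationE BE mulmxE; apply: eq_bigr => c _.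
by rewrite adjmxE !mxE conjcK.
Qed.

End KrausDecomposition.

(** * KMS geometry: contractivity of Psi and the gap in Hilbert-Schmidt norm *)

Section LogConvex.
Context {R : realType}.

(** Log-convexity makes successive ratios nondecreasing, so a first ratio q > 1 forces geometric
    growth. The Bernoulli minorant 1 + (q - 1) k already exceeds any bound. *)
Lemma bounded_log_convex (u : nat -> R) (b : R) : (forall k, 0 <= u k <= b) ->
  (forall k, u k.+1 ^+ 2 <= u k * u k.+2) -> u 1%N <= u 0%N.
Proof.
move=> ub uconv; rewrite leNgt; apply/negP => u01.
have u0 : 0 < u 0%N.
  rewrite lt_def; have /andP[-> _] := ub 0%N; rewrite andbT.
  apply/eqP => u0; have := uconv 0%N; rewrite u0 mul0r => u1.
  have /eqP : u 1%N ^+ 2 = 0 by apply/eqP; rewrite eq_le u1 sqr_ge0.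
  by rewrite sqrf_eq0 => /eqP u1'; rewrite u0 u1' ltxx in u01.
pose q := u 1%N / u 0%N.
have q1 : 1 < q by rewrite /q ltr_pdivlMr // mul1r.
have step k : 0 < u k /\ q * u k <= u k.+1.
  elim: k => [|k [uk IHk]]; first by rewrite /q divfK ?gt_eqF.
  have uk1 : 0 < u k.+1.
    by apply: lt_le_trans IHk; rewrite mulr_gt0 // (lt_trans ltr01).
  split=> //; rewrite -(ler_pM2l uk); apply: le_trans (uconv k).
  rewrite mulrA expr2 ler_pM2r // mulrC; exact: IHk.
have grow k : u 0%N * (1 + (q - 1) * k%:R) <= u k.
  elim: k => [|k IHk]; first by rewrite mulr0 addr0 mulr1.
  have [_] := step k; apply: le_trans.
  have : q * (u 0%N * (1 + (q - 1) * k%:R)) <= q * u k.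
    by rewrite ler_pM2l // (lt_trans ltr01).
  apply: le_trans; rewrite -natr1.
  have h : 0 <= u 0%N * ((q - 1) * ((q - 1) * k%:R)).
    by rewrite !mulr_ge0 // ?subr_ge0 ltW.
  rewrite -subr_ge0; apply: le_trans h _; rewrite le_eqVlt; apply/orP; left.
  by apply/eqP; ring.
have [N hN] : exists N : nat, b / (u 0%N * (q - 1)) < N%:R.
  by exists (Num.bound (b / (u 0%N * (q - 1)))); apply: archi_boundP;
    rewrite divr_ge0 // ?mulr_ge0 ?subr_ge0 ?ltW //; have /andP[] := ub 0%N; lra.
move: hN; rewrite ltr_pdivrMr ?mulr_gt0 ?subr_gt0 // => hN.
have := grow N; have /andP[_] := ub N; lra.
Qed.

End LogConvex.

Section KMS.
Context {R : realType} {n : nat}.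
Local Notation C := R[i].
Context (D W : 'M[C]_n) (d : 'I_n -> R).
Context (uW : unitary W) (DE : D = specmx W d) (d0 : forall i, 0 < d i)
  (SE : sqrtmx D = specmx W (fun i => Num.sqrt (d i))).
Local Notation s i := (Num.sqrt (d i)).
Local Notation hat X := (W *m X *m W ^H).
Implicit Types (X Y Z : 'M[C]_n).

(** A real symmetric bilinear form, which keeps expansions and Cauchy-Schwarz over R even for
    non-Hermitian arguments. *)
Definition kmsb X Y : R := Re (kms_inner D X Y).

Lemma sqrt_eigen_gt0 i : 0 < s i.
Proof. by rewrite sqrtr_gt0. Qed.

Lemma sqrt_eigen_sqr i : s i * s i = d i.
Proof. by rewrite -expr2 sqr_sqrtr // ltW. Qed.

Lemma hat_sandwich X (f g : 'I_n -> R) i j :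
  (hat (specmx W f *m X *m specmx W g)) i j = (f i * g j)%:C * (hat X) i j.
Proof.
have [WW _] := uW.
have -> : hat (specmx W f *m X *m specmx W g) = diagR f *m hat X *m diagR g.
  rewrite !specmxE !mulmxA WW mul1mx -(mulmxA _ W (W ^H)) WW.
  by rewrite mulmx1.
by rewrite mul_mx_diagR mul_diagR rmorphM mulrCA mulrA.
Qed.

Lemma mxtrace_hat X Y : \tr (X ^H *m Y) = \tr ((hat X) ^H *m hat Y).
Proof.
have [_ WW] := uW; rewrite !adjmxM adjmxK -!mulmxA [RHS]mxtrace_mulC -!mulmxA.
by rewrite WW mulmx1 (mulmxA (W ^H)) WW mul1mx.
Qed.

Lemma kms_innerE X Y : kms_inner D X Y =
  \sum_i \sum_j (s i * s j)%:C * (((hat X) i j)^cj * (hat Y) i j).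
Proof.
rewrite /kms_inner adjE; move: SE; move: (sqrtmx D) => S SE'.
rewrite -!mulmxA mxtrace_hat mxtrace_adjM (mulmxA S) SE'.
apply: eq_bigr => i _; apply: eq_bigr => j _.
by rewrite hat_sandwich mulrCA !mulmxA.
Qed.

Lemma kmsbE X Y : kmsb X Y =
  \sum_i \sum_j s i * s j * Re (((hat X) i j)^cj * (hat Y) i j).
Proof.
rewrite /kmsb kms_innerE Re_sum; apply: eq_bigr => i _.
by rewrite Re_sum; apply: eq_bigr => j _; rewrite ReZ.
Qed.

Lemma kmsqE X : kmsb X X = \sum_i \sum_j s i * s j * normsq ((hat X) i j).
Proof. by rewrite kmsbE; do 2![apply: eq_bigr => ? _]; rewrite normsqE. Qed.

Lemma kmsq_ge0 X : 0 <= kmsb X X.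
Proof.
rewrite kmsqE; do 2![apply: sumr_ge0 => ? _].
by rewrite !mulr_ge0 ?sqrtr_ge0 ?normsq_ge0.
Qed.

Lemma kmsbC X Y : kmsb X Y = kmsb Y X.
Proof.
rewrite !kmsbE; do 2![apply: eq_bigr => ? _]; congr (_ * _).
by rewrite -ReJ rmorphM /= conjcK mulrC.
Qed.

Lemma kmsbDr X Y Z : kmsb X (Y + Z) = kmsb X Y + kmsb X Z.
Proof. by rewrite /kmsb /kms_inner mulmxDr mulmxDl raddfD ReD. Qed.

Lemma kmsbNr X Y : kmsb X (- Y) = - kmsb X Y.
Proof. by rewrite /kmsb /kms_inner mulmxN mulNmx raddfN ReN. Qed.

Lemma kmsbBr X Y Z : kmsb X (Y - Z) = kmsb X Y - kmsb X Z.
Proof. by rewrite kmsbDr kmsbNr. Qed.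

Lemma kmsbZr (a : R) X Y : kmsb X (a%:C *: Y) = a * kmsb X Y.
Proof. by rewrite /kmsb /kms_inner -scalemxAr -scalemxAl mxtraceZ ReZ. Qed.

Lemma kmsbDl X Y Z : kmsb (X + Y) Z = kmsb X Z + kmsb Y Z.
Proof. by rewrite kmsbC kmsbDr !(kmsbC Z). Qed.

Lemma kmsbBl X Y Z : kmsb (X - Y) Z = kmsb X Z - kmsb Y Z.
Proof. by rewrite kmsbC kmsbBr !(kmsbC Z). Qed.

Lemma kmsbZl (a : R) X Y : kmsb (a%:C *: X) Y = a * kmsb X Y.
Proof. by rewrite kmsbC kmsbZr kmsbC. Qed.

Lemma frobsq_hat X : frobsq X = \sum_i \sum_j normsq ((hat X) i j).
Proof. by rewrite -(frobsq_unitary X uW uW). Qed.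

Lemma kmsq_ge_frobsq (a : R) X : 0 <= a -> (forall i, a <= d i) -> a * frobsq X <= kmsb X X.
Proof.
move=> a0 ad; rewrite frobsq_hat kmsqE mulr_sumr; apply: ler_sum => i _.
rewrite mulr_sumr; apply: ler_sum => j _; apply: ler_wpM2r; first exact: normsq_ge0.
rewrite -(sqr_sqrtr a0) expr2.
by apply: ler_pM; rewrite ?sqrtr_ge0 ?ler_wsqrtr.
Qed.

Lemma kmsq_le_frobsq (b : R) X : (forall i, d i <= b) -> kmsb X X <= b * frobsq X.
Proof.
move=> db; rewrite frobsq_hat kmsqE mulr_sumr; apply: ler_sum => i _.
have b0 : 0 <= b by apply: le_trans (db i); apply: ltW.
rewrite mulr_sumr; apply: ler_sum => j _; apply: ler_wpM2r; first exact: normsq_ge0.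
rewrite -(sqr_sqrtr b0) expr2.
by apply: ler_pM; rewrite ?sqrtr_ge0 ?ler_wsqrtr.
Qed.

Lemma kmsq_gt0 X : X != 0 -> 0 < kmsb X X.
Proof.
move=> X0; rewrite lt_def kmsq_ge0 andbT; apply: contra_neq X0 => /eqP.
rewrite kmsqE psumr_eq0 => [/allP q0|i _]; last first.
  by apply: sumr_ge0 => j _; rewrite !mulr_ge0 ?sqrtr_ge0 ?normsq_ge0.
rewrite -(unitary_conjK X uW uW); suff -> : hat X = 0 by rewrite mulmx0 mul0mx.
apply/matrixP => i j; have := q0 i (mem_index_enum i).
rewrite psumr_eq0 => [/allP/(_ j (mem_index_enum j))|k _]; last first.
  by rewrite !mulr_ge0 ?sqrtr_ge0 ?normsq_ge0.
rewrite implyTb mulf_eq0 mulf_eq0 !(gt_eqF (sqrt_eigen_gt0 _)) normsq_eq0 /= => /eqP ->.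
by rewrite mxE.
Qed.

Lemma kms_CauchySchwarz X Y : kmsb X Y ^+ 2 <= kmsb X X * kmsb Y Y.
Proof.
have [->|Y0] := eqVneq Y 0.
  by rewrite {1}/kmsb /kms_inner mulmx0 mul0mx raddf0 expr0n mulr_ge0 ?kmsq_ge0.
rewrite -(ler_pM2l (kmsq_gt0 Y0)) -subr_ge0.
have := kmsq_ge0 ((kmsb Y Y)%:C *: X - (kmsb X Y)%:C *: Y).
rewrite kmsbBl !kmsbBr !kmsbZl !kmsbZr (kmsbC Y X) => h.
apply: le_trans h _; rewrite le_eqVlt; apply/orP; left; apply/eqP.
move: (kmsb X X) (kmsb Y Y) (kmsb X Y) => x y z; ring.
Qed.

Lemma kmsq_adj X : kmsb (X ^H) (X ^H) = kmsb X X.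
Proof.
rewrite !kmsqE exchange_big; apply: eq_bigr => i _; apply: eq_bigr => j _.
have -> : hat (X ^H) = (hat X) ^H by rewrite !adjmxM adjmxK mulmxA.
by rewrite adjmxE normsqJ [s j * _]mulrC.
Qed.

(* AM-GM: [2 (d i d j)^(1/2) <= d i + d j]. *)
Lemma kmsq_le_gns X : 2 * kmsb X X <=
  Re (\tr (D *m (X *m X ^H))) + Re (\tr (D *m (X ^H *m X))).
Proof.
have XE := unitary_conjK X uW uW.
have := mxtrace_specmx_left d (hat X) uW uW; rewrite -DE XE => ->.
have := mxtrace_specmx_right d (hat X) uW uW; rewrite -DE XE => ->.
rewrite kmsqE mulr_sumr -big_split /=; apply: ler_sum => i _.
rewrite mulr_sumr -big_split /=; apply: ler_sum => j _.
rewrite -mulrDl mulrA; apply: ler_wpM2r; first exact: normsq_ge0.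
have amgm (x y a b : R) : x * x = a -> y * y = b -> 2 * (x * y) <= a + b.
  by move=> <- <-; have := sqr_ge0 (x - y); nra.
exact: amgm (sqrt_eigen_sqr i) (sqrt_eigen_sqr j).
Qed.

End KMS.

Lemma ge0_sqr_le {R : realType} (a b : R) : 0 <= b -> a ^+ 2 <= b * b -> a <= b.
Proof. by move=> b0 h; rewrite leNgt; apply/negP => ba; nra. Qed.

Lemma le_of_double {R : realType} (x y z v : R) :
  y = x + z -> 0 <= z -> 2 * y <= v + v -> x <= v.
Proof. lra. Qed.

Section KMSContraction.
Context {R : realType} {n : nat} {J : finType}.
Local Notation C := R[i].
Context (D W : 'M[C]_n) (d : 'I_n -> R).
Context (uW : unitary W) (DE : D = specmx W d) (d0 : forall i, 0 < d i)
  (SE : sqrtmx D = specmx W (fun i => Num.sqrt (d i))).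
Context (K : J -> 'M[C]_n) (K1 : kraus K 1%:M = 1%:M) (KD : kraus_dual K D = D)
  (Ksym : forall X Y, kms_inner D (kraus K X) Y = kms_inner D X (kraus K Y)).
Local Notation s i := (Num.sqrt (d i)).
Local Notation hat X := (W *m X *m W ^H).
Local Notation kmsb := (kmsb D).
Implicit Types (X Y Z : 'M[C]_n).

Lemma psd_density : psdmx D.
Proof. by rewrite DE; apply: posdef_psd; apply: specmx_posdef. Qed.

(** The symmetrised GNS norm squared. Kadison-Schwarz and invariance of [D] contract it directly,
    and it dominates twice the KMS square, so it bounds all iterates uniformly. *)
Definition gnsq X : R := Re (\tr (D *m (X *m X ^H))) + Re (\tr (D *m (X ^H *m X))).

Lemma gnsq_kraus_le X : gnsq (kraus K X) <= gnsq X.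
Proof.
apply: lerD; first by have := kraus_schwarz X psd_density K1; rewrite -!kraus_dualP KD.
have := kraus_schwarz (X ^H) psd_density K1.
by rewrite kraus_adj !adjmxK -!kraus_dualP KD.
Qed.

Lemma kmsb_kraus X Y : kmsb (kraus K X) Y = kmsb X (kraus K Y).
Proof. by rewrite /kmsb Ksym. Qed.

(** By KMS symmetry the square of the (k+1)-st iterate equals the pairing of the k-th with the
    (k+2)-nd, so Cauchy-Schwarz makes the squares log-convex; the GNS bound makes them bounded. *)
Lemma kraus_contraction X : kmsb (kraus K X) (kraus K X) <= kmsb X X.
Proof.
pose u k := kmsb (iter k (kraus K) X) (iter k (kraus K) X).
apply: (@bounded_log_convex R u (gnsq X / 2)) => k; last first.
  by rewrite /u !iterS kmsb_kraus; apply: kms_CauchySchwarz uW d0 SE _ _.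
apply/andP; split; first exact: (kmsq_ge0 uW SE).
have gk : gnsq (iter k (kraus K) X) <= gnsq X.
  elim: k => [|k IHk] //; rewrite iterS; apply: le_trans IHk; exact: gnsq_kraus_le.
have := kmsq_le_gns uW DE d0 SE (iter k (kraus K) X).
rewrite -/(gnsq _) /u ler_pdivlMr // mulrC; move/le_trans; exact.
Qed.

Lemma kmsb_kraus_le X : kmsb X (kraus K X) <= kmsb X X.
Proof.
have h := le_trans (kms_CauchySchwarz uW d0 SE X (kraus K X))
  (ler_wpM2l (kmsq_ge0 uW SE X) (kraus_contraction X)).
exact: ge0_sqr_le (kmsq_ge0 uW SE X) h.
Qed.

Lemma kmsq_i X : kmsb ('i%C *: X) ('i%C *: X) = kmsb X X.
Proof.
rewrite !(kmsqE uW SE); do 2![apply: eq_bigr => ? _].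
by rewrite -scalemxAr -scalemxAl mxE normsqM /normsq /= expr0n expr1n add0r mul1r.
Qed.

Lemma kmsq_split X : kmsb X X =
  kmsb (2^-1%:C *: (X + X ^H)) (2^-1%:C *: (X + X ^H)) +
  kmsb (2^-1%:C *: (X - X ^H)) (2^-1%:C *: (X - X ^H)).
Proof.
rewrite !(kmsbZl uW SE) !(kmsbZr D) !(kmsbBl uW SE) !(kmsbBr D) !(kmsbDl uW SE) !(kmsbDr D).
rewrite (kmsq_adj uW SE); move: (kmsb X X) (kmsb X _) (kmsb (X ^H) X) => x y z.
by field.
Qed.

(** Cauchy-Schwarz turns the form bound into a norm bound for Hermitian [X]. The general case is
    needed because off-diagonal blocks of a Hermitian matrix are not Hermitian; it follows from the
    orthogonal splitting into Hermitian and anti-Hermitian parts. *)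
Lemma gap_sqr (g : R) : 0 <= g ->
  (forall X, X ^H = X -> \tr (D *m X) = 0 -> g * kmsb X X <= kmsb X (X - kraus K X)) ->
  forall X, \tr (D *m X) = 0 ->
    g ^+ 2 * kmsb X X <= kmsb (X - kraus K X) (X - kraus K X).
Proof.
move=> g0 gap.
have herm X : X ^H = X -> \tr (D *m X) = 0 ->
    g ^+ 2 * kmsb X X <= kmsb (X - kraus K X) (X - kraus K X).
  move=> hX tX; have [->|X0] := eqVneq X 0.
    by rewrite {1}/kmsb /kms_inner mulmx0 mul0mx raddf0 mulr0 (kmsq_ge0 uW SE).
  have q0 := kmsq_gt0 uW d0 SE X0; rewrite -(ler_pM2l q0).
  apply: le_trans (kms_CauchySchwarz uW d0 SE _ _).
  rewrite mulrCA -expr2 -exprMn; apply: lerXn2r; rewrite ?nnegrE.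
  - by rewrite mulr_ge0 // ltW.
  - by apply: le_trans (gap X hX tX); rewrite mulr_ge0 // ltW.
  - exact: gap.
move=> X tX.
have tXH : \tr (D *m X ^H) = 0.
  have hD : D ^H = D by rewrite DE specmx_adj.
  by rewrite -hD mxtrace_mulC -adjmxM mxtrace_adj tX conjc0.
have krausB Y Z : kraus K (Y - Z) = kraus K Y - kraus K Z.
  by rewrite krausD -scaleN1r krausZ scaleN1r.
rewrite kmsq_split [leRHS]kmsq_split mulrDr; apply: lerD.
  have -> : 2^-1%:C *: (X - kraus K X + (X - kraus K X) ^H) =
     2^-1%:C *: (X + X ^H) - kraus K (2^-1%:C *: (X + X ^H)).
    by rewrite adjmxB -kraus_adj krausZ krausD -scalerBr opprD addrACA.
  apply: herm; first by rewrite adjmxZ conjc_real adjmxD adjmxK addrC.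
  by rewrite -scalemxAr mulmxDr mxtraceZ raddfD /= tX tXH addr0 mulr0.
have -> : 2^-1%:C *: (X - kraus K X - (X - kraus K X) ^H) =
   2^-1%:C *: (X - X ^H) - kraus K (2^-1%:C *: (X - X ^H)).
  have sub4 (a b c e : 'M[C]_n) : a - b - (c - e) = a - c - (b - e).
    by rewrite !opprB addrACA (addrC (- b)) -addrACA.
  by rewrite adjmxB -kraus_adj krausZ krausB -scalerBr sub4.
(* Multiplication by i makes the anti-Hermitian part Hermitian and preserves the KMS norm. *)
set B := 2^-1%:C *: (X - X ^H); rewrite -kmsq_i -[leRHS]kmsq_i scalerBr -krausZ.
rewrite /B; apply: herm; last first.
  rewrite -!scalemxAr mulmxBr !mxtraceZ raddfB /= tX tXH subrr.
  by rewrite !mulr0.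
rewrite !adjmxZ conjc_real adjmxB adjmxK -[X ^H - X]opprB scalerN.
suff -> : 'i%C^cj = - 'i%C :> C by rewrite scaleNr scalerN opprK.
by apply/eqP; rewrite eq_complex /= oppr0 !eqxx.
Qed.

Lemma frobsq_sandwich_ge (a : R) X : (forall i, a <= d i) -> 0 <= a ->
  a * kmsb X X <= frobsq (specmx W (fun i => s i) *m X *m specmx W (fun i => s i)).
Proof.
move=> ad a0; rewrite (frobsq_hat uW) (kmsqE uW SE) mulr_sumr; apply: ler_sum => i _.
rewrite mulr_sumr; apply: ler_sum => j _; rewrite (hat_sandwich uW) normsqM normsqR mulrA.
apply: ler_wpM2r; first exact: normsq_ge0.
rewrite expr2; apply: ler_wpM2r; first by rewrite mulr_ge0 ?sqrtr_ge0.
by rewrite -(sqr_sqrtr a0) expr2 ler_pM ?sqrtr_ge0 ?ler_wsqrtr.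
Qed.

Lemma frobsq_sandwich_le (b : R) X : (forall i, d i <= b) ->
  frobsq (specmx W (fun i => s i) *m X *m specmx W (fun i => s i)) <= b * kmsb X X.
Proof.
move=> db; rewrite (frobsq_hat uW) (kmsqE uW SE) mulr_sumr; apply: ler_sum => i _.
have b0 : 0 <= b by apply: le_trans (db i); apply: ltW.
rewrite mulr_sumr; apply: ler_sum => j _; rewrite (hat_sandwich uW) normsqM normsqR mulrA.
apply: ler_wpM2r; first exact: normsq_ge0.
rewrite expr2; apply: ler_wpM2r; first by rewrite mulr_ge0 ?sqrtr_ge0.
by rewrite -(sqr_sqrtr b0) expr2 ler_pM ?sqrtr_ge0 ?ler_wsqrtr.
Qed.

Lemma kraus_dual_sandwich X :
  kraus_dual K (specmx W (fun i => s i) *m X *m specmx W (fun i => s i)) =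
  specmx W (fun i => s i) *m kraus K X *m specmx W (fun i => s i).
Proof.
have hS := specmx_adj W (fun i => s i).
apply: mxtrace_nondeg => Z; have := Ksym X Z; rewrite /kms_inner !adjE SE.
move: (specmx W _) hS => S hS symE.
rewrite -kraus_dual_adj kraus_dualP !adjmxM !hS.
transitivity (\tr (X ^H *m S *m kraus K Z *m S)).
  by rewrite -mulmxA mxtrace_mulC.
by rewrite -symE -[in RHS]mulmxA [RHS]mxtrace_mulC.
Qed.

(** Write Y = D^(1/2) X D^(1/2): tracelessness of [Y] is centring of [X], and the sandwich
    intertwines the dual map with the map. The Frobenius square of a sandwich lies between [a] and
    [b] times the KMS square of its core, hence [a / b]. *)
Lemma gap_frobsq (g a b : R) : 0 <= g -> 0 < a ->
  (forall i, a <= d i) -> (forall i, d i <= b) ->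
  (forall X, X ^H = X -> \tr (D *m X) = 0 -> g * kmsb X X <= kmsb X (X - kraus K X)) ->
  forall Y, \tr Y = 0 -> a / b * g ^+ 2 * frobsq Y <= frobsq (Y - kraus_dual K Y).
Proof.
move=> g0 a0 ad db gap Y tY.
(* Without an index there is no eigenvalue to show that [b] is positive. *)
have [->|[i0 _]] : Y = 0 \/ exists i : 'I_n, true.
  have [n0|/card_gt0P[i _]] := posnP #|'I_n|; last by right; exists i.
  left; apply/matrixP => i; suff : false by []; move: (card0_eq n0 i); by rewrite inE.
- rewrite /kraus_dual big1 => [|j _]; last by rewrite mulmx0 mul0mx.
  rewrite subr0 (_ : frobsq 0 = 0) ?mulr0 // frobsqE mulmx0 raddf0 //.
have b0 : 0 < b by apply: lt_le_trans (db i0).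
pose Si := specmx W (fun i => (s i)^-1); pose S := specmx W (fun i => s i).
have SSi : S *m Si = 1%:M.
  rewrite /S /Si (specmxM _ _ uW) -(specmx1 uW); apply: eq_specmx => i.
  by rewrite divff // gt_eqF // sqrtr_gt0.
have SiS : Si *m S = 1%:M by apply: mulmx1C.
pose X := Si *m Y *m Si.
have YE : Y = S *m X *m S.
  rewrite /X; move: (Si) (S) SSi SiS => A B BA AB.
  by rewrite !mulmxA BA mul1mx -mulmxA AB mulmx1.
have tX : \tr (D *m X) = 0.
  have -> : D = S *m S.
    by rewrite /S (specmxM _ _ uW) DE; apply: eq_specmx => i; rewrite (sqrt_eigen_sqr d0).
  by rewrite -mulmxA mxtrace_mulC -YE.
rewrite YE kraus_dual_sandwich -mulmxBl -mulmxBr.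
apply: le_trans (frobsq_sandwich_ge _ ad (ltW a0)).
apply: le_trans (ler_wpM2l (ltW a0) (gap_sqr g0 gap tX)).
have := frobsq_sandwich_le X db; rewrite -/S => h.
have -> x : a / b * g ^+ 2 * x = a * (g ^+ 2 * (b^-1 * x)) by ring.
by rewrite ler_pM2l // ler_wpM2l ?sqr_ge0 // ler_pdivrMl.
Qed.

End KMSContraction.

(** * The Cheeger inequality on a finite weighted graph *)

Section DiscreteCheeger.
Context {R : realType} {I : finType}.
Implicit Types (p x f g : I -> R) (w : I -> I -> R) (A : {set I}).

Section Coarea.
Context (w : I -> I -> R) (p : I -> R) (h : R).
Context (w0 : forall i j, 0 <= w i j) (p0 : forall i, 0 <= p i).
Context (cut : forall A, A != finset.set0 -> \sum_(i in A) p i <= 2^-1 ->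
  h * \sum_(i in A) p i <= \sum_i \sum_j w i j * ((i \in A) != (j \in A))%:R).

(* Layer-cake argument: induction on the support, peeling off the lowest level
   of f. *)
Lemma coarea_ge0 f : (forall i, 0 <= f i) -> \sum_(i | 0 < f i) p i <= 2^-1 ->
  h * \sum_i p i * f i <= \sum_i \sum_j w i j * `|f i - f j|.
Proof.
move: {2}_.+1 (ltnSn #|[set i | 0 < f i]|) => N.
elim: N f => // N IHN f suppN f0 pf.
pose A := [set i | 0 < f i].
have fA i : i \notin A -> f i = 0.
  by rewrite inE -leNgt => fi; apply/eqP; rewrite eq_le fi f0.
have [A0|/set0Pn[i1 i1A]] := eqVneq A finset.set0.
  rewrite (eq_bigr (fun=> 0)) => [|i _]; last by rewrite fA ?mulr0 // A0 inE.
  by rewrite big1 // mulr0; do 2![apply: sumr_ge0 => ? _]; rewrite mulr_ge0.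
have pA : \sum_(i in A) p i <= 2^-1.
  by apply: le_trans pf; rewrite le_eqVlt; apply/orP; left; apply/eqP/eq_bigl => i; rewrite inE.
have [i0 i0A i0min] := arg_minP f i1A.
have {}i0A : i0 \in A := i0A.
have c0 : 0 < f i0 by move: i0A; rewrite inE.
set c := f i0 in i0min c0.
(* [f] is [f'] plus [c] times the indicator of [A], and the differences across edges add without
   cancellation. [f'] vanishes at [i0], so its support is strictly smaller. *)
pose f' i := if i \in A then f i - c else 0.
have f'0 i : 0 <= f' i.
  by rewrite /f'; case: ifP => // iA; rewrite subr_ge0; apply: i0min.
have sub : [set i | 0 < f' i] \proper A.
  apply/properP; split.
    by apply/fintype.subsetP => i; rewrite inE /f'; case: ifP => //; rewrite ltxx.
  by exists i0 => //; rewrite inE /f' i0A subrr ltxx.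
have IH := IHN f' (leq_trans (proper_card sub) suppN) f'0.
have {}IH : h * \sum_i p i * f' i <= \sum_i \sum_j w i j * `|f' i - f' j|.
  apply: IH; apply: le_trans pA; rewrite [leRHS]big_mkcond [leLHS]big_mkcond /=.
  apply: ler_sum => i _; case: ifP => [fi|_]; last by case: ifP.
  suff -> : i \in A by [].
  by move: fi; rewrite /f'; case: ifP => //; rewrite ltxx.
have An0 : A != finset.set0 by apply/set0Pn; exists i1.
have := lerD IH (ler_wpM2l (ltW c0) (cut An0 pA)).
have -> : h * (\sum_i p i * f' i) + c * (h * (\sum_(i in A) p i)) = h * \sum_i p i * f i.
  rewrite mulrCA -mulrDr; congr (_ * _).
  rewrite mulr_sumr [X in _ + X]big_mkcond -big_split.
  apply: eq_bigr => i _; rewrite /f' /=; case: ifP => iA; first by ring.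
  by rewrite fA ?iA // mulr0 addr0.
move/le_trans; apply; rewrite mulr_sumr -big_split /= le_eqVlt; apply/orP; left.
apply/eqP/eq_bigr => i _; rewrite mulr_sumr -big_split /=; apply: eq_bigr => j _.
rewrite mulrCA -mulrDr /f'; congr (_ * _).
have [iA|iA] := boolP (i \in A); have [jA|jA] := boolP (j \in A) => /=.
- by rewrite mulr0 addr0; congr (`| _ |); ring.
- rewrite (fA j) // !subr0 mulr1 !ger0_norm ?subr_ge0 //; first by ring.
  exact: i0min.
- rewrite (fA i) // !sub0r !normrN mulr1 !ger0_norm ?subr_ge0 //; first by ring.
  exact: i0min.
- by rewrite !fA // mulr0 addr0.
Qed.

(** The positive and negative parts are handled separately; on each edge their variations add up to
    at most that of [g]. *)
Lemma coarea g : \sum_(i | 0 < g i) p i <= 2^-1 -> \sum_(i | g i < 0) p i <= 2^-1 ->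
  h * \sum_i p i * `|g i| <= \sum_i \sum_j w i j * `|g i - g j|.
Proof.
move=> gp gn.
pose pos i := Num.max (g i) 0; pose neg i := Num.max (- g i) 0.
have hp : h * \sum_i p i * pos i <= \sum_i \sum_j w i j * `|pos i - pos j|.
  apply: coarea_ge0 => [i|]; first by rewrite le_max lexx orbT.
  by under eq_bigl do rewrite lt_max ltxx orbF.
have hn : h * \sum_i p i * neg i <= \sum_i \sum_j w i j * `|neg i - neg j|.
  apply: coarea_ge0 => [i|]; first by rewrite le_max lexx orbT.
  by under eq_bigl do rewrite lt_max ltxx orbF oppr_gt0.
have := lerD hp hn.
rewrite -mulrDr -!big_split /= (eq_bigr (fun i => p i * `|g i|)); last first.
  move=> i _; rewrite -mulrDr; congr (_ * _); rewrite /pos /neg.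
  by case: (ler0P (g i)) => gi; case: (ler0P (- g i)) => gi' //; lra.
move/le_trans; apply; apply: ler_sum => i _; rewrite -big_split /=; apply: ler_sum => j _.
rewrite -mulrDr; apply: ler_wpM2l => //; rewrite /pos /neg.
have := ler_norm (g i - g j); have := ler_norm (g j - g i); rewrite distrC.
case: (ler0P (g i)) => gi; case: (ler0P (- g i)) => gi'; try lra;
case: (ler0P (g j)) => gj; case: (ler0P (- g j)) => gj'; try lra;
rewrite ?subrr ?subr0 ?sub0r ?normr0 ?addr0 ?add0r ?normrN ?normr_ge0 //;
rewrite ?(gtr0_norm gi) ?(gtr0_norm gj) ?(ler0_norm gi) ?(ler0_norm gj); try lra.
by rewrite -opprD normrN.
Qed.

End Coarea.

(** The median is the smallest value at which the cumulative mass reaches 1/2. The mass strictly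
    below it is the cumulative mass at the next smaller value, which falls short of 1/2. *)
Lemma weighted_median p x : (forall i, 0 <= p i) -> \sum_i p i = 1 ->
  exists c, \sum_(i | c < x i) p i <= 2^-1 /\ \sum_(i | x i < c) p i <= 2^-1.
Proof.
move=> p0 p1.
have [i1 _] : exists i : I, true.
  have [I0|/card_gt0P[i _]] := posnP #|I|; last by exists i.
  move: p1; rewrite big1 => [/eqP|i _]; first by rewrite eq_sym oner_eq0.
  by have := card0_eq I0 i; rewrite inE.
have [m _ mmax] := arg_maxP x (isT : predT i1).
have {}mmax j : x j <= x m := mmax j isT.
pose P i := 2^-1 <= \sum_(j | x j <= x i) p j.
have Pm : P m.
  rewrite /P (eq_bigl predT) => [|j]; last by rewrite mmax.
  by rewrite p1; lra.
have [k Pk kmin] := arg_minP x Pm.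
have split2 c : \sum_(i | x i <= c) p i + \sum_(i | c < x i) p i = 1.
  rewrite -p1 [RHS](bigID (fun i => x i <= c)) /=; congr (_ + _).
  by apply: eq_bigl => i; rewrite ltNge.
exists (x k); split.
  by have := split2 (x k); rewrite /P in Pk; lra.
have [noneq|[l lk]] : (forall i, ~~ (x i < x k)) \/ exists i, x i < x k.
  case: (pickP (fun i => x i < x k)) => [i xi|no]; first by right; exists i.
  by left=> i; rewrite no.
  by rewrite big_pred0 => [|i]; [lra|apply/negbTE].
have [l0 l0k l0max] := @arg_maxP _ _ _ l (fun i => x i < x k) x lk.
have : ~~ P l0 by apply/negP => /kmin; rewrite leNgt (l0k : x l0 < x k).
rewrite /P -ltNge => /ltW; apply: le_trans; rewrite le_eqVlt; apply/orP; left.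
apply/eqP/eq_bigl => j; apply/idP/idP => [|jl]; first exact: l0max.
exact: le_lt_trans jl l0k.
Qed.

(** The coarea inequality is applied to the signed square y |y| with y = x - c. Centring at a median
    keeps both sign sets below mass 1/2, and signed squares have the same sign sets as y. *)
Lemma discrete_cheeger p w (h m : R) x : 0 <= h -> 0 < m ->
  (forall i, 0 <= p i) -> \sum_i p i = 1 -> (forall i j, 0 <= w i j) ->
  (forall A, A != finset.set0 -> \sum_(i in A) p i <= 2^-1 ->
    h * \sum_(i in A) p i <= \sum_i \sum_j w i j * ((i \in A) != (j \in A))%:R) ->
  (forall i, \sum_j (w i j + w j i) <= m * p i) ->
  exists c, h ^+ 2 * \sum_i p i * (x i - c) ^+ 2 <=
    2 * m * \sum_i \sum_j w i j * (x i - x j) ^+ 2.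
Proof.
move=> h0 m0 p0 p1 w0 cut deg.
have [c [cp cn]] := weighted_median x p0 p1; exists c.
set E := \sum_i \sum_j _.
have E0 : 0 <= E by do 2![apply: sumr_ge0 => ? _]; rewrite mulr_ge0 ?sqr_ge0.
have [->|hn0] := eqVneq h 0.
  by rewrite expr0n mul0r !mulr_ge0 // ltW.
have {hn0 h0}h0 : 0 < h by rewrite lt_def hn0.
pose y i := x i - c; pose g i := y i * `|y i|.
set T := \sum_i p i * (x i - c) ^+ 2.
have gpos i : (0 < g i) = (c < x i).
  rewrite /g /y -[c < _]subr_gt0; case: (ltrgt0P (x i - c)) => yi.
  - by rewrite mulr_gt0.
  - by apply/negbTE; rewrite -leNgt; nra.
  - by rewrite mulr0 ltxx.
have gneg i : (g i < 0) = (x i < c).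
  rewrite /g /y -[_ < c]subr_lt0; case: (ltrgt0P (x i - c)) => yi.
  - by apply/negbTE; rewrite -leNgt mulr_ge0 // ltW.
  - by nra.
  - by rewrite mulr0 ltxx.
have hT : h * T <= \sum_i \sum_j w i j * `|g i - g j|.
  have := @coarea w p h w0 p0 cut g.
  rewrite (eq_bigl (fun i => c < x i)) => [|i]; last exact: gpos.
  move=> /(_ cp); rewrite (eq_bigl (fun i => x i < c)) => [|i]; last exact: gneg.
  move=> /(_ cn); apply: le_trans; rewrite le_eqVlt; apply/orP; left; apply/eqP.
  congr (_ * _); apply: eq_bigr => i _; rewrite /g normrM normr_id -expr2.
  by rewrite real_normK // num_real.
(* AM-GM replaces Cauchy-Schwarz. The parameter 2 m / h is chosen so that, after the degree bound,
   the second term equals h T and is absorbed by half of the left-hand side 2 h T. *)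
have amgm i j : 2 * `|g i - g j| <=
    2 * m / h * (x i - x j) ^+ 2 + h / (2 * m) * (2 * (y i ^+ 2 + y j ^+ 2)).
  have mh0 : 0 < 2 * m / h by rewrite !mulr_gt0 ?invr_gt0.
  have -> : h / (2 * m) = (2 * m / h)^-1 by field; rewrite !gt_eqF.
  set l := 2 * m / h in mh0 *.
  have xy : x i - x j = y i - y j by rewrite /y; ring.
  rewrite xy.
  have hg : `|g i - g j| <= `|y i - y j| * (`|y i| + `|y j|).
    rewrite /g.
    have := ler_norm (y i - y j); have := ler_norm (y j - y i); rewrite distrC.
    case: (ger0P (y i)) => yi; case: (ger0P (y j)) => yj;
      case: (ger0P (y i - y j)) => yij; case: ger0P => ?; nra.
  have sq (a : R) : `|a| ^+ 2 = a ^+ 2 by rewrite real_normK // num_real.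
  rewrite -(sq (y i - y j)) -(sq (y i)) -(sq (y j)).
  move: (`|y i - y j|) (`|y i|) (`|y j|) hg => a b e hg.
  have h1 : 2 * (a * (b + e)) <= l * a ^+ 2 + l^-1 * (b + e) ^+ 2.
    rewrite -subr_ge0.
    have -> : l * a ^+ 2 + l^-1 * (b + e) ^+ 2 - 2 * (a * (b + e)) =
        l^-1 * (l * a - (b + e)) ^+ 2 by field; rewrite gt_eqF.
    by rewrite mulr_ge0 ?sqr_ge0 // invr_ge0 ltW.
  have h2 : l^-1 * (b + e) ^+ 2 <= l^-1 * (2 * (b ^+ 2 + e ^+ 2)).
    apply: ler_wpM2l; first by rewrite invr_ge0 ltW.
    by have := sqr_ge0 (b - e); nra.
  lra.
have sumw : \sum_i \sum_j w i j * (2 * (y i ^+ 2 + y j ^+ 2)) <= 2 * m * T.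
  have -> : \sum_i \sum_j w i j * (2 * (y i ^+ 2 + y j ^+ 2)) =
      2 * \sum_i y i ^+ 2 * \sum_j (w i j + w j i).
    transitivity (2 * (\sum_i \sum_j y i ^+ 2 * w i j + \sum_i \sum_j y j ^+ 2 * w i j)).
      rewrite -big_split mulr_sumr; apply: eq_bigr => i _.
      by rewrite -big_split mulr_sumr; apply: eq_bigr => j _ /=; ring.
    congr (_ * _); rewrite [X in _ + X]exchange_big -big_split; apply: eq_bigr => i _ /=.
    by rewrite -!mulr_sumr -mulrDr big_split.
  rewrite -mulrA; apply: ler_wpM2l => //; rewrite /T mulr_sumr; apply: ler_sum => i _.
  have := ler_wpM2l (sqr_ge0 (y i)) (deg i); rewrite /y; move/le_trans; apply.
  by rewrite le_eqVlt; apply/orP; left; apply/eqP; ring.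
have main : 2 * (h * T) <= 2 * m / h * E + h / (2 * m) * (2 * m * T).
  apply: le_trans (ler_wpM2l (ler0n _ 2) hT) _.
  have l0 : 0 <= h / (2 * m) by rewrite divr_ge0 ?mulr_ge0 // ltW.
  apply: le_trans (lerD (lexx _) (ler_wpM2l l0 sumw)).
  rewrite /E !mulr_sumr -big_split; apply: ler_sum => i _ /=.
  rewrite !mulr_sumr -big_split; apply: ler_sum => j _ /=.
  by have := ler_wpM2l (w0 i j) (amgm i j); lra.
have : h * T <= 2 * m / h * E.
  have e : h / (2 * m) * (2 * m * T) = h * T by field; rewrite gt_eqF.
  by rewrite e in main; lra.
move/(ler_wpM2l (ltW h0)).
have -> : h * (2 * m / h * E) = 2 * m * E by field; rewrite gt_eqF.
by rewrite mulrA -expr2.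
Qed.

End DiscreteCheeger.

(** * The Dirichlet form as a sum of squared commutators *)

Section CauchyKernel.
Context {R : realType}.
Local Notation C := R[i].

(** Schur complement induction: subtracting the rank-one term through [e] leaves the same kernel
    with coefficients rescaled by [q], and [q e = 0] removes [e]. *)
Lemma cauchy_kernel_ge0 (A : Type) (r : seq A) (x : A -> R) (u : A -> C) :
  (forall a, 0 < x a) ->
  0 <= \sum_(a <- r) \sum_(b <- r) (x a + x b)^-1%:C * (u a * (u b)^cj).
Proof.
move=> x0; elim: r u => [|e r IHr] u; first by rewrite big_nil.
pose c := x e; have c0 : 0 < c := x0 e.
pose q a := (x a - c) / (x a + c).
have split2 a b : (x a + x b)^-1 =
    2 * c * ((x a + c)^-1 * (x b + c)^-1) + (x a + x b)^-1 * (q a * q b).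
  have := x0 a; have := x0 b => xb xa; rewrite /q; field.
  by rewrite !gt_eqF ?addr_gt0.
have -> : \sum_(a <- e :: r) \sum_(b <- e :: r) (x a + x b)^-1%:C * (u a * (u b)^cj) =
   (2 * c)%:C * ((\sum_(a <- e :: r) (x a + c)^-1%:C * u a) *
      (\sum_(a <- e :: r) (x a + c)^-1%:C * u a)^cj) +
   \sum_(a <- e :: r) \sum_(b <- e :: r) (x a + x b)^-1%:C *
      (((q a)%:C * u a) * ((q b)%:C * u b)^cj).
  rewrite conjc_sum mulr_suml mulr_sumr -big_split; apply: eq_bigr => a _.
  rewrite !mulr_sumr -big_split; apply: eq_bigr => b _ /=.
  rewrite !conjcM !conjc_real {1}split2 rmorphD !rmorphM; ring.
apply: addr_ge0; first by rewrite mulzJ -rmorphM lecR mulr_ge0 ?normsq_ge0 ?mulr_ge0 // ltW.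
have qe : (q e)%:C * u e = 0 by rewrite /q subrr mul0r mul0r.
rewrite big_cons big1 => [|b _]; last by rewrite qe mul0r mulr0.
rewrite add0r (eq_bigr (fun a => \sum_(b <- r) (x a + x b)^-1%:C *
  ((q a)%:C * u a * ((q b)%:C * u b)^cj))) => [|a _]; first exact: IHr.
by rewrite big_cons qe conjc0 !mulr0 add0r.
Qed.

(* Schur product of the Gram kernel of the K_j with the positive kernel
   1 / (x + y). *)
Lemma gram_cauchy {J : finType} n (K : J -> 'M[C]_n) (x : 'I_n -> 'I_n -> R) :
  (forall k l, 0 < x k l) ->
  exists V : 'I_(n * n) -> 'M[C]_n, forall k p q l,
    \sum_c V c k p * (V c q l)^cj =
    (x k p + x q l)^-1%:C * \sum_j K j k p * (K j q l)^cj.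
Proof.
move=> x0.
pose k1 (a : 'I_(n * n)) := (mxtens_unindex a).1.
pose k2 (a : 'I_(n * n)) := (mxtens_unindex a).2.
pose y a := x (k1 a) (k2 a); pose u j a := K j (k1 a) (k2 a).
pose T : 'M[C]_(n * n) := \matrix_(a, b) ((y a + y b)^-1%:C * \sum_j u j a * (u j b)^cj).
have TE a b : T a b = (y a + y b)^-1%:C * \sum_j u j a * (u j b)^cj by rewrite mxE.
have psdT : psdmx T.
  apply/psdP; split.
    apply/matrixP => a b; rewrite adjmxE !TE conjcM conjc_real addrC; congr (_ * _).
    rewrite conjc_sum; apply: eq_bigr => j _.
    by rewrite conjcM conjcK mulrC.
  move=> v.
  have -> : (v *m T *m v ^H) 0 0 = \sum_j \sum_a \sum_b
      (y a + y b)^-1%:C * ((v 0 a * u j a) * (v 0 b * u j b)^cj).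
    rewrite mulmxE [RHS]exchange_big.
    transitivity (\sum_b \sum_a \sum_j (y a + y b)^-1%:C *
       ((v 0 a * u j a) * (v 0 b * u j b)^cj)).
      apply: eq_bigr => b _; rewrite mulmxE mulr_suml; apply: eq_bigr => a _.
      rewrite adjmxE TE mulr_sumr mulr_sumr mulr_suml; apply: eq_bigr => j _.
      by rewrite conjcM; ring.
    rewrite [LHS]exchange_big /=; apply: eq_bigr => a _; exact: exchange_big.
  by apply: sumr_ge0 => j _; apply: cauchy_kernel_ge0 => a; apply: x0.
have [B BE] := psd_factor psdT.
exists (fun c => \matrix_(k, l) (B c (mxtens_index (k, l)))^cj) => k p q l.
have := TE (mxtens_index (k, p)) (mxtens_index (q, l)).
rewrite /y /u /k1 /k2 !mxtens_indexK /= BE mulmxE => <-; apply: eq_bigr => c _.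
by rewrite adjmxE !mxE conjcK.
Qed.

End CauchyKernel.

Section Derivation.
Context {R : realType} {n : nat} {J : finType}.
Local Notation C := R[i].
Context (s : 'I_n -> R) (s0 : forall i, 0 < s i) (K : J -> 'M[C]_n).
Local Notation kap k p q l := (\sum_j K j k p * (K j q l)^cj).
Context (kraus_diag : forall p q, \sum_k (s k ^+ 2)%:C * kap k p k q = (s p ^+ 2)%:C *+ (p == q)).
Context (kraus_unit : forall p q, \sum_l kap p l q l = 1 *+ (p == q)).
Context (kraus_sym : forall k p q l, (s k * s q)%:C * kap k p q l = (s p * s l)%:C * (kap p k l q)^cj).

(** The square of the commutator is expanded. The terms in V X and X V each give half of the KMS
    square of [X], by invariance of the density and by unitality; the cross term gives the pairing
    of [X] with its image, by KMS symmetry. *)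
Lemma derivation_diag : exists V : 'I_(n * n) -> 'M[C]_n, forall X : 'M[C]_n,
  \sum_c \sum_k \sum_l s k * s l * normsq ((V c *m X - X *m V c) k l) =
  \sum_k \sum_l s k * s l * normsq (X k l) -
  \sum_k \sum_q s k * s q * Re ((X k q)^cj * (kraus K X) k q).
Proof.
(* These ratios are the square roots of the modular eigenvalues. They reduce the kernel in V X to
   s_k / (s_p + s_q) and that in X V to s_p s_q / (s_l (s_p + s_q)), so that the sums over k and l
   meet the hypotheses on [K]. *)
have [V VP] := @gram_cauchy R J n K (fun k l => s l / s k) (fun k l => divr_gt0 (s0 l) (s0 k)).
exists V => X.
pose a c k l := (V c *m X) k l; pose b c k l := (X *m V c) k l.
have normsqB (z w : C) : normsq (z - w) = normsq z + normsq w - 2 * Re (z * w^cj).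
  by case: z w => [z1 z2] [w1 w2]; rewrite /normsq /=; ring.
have sum_a k l : \sum_c normsq (a c k l) =
    Re (\sum_p \sum_q (\sum_c V c k p * (V c k q)^cj) * (X p l * (X q l)^cj)).
  transitivity (Re (\sum_c a c k l * (a c k l)^cj)).
    by rewrite Re_sum; apply: eq_bigr => c _; rewrite mulzJ.
  congr Re.
  transitivity (\sum_c \sum_p \sum_q V c k p * (V c k q)^cj * (X p l * (X q l)^cj)).
    apply: eq_bigr => c _; rewrite /a mulmxE conjc_sum mulr_suml; apply: eq_bigr => p _.
    by rewrite mulr_sumr; apply: eq_bigr => q _; rewrite rmorphM /=; ring.
  rewrite exchange_big; apply: eq_bigr => p _; rewrite exchange_big; apply: eq_bigr => q _.
  by rewrite mulr_suml.
have sum_b k l : \sum_c normsq (b c k l) =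
    Re (\sum_p \sum_q (\sum_c V c p l * (V c q l)^cj) * (X k p * (X k q)^cj)).
  transitivity (Re (\sum_c b c k l * (b c k l)^cj)).
    by rewrite Re_sum; apply: eq_bigr => c _; rewrite mulzJ.
  congr Re.
  transitivity (\sum_c \sum_p \sum_q V c p l * (V c q l)^cj * (X k p * (X k q)^cj)).
    apply: eq_bigr => c _; rewrite /b mulmxE conjc_sum mulr_suml; apply: eq_bigr => p _.
    by rewrite mulr_sumr; apply: eq_bigr => q _; rewrite rmorphM /=; ring.
  rewrite exchange_big; apply: eq_bigr => p _; rewrite exchange_big; apply: eq_bigr => q _.
  by rewrite mulr_suml.
have sum_ab k l : \sum_c Re (a c k l * (b c k l)^cj) =
    \sum_p \sum_q (s p / s k + s l / s q)^-1 * Re (kap k p q l * (X p l * (X k q)^cj)).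
  rewrite -Re_sum.
  transitivity (Re (\sum_p \sum_q (\sum_c V c k p * (V c q l)^cj) * (X p l * (X k q)^cj))).
    congr Re.
    transitivity (\sum_c \sum_p \sum_q V c k p * (V c q l)^cj * (X p l * (X k q)^cj)).
      apply: eq_bigr => c _; rewrite /a /b !mulmxE conjc_sum mulr_suml; apply: eq_bigr => p _.
      by rewrite mulr_sumr; apply: eq_bigr => q _; rewrite rmorphM /=; ring.
    rewrite exchange_big; apply: eq_bigr => p _; rewrite exchange_big; apply: eq_bigr => q _.
    by rewrite mulr_suml.
  rewrite Re_sum; apply: eq_bigr => p _; rewrite Re_sum; apply: eq_bigr => q _.
  by rewrite VP -mulrA ReZ.
have N1 p q : \sum_k (s k)%:C * (\sum_c V c k p * (V c k q)^cj) = (s p / 2)%:C *+ (p == q).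
  transitivity ((s p + s q)^-1%:C * \sum_k (s k ^+ 2)%:C * kap k p k q).
    rewrite mulr_sumr; apply: eq_bigr => k _; rewrite VP !mulrA; congr (_ * _).
    rewrite -!rmorphM; congr (_%:C).
    by have := s0 k; have := s0 p; have := s0 q => ? ? ?; field; rewrite !gt_eqF ?addr_gt0.
  rewrite kraus_diag; case: eqP => [<-|_]; last by rewrite !mulr0n mulr0.
  rewrite !mulr1n -rmorphM; congr (_%:C).
  by have := s0 p => ?; field; rewrite !gt_eqF ?addr_gt0.
have N2 p q : \sum_l (s l)%:C * (\sum_c V c p l * (V c q l)^cj) = (s p / 2)%:C *+ (p == q).
  transitivity ((s p * s q / (s p + s q))%:C * \sum_l kap p l q l).
    rewrite mulr_sumr; apply: eq_bigr => l _; rewrite VP !mulrA; congr (_ * _).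
    rewrite -!rmorphM; congr (_%:C).
    by have := s0 l; have := s0 p; have := s0 q => ? ? ?; field; rewrite !gt_eqF ?addr_gt0 ?mulr_gt0.
  rewrite kraus_unit; case: eqP => [<-|_]; last by rewrite !mulr0n mulr0.
  rewrite !mulr1n mulr1; congr (_%:C).
  by have := s0 p => ?; field; rewrite !gt_eqF ?addr_gt0.
have T1 : \sum_k \sum_l s k * s l * \sum_c normsq (a c k l) =
    2^-1 * \sum_k \sum_l s k * s l * normsq (X k l).
  transitivity (\sum_l \sum_p \sum_q Re ((s l)%:C *
      ((\sum_k (s k)%:C * (\sum_c V c k p * (V c k q)^cj)) * (X p l * (X q l)^cj)))).
    rewrite exchange_big; apply: eq_bigr => l _.
    transitivity (\sum_k \sum_p \sum_q Re ((s l)%:C * ((s k)%:C *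
       (\sum_c V c k p * (V c k q)^cj) * (X p l * (X q l)^cj)))).
      apply: eq_bigr => k _; rewrite sum_a Re_sum mulr_sumr; apply: eq_bigr => p _.
      rewrite Re_sum mulr_sumr; apply: eq_bigr => q _.
      by rewrite -(mulrA (s k)%:C) !ReZ; ring.
    rewrite exchange_big; apply: eq_bigr => p _; rewrite exchange_big; apply: eq_bigr => q _.
    by rewrite -Re_sum -mulr_sumr -mulr_suml.
  rewrite [in RHS]exchange_big mulr_sumr; apply: eq_bigr => l _; rewrite mulr_sumr.
  apply: eq_bigr => p _; rewrite (bigD1 p) //= N1 eqxx mulr1n mulzJ !ReZ /=.
  rewrite big1 => [|q /negbTE qp]; first by field.
  by rewrite N1 eq_sym qp mulr0n mul0r mulr0.
have T2 : \sum_k \sum_l s k * s l * \sum_c normsq (b c k l) =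
    2^-1 * \sum_k \sum_l s k * s l * normsq (X k l).
  transitivity (\sum_k \sum_p \sum_q Re ((s k)%:C *
      ((\sum_l (s l)%:C * (\sum_c V c p l * (V c q l)^cj)) * (X k p * (X k q)^cj)))).
    apply: eq_bigr => k _.
    transitivity (\sum_l \sum_p \sum_q Re ((s k)%:C * ((s l)%:C *
       (\sum_c V c p l * (V c q l)^cj) * (X k p * (X k q)^cj)))).
      apply: eq_bigr => l _; rewrite sum_b Re_sum mulr_sumr; apply: eq_bigr => p _.
      rewrite Re_sum mulr_sumr; apply: eq_bigr => q _.
      by rewrite -(mulrA (s l)%:C) !ReZ; ring.
    rewrite exchange_big; apply: eq_bigr => p _; rewrite exchange_big; apply: eq_bigr => q _.
    by rewrite -Re_sum -mulr_sumr -mulr_suml.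
  rewrite mulr_sumr; apply: eq_bigr => k _; rewrite mulr_sumr.
  apply: eq_bigr => p _; rewrite (bigD1 p) //= N2 eqxx mulr1n mulzJ !ReZ /=.
  rewrite big1 => [|q /negbTE qp]; first by field.
  by rewrite N2 eq_sym qp mulr0n mul0r mulr0.
pose tau k p q l := Re (kap k p q l * (X p l * (X k q)^cj)).
have tau_sym k p q l : s k * s q * tau k p q l = s p * s l * tau p k l q.
  rewrite /tau -!ReZ mulrA kraus_sym -[in RHS]ReJ !conjcM conjc_real conjcK.
  by rewrite -!mulrA (mulrC (X p l)).
have T3 : 2 * (\sum_k \sum_l s k * s l * \sum_c Re (a c k l * (b c k l)^cj)) =
    \sum_k \sum_q s k * s q * Re ((X k q)^cj * (kraus K X) k q).
  pose f k p q l := s k * s l * ((s p / s k + s l / s q)^-1 * tau k p q l).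
  have -> : \sum_k \sum_l s k * s l * \sum_c Re (a c k l * (b c k l)^cj) =
      \sum_k \sum_p \sum_q \sum_l f k p q l.
    apply: eq_bigr => k _.
    transitivity (\sum_l \sum_p \sum_q f k p q l).
      apply: eq_bigr => l _; rewrite sum_ab mulr_sumr; apply: eq_bigr => p _.
      by rewrite mulr_sumr.
    by rewrite exchange_big; apply: eq_bigr => p _; rewrite exchange_big.
  (* After k and p, and q and l, are exchanged, [tau_sym] brings both summands to the same [tau],
     and the two Cauchy weights add up to exactly s_k s_q. *)
  have swap : \sum_k \sum_p \sum_q \sum_l f k p q l = \sum_k \sum_p \sum_q \sum_l f p k l q.
    by rewrite exchange_big; do 2![apply: eq_bigr => ? _]; rewrite exchange_big.
  transitivity (\sum_k \sum_p \sum_q \sum_l f k p q l + \sum_k \sum_p \sum_q \sum_l f p k l q).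
    by rewrite -swap; ring.
  transitivity (\sum_k \sum_p \sum_q \sum_l s k * s q * tau k p q l).
    rewrite -big_split; apply: eq_bigr => k _; rewrite -big_split; apply: eq_bigr => p _.
    rewrite -big_split; apply: eq_bigr => q _; rewrite -big_split; apply: eq_bigr => l _ /=.
    rewrite /f.
    have -> : tau p k l q = s k * s q / (s p * s l) * tau k p q l.
      have pl0 : s p * s l != 0 by rewrite gt_eqF ?mulr_gt0.
      apply: (mulfI pl0); rewrite -tau_sym; move: (tau k p q l) => z.
      by field; rewrite !gt_eqF.
    move: (tau k p q l) => z.
    have := s0 k; have := s0 p; have := s0 q; have := s0 l => ? ? ? ?; field.
    by rewrite !gt_eqF ?addr_gt0 ?mulr_gt0.
  apply: eq_bigr => k _; rewrite exchange_big; apply: eq_bigr => q _.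
  transitivity (s k * s q * Re (\sum_p \sum_l kap k p q l * (X p l * (X k q)^cj))).
    rewrite Re_sum mulr_sumr; apply: eq_bigr => p _.
    by rewrite Re_sum mulr_sumr.
  congr (_ * Re _); rewrite [kraus K X](_ : _ = kraus K (\sum_i \sum_j X i j *: delta_mx i j)).
    rewrite kraus_sum summxE mulr_sumr.
    apply: eq_bigr => p _; rewrite kraus_sum summxE mulr_sumr; apply: eq_bigr => l _.
    by rewrite krausZ mxE kraus_delta; ring.
  by rewrite -matrix_sum_delta.
transitivity (\sum_k \sum_l s k * s l * \sum_c normsq (a c k l) +
  \sum_k \sum_l s k * s l * \sum_c normsq (b c k l) -
  2 * (\sum_k \sum_l s k * s l * \sum_c Re (a c k l * (b c k l)^cj))); last first.
  by rewrite T1 T2 T3; field.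
rewrite exchange_big -big_split mulr_sumr -sumrB; apply: eq_bigr => k _ /=.
rewrite exchange_big -big_split mulr_sumr -sumrB; apply: eq_bigr => l _ /=.
rewrite -mulr_sumr -mulrDr mulrCA -mulrBr; congr (_ * _).
rewrite -big_split mulr_sumr -sumrB; apply: eq_bigr => c _ /=.
by rewrite -normsqB /a /b [in LHS]mxE [X in _ + X]mxE.
Qed.

End Derivation.

(** * From the conductance of projections to a Poincare inequality *)

Section KMSCheeger.
Context {R : realType} {n : nat} {J : finType}.
Local Notation C := R[i].
Context (D W : 'M[C]_n) (d : 'I_n -> R).
Context (uW : unitary W) (DE : D = specmx W d) (d0 : forall i, 0 < d i)
  (SE : sqrtmx D = specmx W (fun i => Num.sqrt (d i))).
Context (K : J -> 'M[C]_n) (K1 : kraus K 1%:M = 1%:M) (KD : kraus_dual K D = D)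
  (Ksym : forall X Y, kms_inner D (kraus K X) Y = kms_inner D X (kraus K Y)).
Local Notation s i := (Num.sqrt (d i)).
Local Notation hat X := (W *m X *m W ^H).
Local Notation kmsb := (kmsb D).
Implicit Types (X Y Z : 'M[C]_n).

Lemma hatM X Y : hat X *m hat Y = hat (X *m Y).
Proof.
case: uW => _ WW; rewrite !mulmxA -(mulmxA _ (W ^H)) WW mulmx1.
by rewrite -!mulmxA.
Qed.

Lemma hat_adj X : (hat X) ^H = hat (X ^H).
Proof. by rewrite !adjmxM adjmxK mulmxA. Qed.

Lemma hat_sum (F : J -> 'M[C]_n) : hat (\sum_j F j) = \sum_j hat (F j).
Proof. by rewrite mulmx_sumr mulmx_suml. Qed.

Lemma kraus_hat X : kraus (fun j => hat (K j)) (hat X) = hat (kraus K X).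
Proof. by rewrite /kraus hat_sum; apply: eq_bigr => j _; rewrite hat_adj !hatM. Qed.

Lemma kraus_dual_hat X : kraus_dual (fun j => hat (K j)) (hat X) = hat (kraus_dual K X).
Proof. by rewrite /kraus_dual hat_sum; apply: eq_bigr => j _; rewrite hat_adj !hatM. Qed.

Lemma kraus_dual_entry (L : J -> 'M[C]_n) (f : 'I_n -> 'I_n -> C) q p :
  (kraus_dual L (\matrix_(i, j) f i j)) q p =
  \sum_j \sum_k \sum_l (L j k q)^cj * f k l * L j l p.
Proof.
rewrite /kraus_dual summxE; apply: eq_bigr => j _; rewrite mulmxE.
rewrite exchange_big; apply: eq_bigr => l _; rewrite mulmxE mulr_suml.
by apply: eq_bigr => k _; rewrite adjmxE mxE.
Qed.

(** In the eigenbasis of [D], invariance, unitality and KMS symmetry become the three entrywise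
    identities that [derivation_diag] asks for. *)
Lemma kms_derivation : exists V : 'I_(n * n) -> 'M[C]_n, forall X,
  \sum_c kmsb (V c *m X - X *m V c) (V c *m X - X *m V c) = kmsb X (X - kraus K X).
Proof.
pose Kh j := hat (K j).
have hat1 : hat 1%:M = 1%:M by case: uW => WW _; rewrite mulmx1 WW.
have s0 i : 0 < s i by apply: sqrt_eigen_gt0.
have ssq i : s i ^+ 2 = d i by rewrite expr2 (sqrt_eigen_sqr d0).
have Kd p q : \sum_k (s k ^+ 2)%:C * (\sum_j Kh j k p * (Kh j k q)^cj) =
    (s p ^+ 2)%:C *+ (p == q).
  have : kraus_dual Kh (diagR d) = diagR d.
    by rewrite -(conj_specmx d uW) -DE kraus_dual_hat KD.
  have -> : diagR d = \matrix_(i, j) ((d i)%:C *+ (i == j)).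
    by apply/matrixP => i j; rewrite diagRE mxE.
  move/matrixP/(_ q p); rewrite kraus_dual_entry mxE eq_sym ssq => E.
  have -> : (d p)%:C *+ (p == q) = (d q)%:C *+ (p == q) by case: eqP => [->|].
  rewrite -E exchange_big; apply: eq_bigr => k _; rewrite mulr_sumr; apply: eq_bigr => j _.
  rewrite (bigD1 k) //= eqxx mulr1n big1 => [|l /negbTE lk]; last first.
    by rewrite eq_sym lk mulr0n mulr0 mul0r.
  by rewrite addr0 ssq; ring.
have Ku p q : \sum_l (\sum_j Kh j p l * (Kh j q l)^cj) = 1 *+ (p == q).
  have : kraus Kh 1%:M = 1%:M by rewrite -hat1 kraus_hat K1.
  move/matrixP/(_ p q); rewrite [RHS]mxE => <-; rewrite exchange_big /kraus summxE.
  apply: eq_bigr => j _; rewrite mulmx1 mulmxE; apply: eq_bigr => l _.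
  by rewrite adjmxE.
(* The identity [kraus_dual_sandwich] at the matrix unit (p, l), read at the entry (k, q). *)
have Ks k p q l : (s k * s q)%:C * (\sum_j Kh j k p * (Kh j q l)^cj) =
    (s p * s l)%:C * (\sum_j Kh j p k * (Kh j l q)^cj)^cj.
  have hatS : hat (specmx W (fun i => s i)) = diagR (fun i => s i) by apply: conj_specmx.
  pose X := W ^H *m delta_mx p l *m W.
  have hX : hat X = delta_mx p l.
    by have := unitary_conjK (delta_mx p l) (unitary_adj uW) (unitary_adj uW); rewrite adjmxK.
  have := kraus_dual_sandwich SE Ksym X.
  move: (specmx W _) hatS => S hatS sandwich.
  have hatSS Y : hat (S *m Y *m S) = diagR (fun i => s i) *m hat Y *m diagR (fun i => s i).
    by rewrite -(hatM (S *m Y) S) -(hatM S Y) hatS.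
  have := kraus_dual_hat (S *m X *m S).
  rewrite sandwich !hatSS -kraus_hat hX.
  have -> : diagR (fun i => s i) *m delta_mx p l *m diagR (fun i => s i) =
      \matrix_(i, j) ((s p * s l)%:C * ((i == p) && (j == l))%:R).
    apply/matrixP => i j; rewrite mul_mx_diagR mul_diagR !mxE.
    case: (eqVneq i p) => [->|_]; case: (eqVneq j l) => [->|_] /=; rewrite ?mulr0 //.
    by rewrite !mulr1 rmorphM mulrC.
  move/matrixP/(_ k q); rewrite kraus_dual_entry mul_mx_diagR mul_diagR kraus_delta => E.
  rewrite rmorphM -mulrA mulrCA -E conjc_sum mulr_sumr; apply: eq_bigr => j _.
  rewrite (bigD1 p) //= (bigD1 l) //= !eqxx mulr1 big1 => [|l' /negbTE ll]; last first.
    by rewrite ll andbF !mulr0 mul0r.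
  rewrite addr0 big1 => [|p' /negbTE pp]; last first.
    by rewrite big1 // => l' _; rewrite pp !mulr0 mul0r.
  by rewrite addr0 conjcM conjcK; ring.
have [V VP] := derivation_diag s0 Kd Ku Ks.
exists (fun c => W ^H *m V c *m W) => X.
rewrite kmsbBr (kmsqE uW SE) (kmsbE uW SE).
have -> : \sum_i \sum_j s i * s j * Re ((hat X i j)^cj * hat (kraus K X) i j) =
   \sum_k \sum_q s k * s q * Re ((hat X k q)^cj * (kraus Kh (hat X)) k q).
  by apply: eq_bigr => i _; apply: eq_bigr => j _; rewrite kraus_hat.
rewrite -(VP (hat X)); apply: eq_bigr => c _; rewrite (kmsqE uW SE).
apply: eq_bigr => k _; apply: eq_bigr => l _; congr (_ * normsq (_ k l)).
have hV : hat (W ^H *m V c *m W) = V c.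
  by have := unitary_conjK (V c) (unitary_adj uW) (unitary_adj uW); rewrite adjmxK.
by rewrite mulmxBr mulmxBl -(hatM (W ^H *m V c *m W)) -(hatM X) hV.
Qed.

Lemma specmx_indicator (U : 'M[C]_n) (A : {set 'I_n})
    (P := specmx U (fun i => (i \in A)%:R)) : unitary U -> P ^H = P /\ P *m P = P.
Proof.
move=> uU; split; first exact: specmx_adj.
rewrite /P (specmxM _ _ uU); apply: eq_specmx => i.
by case: (i \in A); rewrite ?mulr1 ?mulr0.
Qed.

Lemma frobsq_commutator U (y : 'I_n -> R) X : unitary U ->
  frobsq (X *m specmx U y - specmx U y *m X) =
  \sum_i \sum_j normsq ((U *m X *m U ^H) i j) * (y i - y j) ^+ 2.
Proof.
move=> uU; have [UU U1] := uU; rewrite -(frobsq_unitary _ uU uU).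
have -> : U *m (X *m specmx U y - specmx U y *m X) *m U ^H =
    (U *m X *m U ^H) *m diagR y - diagR y *m (U *m X *m U ^H).
  rewrite specmxE mulmxBr mulmxBl !mulmxA UU mul1mx.
  by rewrite -(mulmxA _ U (U ^H)) UU mulmx1.
apply: eq_bigr => i _; apply: eq_bigr => j _.
have -> : (U *m X *m U ^H *m diagR y - diagR y *m (U *m X *m U ^H)) i j =
   (y j - y i)%:C * (U *m X *m U ^H) i j.
  by rewrite rmorphB mulrBl -mul_mx_diagR -mul_diagR !mxE.
by rewrite normsqM normsqR; ring.
Qed.

Lemma kms_inner1 X : kmsb 1%:M X = Re (\tr (D *m X)).
Proof.
rewrite /kmsb /kms_inner adjE adjmx1 mul1mx -mulmxA mxtrace_mulC -mulmxA mxtrace_mulC.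
have -> : sqrtmx D *m sqrtmx D = D; last by [].
rewrite SE (specmxM _ _ uW) DE.
by apply: eq_specmx => i; rewrite (sqrt_eigen_sqr d0).
Qed.

(** The vertices are the eigenvectors of [X], with mass their expectation under the state; the edge
    weights are the squared entries of the commutator matrices in this basis. Frobenius energies [E]
    and KMS energies [Q] satisfy a E <= Q <= b E, so the graph has conductance at least h / b and
    degree constant lam / a. *)
Lemma kms_cheeger (g h lam a b : R) X : \tr D = 1 -> 0 < g -> 0 <= h -> 0 < lam ->
  0 < a -> (forall i, a <= d i) -> (forall i, d i <= b) ->
  (forall P, P ^H = P -> P *m P = P -> P != 0 -> P != 1%:M ->
    h * Num.min (Re (\tr (D *m P))) (1 - Re (\tr (D *m P))) <= g * kmsb P (P - kraus K P)) ->
  (forall Z, g * kmsb Z (Z - kraus K Z) <= lam * kmsb Z Z) ->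
  X ^H = X -> \tr (D *m X) = 0 ->
  h ^+ 2 * a ^+ 2 * kmsb X X <= 2 * b ^+ 2 * lam * (g * kmsb X (X - kraus K X)).
Proof.
move=> trD g0 h0 lam0 a0 ad db cond opn hX tX.
have [U [x [uU XE _]]] := herm_specmx hX; have [UU U1] := uU.
have [V VP] := kms_derivation.
pose w i j := g * \sum_c normsq ((U *m V c *m U ^H) i j).
have w0 i j : 0 <= w i j.
  by rewrite mulr_ge0 ?(ltW g0) //; apply: sumr_ge0 => c _; apply: normsq_ge0.
pose E (y : 'I_n -> R) := \sum_i \sum_j w i j * (y i - y j) ^+ 2.
pose Q Z := g * kmsb Z (Z - kraus K Z).
have EE y : E y = g * \sum_c frobsq (V c *m specmx U y - specmx U y *m V c).
  rewrite (eq_bigr _ (fun c _ => frobsq_commutator y (V c) uU)).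
  rewrite /E exchange_big [in RHS]exchange_big mulr_sumr /=.
  rewrite exchange_big; apply: eq_bigr => i _.
  rewrite exchange_big mulr_sumr; apply: eq_bigr => j _.
  by rewrite /w -mulr_suml mulrA.
have aE y : a * E y <= Q (specmx U y).
  rewrite EE /Q -VP mulrCA ler_pM2l // mulr_sumr; apply: ler_sum => c _.
  by apply: (kmsq_ge_frobsq uW SE) => //; apply: ltW.
have Eb y : Q (specmx U y) <= b * E y.
  rewrite EE /Q -VP mulrCA ler_pM2l // mulr_sumr; apply: ler_sum => c _.
  exact: (kmsq_le_frobsq uW d0 SE).
pose p i := Re ((U *m D *m U ^H) i i).
have rhoE y : Re (\tr (D *m specmx U y)) = \sum_i y i * p i.
  by rewrite mxtrace_specmx_mul Re_sum; apply: eq_bigr => i _; rewrite ReZ.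
have p1 : \sum_i p i = 1.
  have := rhoE (fun=> 1); rewrite (specmx1 uU) mulmx1 trD => /= ->.
  by apply: eq_bigr => i _; rewrite mul1r.
pose e i (k : 'I_n) : R := (k \in [set i])%:R.
have rho_e i : Re (\tr (D *m specmx U (e i))) = p i.
  rewrite rhoE (bigD1 i) //= /e inE eqxx mul1r big1 ?addr0 // => k ki.
  by rewrite inE (negbTE ki) mul0r.
(* For a projection both GNS terms equal its expectation, so AM-GM bounds the KMS square by that
   expectation. *)
have kms_rho (A : {set 'I_n}) (P := specmx U (fun i => (i \in A)%:R)) :
    kmsb P P <= Re (\tr (D *m P)).
  have [PH PP] := specmx_indicator A uU.
  have := kmsq_le_gns uW DE d0 SE P; rewrite /P PH PP; lra.
have p0 i : 0 <= p i.
  by rewrite -rho_e; apply: le_trans (kms_rho _); apply: (kmsq_ge0 uW SE).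
have b0 : 0 < b.
  have [i _] : exists i : 'I_n, true.
    case: (posnP n) => [n0|n0]; last by exists (Ordinal n0).
    move: p1; rewrite big1 => [/eqP|i _]; first by rewrite eq_sym oner_eq0.
    by exfalso; move: (ltn_ord i); rewrite {2}n0.
  exact: lt_le_trans (lt_le_trans a0 (ad i)) (db i).
have cut (A : {set 'I_n}) : A != finset.set0 -> \sum_(i in A) p i <= 2^-1 ->
    h / b * \sum_(i in A) p i <= \sum_i \sum_j w i j * ((i \in A) != (j \in A))%:R.
  move=> A0 pA; pose P := specmx U (fun i => (i \in A)%:R).
  have [PH PP] := specmx_indicator A uU; rewrite -/P in PH PP.
  have rP : Re (\tr (D *m P)) = \sum_(i in A) p i.
    rewrite /P rhoE [RHS]big_mkcond; apply: eq_bigr => i _.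
    by case: (i \in A); rewrite ?mul1r ?mul0r.
  have P1 : P != 1%:M.
    by apply/eqP => P1; move: rP; rewrite P1 mulmx1 trD /= => e1; move: pA; rewrite -e1; lra.
  have P0 : P != 0.
    have /set0Pn[i iA] := A0; apply/eqP => P0.
    have := conj_specmx (fun i => (i \in A)%:R) uU; rewrite -/P P0 mulmx0 mul0mx.
    move/matrixP/(_ i i); rewrite diagRE mxE eqxx iA mulr1n => /eqP.
    by rewrite eq_sym oner_eq0.
  have := le_trans (cond P PH PP P0 P1) (Eb _).
  rewrite rP min_l; last by lra.
  have -> : E (fun i => (i \in A)%:R) =
      \sum_i \sum_j w i j * ((i \in A) != (j \in A))%:R.
    apply: eq_bigr => i _; apply: eq_bigr => j _; congr (_ * _).
    by case: (i \in A); case: (j \in A); rewrite /= ?subrr ?subr0 ?sub0r ?sqrrN ?expr1n ?expr0n.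
  by rewrite mulrAC ler_pdivrMr // [b * _]mulrC.
(* Loops contribute to no energy and no cut, but they would count in the degrees. *)
pose w' i j := w i j * (i != j)%:R.
have w'0 i j : 0 <= w' i j by rewrite mulr_ge0.
have w'E (y : 'I_n -> R) : \sum_i \sum_j w' i j * (y i - y j) ^+ 2 = E y.
  apply: eq_bigr => i _; apply: eq_bigr => j _; rewrite /w'.
  by case: (eqVneq i j) => [->|_] /=; rewrite ?mulr1 // subrr expr0n !mulr0.
(* The degree of a vertex is the energy of its indicator, that is, of a rank-one spectral
   projection, to which the operator bound applies. *)
have deg i : \sum_j (w' i j + w' j i) <= lam / a * p i.
  have -> : \sum_j (w' i j + w' j i) = E (e i).
    have wii : w' i i = 0 by rewrite /w' eqxx mulr0.
    rewrite -w'E (bigD1 i) //= [RHS](bigD1 i) //= wii addr0 add0r.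
    rewrite [X in _ = X + _](bigD1 i) //= wii mul0r add0r big_split; congr (_ + _).
      apply: eq_bigr => j /negbTE ji.
      by rewrite /e !inE eqxx ji subr0 expr1n mulr1.
    apply: eq_bigr => j /negbTE ji; rewrite (bigD1 i) //= /e !inE eqxx ji sub0r sqrrN expr1n mulr1.
    by rewrite big1 ?addr0 // => k /negbTE ki; rewrite !inE ki subrr expr0n mulr0.
  have h1 := aE (e i); have h2 := opn (specmx U (e i)).
  have h3 := ler_wpM2l (ltW lam0) (kms_rho [set i]).
  rewrite mulrAC ler_pdivlMr // mulrC -rho_e.
  exact: le_trans h1 (le_trans h2 h3).
have cut' (A : {set 'I_n}) : A != finset.set0 -> \sum_(i in A) p i <= 2^-1 ->
    h / b * \sum_(i in A) p i <= \sum_i \sum_j w' i j * ((i \in A) != (j \in A))%:R.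
  move=> A0 pA; apply: le_trans (cut A A0 pA) _; rewrite le_eqVlt; apply/orP; left.
  apply/eqP; apply: eq_bigr => i _; apply: eq_bigr => j _; rewrite /w'.
  by case: (eqVneq i j) => [->|_] /=; rewrite ?mulr1 // eqxx !mulr0.
have [c cP] := discrete_cheeger x (divr_ge0 h0 (ltW b0)) (divr_gt0 lam0 a0) p0 p1 w'0 cut' deg.
rewrite w'E in cP.
(* The centre [c] need not be the mean, but [X] has mean 0, so the shift by [c] only increases the
   KMS square. *)
have var : kmsb X X <= \sum_i p i * (x i - c) ^+ 2.
  pose Z := X - c%:C *: 1%:M.
  have kX1 : kmsb X 1%:M = 0 by rewrite (kmsbC uW SE) kms_inner1 tX.
  have ZZ : kmsb Z Z = kmsb X X + c ^+ 2 * kmsb 1%:M 1%:M.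
    rewrite /Z (kmsbBl uW SE) !(kmsbBr D) !(kmsbZl uW SE) !(kmsbZr D) (kmsbC uW SE 1%:M X) kX1.
    by ring.
  have hZ : Z ^H = Z by rewrite /Z adjmxB adjmxZ conjc_real adjmx1 hX.
  have ZE : Z = specmx U (fun i => 1 * x i + (- c) * 1).
    rewrite (specmx_comb U x (fun=> 1)) (specmx1 uU) -XE rmorph1 scale1r rmorphN.
    by rewrite scaleNr.
  have := kmsq_le_gns uW DE d0 SE Z; rewrite hZ.
  have -> : Re (\tr (D *m (Z *m Z))) = \sum_i p i * (x i - c) ^+ 2.
    rewrite ZE (specmxM _ _ uU) rhoE; apply: eq_bigr => i _; ring.
  exact: le_of_double ZZ (mulr_ge0 (sqr_ge0 c) (kmsq_ge0 uW SE 1%:M)).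
have hE := aE x; rewrite -XE in hE.
have h2 : 0 <= h ^+ 2 by apply: sqr_ge0.
have := ler_wpM2l (mulr_ge0 h2 (sqr_ge0 a)) var; move/le_trans; apply.
have -> y : h ^+ 2 * a ^+ 2 * y = (a ^+ 2 * b ^+ 2) * ((h / b) ^+ 2 * y).
  by field; rewrite gt_eqF.
apply: le_trans (ler_wpM2l _ cP) _; first by rewrite mulr_ge0 ?sqr_ge0.
have -> y : a ^+ 2 * b ^+ 2 * (2 * (lam / a) * y) = 2 * b ^+ 2 * lam * (a * y).
  by field; rewrite gt_eqF.
by apply: ler_wpM2l => //; rewrite !mulr_ge0 ?sqr_ge0 // ltW.
Qed.

End KMSCheeger.

(** * Tensor products, blocks and the partial trace *)

Section Tensor.
Context {R : realType} {n m : nat}.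
Local Notation C := R[i].
Implicit Types (E Y Z : 'M[C]_(n * m)).

Lemma mx1E p (i j : 'I_p) : (1%:M : 'M[C]_p) i j = (i == j)%:R.
Proof. by rewrite mxE. Qed.

Lemma tensmx_adj (A : 'M[C]_n) (B : 'M[C]_m) : (A *t B) ^H = A ^H *t B ^H.
Proof.
apply/matrixP => k l; case: (mxtens_indexP k) => i a; case: (mxtens_indexP l) => j b.
by rewrite adjmxE !tensmxE conjcM !adjmxE.
Qed.

Lemma tensmx11 : (1%:M : 'M[C]_n) *t (1%:M : 'M[C]_m) = 1%:M.
Proof.
apply/matrixP => k l; case: (mxtens_indexP k) => i a; case: (mxtens_indexP l) => j b.
rewrite tensmxE !mxE -natrM mulnb (inj_eq (can_inj (@mxtens_indexK n m))).
by rewrite xpair_eqE.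
Qed.

Lemma tensmx_suml (I : Type) (r : seq I) (A : I -> 'M[C]_n) (B : 'M[C]_m) :
  (\sum_(i <- r) A i) *t B = \sum_(i <- r) (A i *t B).
Proof.
apply/matrixP => k l; case: (mxtens_indexP k) => i a; case: (mxtens_indexP l) => j b.
rewrite tensmxE !summxE mulr_suml; apply: eq_bigr => c _.
by rewrite tensmxE.
Qed.

Lemma unitary_tens (W : 'M[C]_n) (V : 'M[C]_m) : unitary W -> unitary V ->
  unitary (W *t V).
Proof.
by move=> [W1 W2] [V1 V2]; split; rewrite tensmx_adj tensmx_mul ?W1 ?W2 ?V1 ?V2 tensmx11.
Qed.

Lemma specmx_tens (W : 'M[C]_n) (V : 'M[C]_m) (f : 'I_n -> R) (g : 'I_m -> R) :
  specmx W f *t specmx V g =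
  specmx (W *t V) (fun k => f (mxtens_unindex k).1 * g (mxtens_unindex k).2).
Proof.
rewrite !specmxE -!tensmx_mul tensmx_adj; congr (_ *m _ *m _).
apply/matrixP => k l; case: (mxtens_indexP k) => i a; case: (mxtens_indexP l) => j b.
rewrite tensmxE !diagRE !mxtens_indexK /= (inj_eq (can_inj (@mxtens_indexK n m))) xpair_eqE.
by case: (i == j); case: (a == b); rewrite /= ?mulr1n ?mulr0n ?mulr0 ?mul0r // rmorphM.
Qed.

Lemma mxtrace_tens_sum E : \tr E = \tr (partial_trace E).
Proof.
rewrite !mxtraceE mxtens_sum exchange_big; apply: eq_bigr => a _.
rewrite mxE mxtraceE; apply: eq_bigr => i _.
by rewrite mxE.
Qed.

Lemma mxtens_blockB Y Z a b :
  mxtens_block (Y - Z) a b = mxtens_block Y a b - mxtens_block Z a b.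
Proof. by apply/matrixP => i j; rewrite !mxE. Qed.

Lemma mxtens_block_tens (A : 'M[C]_n) (B : 'M[C]_m) a b :
  mxtens_block (A *t B) a b = B a b *: A.
Proof. by apply/matrixP => i j; rewrite [LHS]mxE tensmxE mxE mulrC. Qed.

Lemma mxtens_block_kraus_dual {J : finType} (K : J -> 'M[C]_n) E a b :
  mxtens_block (kraus_dual (fun j => K j *t 1%:M) E) a b =
  kraus_dual K (mxtens_block E a b).
Proof.
apply/matrixP => p q; rewrite mxE /kraus_dual !summxE; apply: eq_bigr => j _.
rewrite !mulmxE mxtens_sum; apply: eq_bigr => l _.
rewrite (bigD1 b) //= tensmxE mx1E eqxx mulr1 [X in _ + X]big1 ?addr0; last first.
  by move=> c /negbTE cb; rewrite tensmxE mx1E cb !mulr0.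
congr (_ * _); rewrite !mulmxE mxtens_sum; apply: eq_bigr => k _.
rewrite (bigD1 a) //= tensmx_adj tensmxE !adjmxE mx1E eqxx conjc1 mulr1.
rewrite [X in _ + X]big1 ?addr0 => [|c /negbTE ca].
  by rewrite mxE.
by rewrite tensmxE [X in _ * X * _]adjmxE mx1E ca conjc0 mulr0 mul0r.
Qed.

Lemma partial_trace_kraus_dual {J : finType} (K : J -> 'M[C]_n) E :
  kraus K 1%:M = 1%:M ->
  partial_trace (kraus_dual (fun j => K j *t 1%:M) E) = partial_trace E.
Proof.
move=> K1; apply/matrixP => a b; rewrite !mxE mxtens_block_kraus_dual.
by rewrite mxtrace_kraus_dual.
Qed.

Lemma kraus_dual_tens {J : finType} (K : J -> 'M[C]_n) (A : 'M[C]_n) (B : 'M[C]_m) :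
  kraus_dual (fun j => K j *t 1%:M) (A *t B) = kraus_dual K A *t B.
Proof.
rewrite /kraus_dual tensmx_suml; apply: eq_bigr => j _.
by rewrite tensmx_adj adjmx1 !tensmx_mul mul1mx mulmx1.
Qed.

Lemma kraus_tens1 {J : finType} (K : J -> 'M[C]_n) : kraus K 1%:M = 1%:M ->
  kraus (fun j => K j *t (1%:M : 'M[C]_m)) 1%:M = 1%:M.
Proof.
move=> K1; rewrite -[RHS]tensmx11 -K1 /kraus tensmx_suml; apply: eq_bigr => j _.
by rewrite tensmx_adj adjmx1 !mulmx1 tensmx_mul mulmx1.
Qed.

Lemma frobsq_sum_le (p : nat) (A : 'I_p -> 'M[C]_(n * m)) :
  frobsq (\sum_i A i) <= p%:R * \sum_i frobsq (A i).
Proof.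
rewrite frobsqE adjmx_sum mulmx_suml (raddf_sum (@mxtrace _ _)) /= Re_sum.
have -> : \sum_i Re (\tr ((A i) ^H *m \sum_j A j)) = \sum_i \sum_j Re (\tr ((A i) ^H *m A j)).
  by apply: eq_bigr => i _; rewrite mulmx_sumr (raddf_sum (@mxtrace _ _)) /= Re_sum.
have -> : p%:R * \sum_i frobsq (A i) =
    \sum_i \sum_j 2^-1 * (frobsq (A i) + frobsq (A j)).
  set S := \sum_i frobsq (A i).
  transitivity (\sum_(i < p) 2^-1 * (p%:R * frobsq (A i) + S)).
    rewrite -mulr_sumr big_split /= sumr_const card_ord -mulr_sumr -/S -[S *+ p]mulr_natl.
    by field.
  apply: eq_bigr => i _; rewrite -mulr_sumr big_split /= sumr_const card_ord.
  by rewrite [p%:R * _]mulr_natl.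
do 2![apply: ler_sum => ? _]; rewrite ler_pdivlMl //; exact: frob_AMGM.
Qed.

(** With the matrix units as Kraus operators, the diagonal units reproduce the pinching of [E],
    which is how [E] gets compared with its marginal. *)
Lemma partial_trace_twirl E :
  kraus_dual (fun ij : 'I_n * 'I_n => delta_mx ij.1 ij.2 *t 1%:M) E =
  1%:M *t partial_trace E.
Proof.
apply/matrixP => k l; case: (mxtens_indexP k) => p a; case: (mxtens_indexP l) => q b.
have entry Z : Z (mxtens_index (p, a)) (mxtens_index (q, b)) = mxtens_block Z a b p q.
  by rewrite mxE.
rewrite !entry mxtens_block_kraus_dual mxtens_block_tens.
rewrite /kraus_dual summxE -(pair_big xpredT xpredT (fun i j =>
  ((delta_mx i j) ^H *m mxtens_block E a b *m delta_mx i j) p q)) /=.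
have E1 i j : ((delta_mx i j) ^H *m mxtens_block E a b *m delta_mx i j) p q =
    (j == p)%:R * mxtens_block E a b i i * (j == q)%:R.
  rewrite mulmxE (bigD1 i) //= big1 => [|i' /negbTE ii]; last first.
    by rewrite [X in _ * X]mxE ii mulr0.
  rewrite addr0 [X in _ * X]mxE eqxx (eq_sym q) mulmxE (bigD1 i) //= big1 => [|i' /negbTE ii]; last first.
    by rewrite adjmxE [X in X^cj]mxE ii conjc0 mul0r.
  by rewrite addr0 adjmxE [X in X^cj]mxE eqxx conjc_nat (eq_sym p).
under eq_bigr do under eq_bigr do rewrite E1.
rewrite !mxE mulr_suml; apply: eq_bigr => i _.
rewrite (bigD1 p) //= eqxx mul1r big1 ?addr0 // => j /negbTE jp.
by rewrite jp !mul0r.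
Qed.

(** The identity is the sum of the n diagonal units, so the convexity bound [frobsq_sum_le] gives n
    times the pinching of [E]; adding the off-diagonal terms of the twirl only increases it. This is
    the source of n in the final constant. *)
Lemma le_partial_trace E Z : psdmx E ->
  Re (\tr (E *m (Z *m Z ^H))) <= n%:R * Re (\tr ((1%:M *t partial_trace E) *m (Z *m Z ^H))).
Proof.
move=> /psd_factor[F FE].
have trF (X : 'M[C]_(n * m)) : Re (\tr (X ^H *m E *m X *m (Z *m Z ^H))) = frobsq (F *m X *m Z).
  rewrite frobsqE !adjmxM mulmxA mxtrace_mulC FE; congr (Re (\tr _)).
  by rewrite !mulmxA.
pose T (i j : 'I_n) : 'M[C]_(n * m) := delta_mx i j *t 1%:M.
have -> : Re (\tr (E *m (Z *m Z ^H))) = frobsq (\sum_i F *m T i i *m Z).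
  have := trF 1%:M; rewrite adjmx1 mul1mx mulmx1 => ->.
  rewrite -mulmx_suml -mulmx_sumr; congr (frobsq (_ *m _ *m _)).
  rewrite -tensmx_suml -tensmx11; congr (_ *t _).
  apply/matrixP => p q; rewrite summxE [LHS]mxE (bigD1 p) //= mxE eqxx /= eq_sym big1 ?addr0 //.
  by move=> i /negbTE ip; rewrite mxE eq_sym ip.
apply: le_trans (frobsq_sum_le _) _; apply: ler_wpM2l => //.
rewrite -partial_trace_twirl /kraus_dual mulmx_suml (raddf_sum (@mxtrace _ _)) /= Re_sum.
rewrite -(pair_big xpredT xpredT (fun i j =>
  Re (\tr ((T i j) ^H *m E *m T i j *m (Z *m Z ^H))))) /=.
apply: ler_sum => i _; rewrite (bigD1 i) //= trF lerDl.
by apply: sumr_ge0 => j _; rewrite trF frobsq_ge0.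
Qed.

Lemma posdef_partial_trace E : (0 < n)%N -> posdefmx E -> posdefmx (partial_trace E).
Proof.
move=> n0 /posdefP[hE E0]; apply/posdefP; split.
  apply/matrixP => a b; rewrite adjmxE !mxE !mxtraceE conjc_sum; apply: eq_bigr => i _.
  by rewrite !mxE -adjmxE hE.
move=> v v0.
pose w (i : 'I_n) : 'rV[C]_(n * m) :=
  \row_k (((mxtens_unindex k).1 == i)%:R * v 0 (mxtens_unindex k).2).
have wE i p a : w i 0 (mxtens_index (p, a)) = (p == i)%:R * v 0 a.
  by rewrite mxE mxtens_indexK.
have -> : (v *m partial_trace E *m v ^H) 0 0 = \sum_i (w i *m E *m (w i) ^H) 0 0.
  transitivity (\sum_b \sum_a \sum_i v 0 a * E (mxtens_index (i, a)) (mxtens_index (i, b)) * (v 0 b)^cj).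
    rewrite mulmxE; apply: eq_bigr => b _; rewrite mulmxE mulr_suml; apply: eq_bigr => a _.
    rewrite mxE mxtraceE mulr_sumr mulr_suml adjmxE; apply: eq_bigr => i _.
    by rewrite mxE.
  transitivity (\sum_i \sum_b \sum_a v 0 a * E (mxtens_index (i, a)) (mxtens_index (i, b)) * (v 0 b)^cj).
    by rewrite [RHS]exchange_big; apply: eq_bigr => b _; rewrite [RHS]exchange_big.
  apply: eq_bigr => i _; rewrite mulmxE mxtens_sum (bigD1 i) //= [X in _ = _ + X]big1; last first.
    move=> p /negbTE pi; rewrite big1 // => b _.
    by rewrite adjmxE wE pi mul0r conjc0 mulr0.
  rewrite addr0; apply: eq_bigr => b _; rewrite adjmxE wE eqxx mul1r mulmxE mulr_suml.
  rewrite mxtens_sum (bigD1 i) //= [X in _ = _ + X]big1; last first.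
    by move=> p /negbTE pi; rewrite big1 // => a _; rewrite wE pi !mul0r.
  by rewrite addr0; apply: eq_bigr => a _; rewrite wE eqxx mul1r.
have wn0 i : w i != 0.
  apply: contra_neq v0 => /rowP w0; apply/rowP => a.
  by have := w0 (mxtens_index (i, a)); rewrite wE eqxx mul1r !mxE.
have wpos i : 0 < (w i *m E *m (w i) ^H) 0 0 by apply: E0.
rewrite (bigD1 (Ordinal n0)) //=; apply: ltr_wpDr; last exact: wpos.
by apply: sumr_ge0 => i _; apply/ltW/wpos.
Qed.

End Tensor.

Lemma entropy_production_split {R : realType} n (E A S : 'M[R[i]]_n) :
  Re (\tr ((E - A) *m (logmx E - logmx S))) =
  relative_entropy E S - relative_entropy A S + relative_entropy A E.
Proof.
rewrite /relative_entropy; move: (logmx E) (logmx A) (logmx S) => e a s.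
rewrite !mulmxBl !mulmxBr !(raddfB (@mxtrace _ _)) /= !ReB.
by ring.
Qed.

Local Opaque relative_entropy logmx.

(** * The entropy production inequality *)

Section CMLSI.
Context {R : realType} {n m : nat} {J : finType}.
Local Notation C := R[i].
Context (D W : 'M[C]_n) (d : 'I_n -> R) (a : R).
Context (uW : unitary W) (DE : D = specmx W d) (a0 : 0 < a) (ad : forall i, a <= d i)
  (trD : \tr D = 1).
Context (K : J -> 'M[C]_n) (K1 : kraus K 1%:M = 1%:M) (KD : kraus_dual K D = D).
Implicit Types (E Y Z : 'M[C]_(n * m)).
Local Notation Kt := (fun j => K j *t (1%:M : 'M[C]_m)).

(** With [V] diagonalising the second marginal, the weights depend on (b, c) alone, while the map
    acts inside each block. This reduces the tensor problem to the gap on M_n. *)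
Definition rotated_block (V : 'M[C]_m) Y b c : 'M[C]_n :=
  mxtens_block ((1%:M *t V) *m Y *m (1%:M *t V) ^H) b c.

Lemma rotated_blockB V Y Z b c :
  rotated_block V (Y - Z) b c = rotated_block V Y b c - rotated_block V Z b c.
Proof. by rewrite /rotated_block mulmxBr mulmxBl mxtens_blockB. Qed.

Lemma rotated_blockN V Y b c : rotated_block V (- Y) b c = - rotated_block V Y b c.
Proof.
by rewrite /rotated_block mulmxN mulNmx; apply/matrixP => i j; rewrite !mxE.
Qed.

Lemma rotated_block_kraus_dual V Y b c :
  rotated_block V (kraus_dual Kt Y) b c = kraus_dual K (rotated_block V Y b c).
Proof.
rewrite /rotated_block -mxtens_block_kraus_dual; congr (mxtens_block _ b c).
rewrite /kraus_dual mulmx_sumr mulmx_suml; apply: eq_bigr => j _.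
rewrite !mulmxA tensmx_adj adjmx1 !tensmx_mul !mul1mx !mulmx1.
rewrite -!mulmxA !tensmx_adj !adjmx1 !tensmx_mul !mul1mx !mulmx1.
by [].
Qed.

Lemma mxtrace_rotated_block V Y b c : partial_trace Y = 0 ->
  \tr (rotated_block V Y b c) = 0.
Proof.
move=> Y0; rewrite mxtraceE.
transitivity (\sum_p \sum_f \sum_e V b e * Y (mxtens_index (p, e)) (mxtens_index (p, f)) * (V c f)^cj).
  apply: eq_bigr => p _; rewrite mxE mulmxE mxtens_sum (bigD1 p) //= [X in _ + X]big1 ?addr0.
    apply: eq_bigr => f _; rewrite tensmx_adj tensmxE adjmx1 mx1E eqxx mul1r adjmxE.
    rewrite mulmxE mulr_suml mxtens_sum (bigD1 p) //= [X in _ + X]big1 ?addr0.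
      by apply: eq_bigr => e _; rewrite tensmxE mx1E eqxx mul1r.
    by move=> q /negbTE qp; rewrite big1 // => e _; rewrite tensmxE mx1E eq_sym qp !mul0r.
  move=> q /negbTE qp; rewrite big1 // => f _.
  by rewrite tensmx_adj tensmxE adjmx1 mx1E qp mul0r mulr0.
rewrite exchange_big big1 // => f _; rewrite exchange_big big1 // => e _ /=.
rewrite -mulr_suml -mulr_sumr.
have := congr1 (fun M : 'M[C]_m => M e f) Y0; rewrite mxE mxE mxtraceE.
under eq_bigr do rewrite mxE.
by move=> ->; rewrite mulr0 mul0r.
Qed.

Lemma mxtens_block_rotate V Y b c :
  mxtens_block ((W *t V) *m Y *m (W *t V) ^H) b c = W *m rotated_block V Y b c *m W ^H.
Proof.
(* Conjugation by [W] is treated as a dual map with a single Kraus operator. *)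
have := mxtens_block_kraus_dual (fun _ : unit => W ^H)
  ((1%:M *t V) *m Y *m (1%:M *t V) ^H) b c.
rewrite /kraus_dual !big_const !card_unit /= !addr0 adjmxK tensmx_adj adjmx1 adjmxK => <-.
congr (mxtens_block _ b c).
rewrite !mulmxA tensmx_mul mulmx1 mul1mx -!mulmxA !tensmx_adj tensmx_mul.
by rewrite adjmx1 mul1mx mulmx1.
Qed.

Lemma block_norm V Y (g : 'I_m -> 'I_m -> R) (Yh := (W *t V) *m Y *m (W *t V) ^H) :
  \sum_k \sum_l normsq (Yh k l) * g (mxtens_unindex k).2 (mxtens_unindex l).2 =
  \sum_b \sum_c g b c * frobsq (rotated_block V Y b c).
Proof.
rewrite mxtens_sum exchange_big; apply: eq_bigr => b _.
transitivity (\sum_i \sum_c \sum_j normsq (Yh (mxtens_index (i, b)) (mxtens_index (j, c))) * g b c).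
  apply: eq_bigr => i _; rewrite mxtens_sum exchange_big; apply: eq_bigr => c _.
  by apply: eq_bigr => j _; rewrite !mxtens_indexK.
rewrite exchange_big; apply: eq_bigr => c _.
rewrite -(frobsq_unitary (rotated_block V Y b c) uW uW) -mxtens_block_rotate -/Yh.
rewrite mulr_sumr; apply: eq_bigr => i _; rewrite mulr_sumr; apply: eq_bigr => j _.
by rewrite [mxtens_block Yh b c i j]mxE mulrC.
Qed.

(** A vector on which the image of [E] vanishes is killed by every adjoint Kraus operator, so the
    form of the fixed matrix [D *t S] would vanish on it too. *)
Lemma posdef_kraus_dual_tens E (S : 'M[C]_m) : posdefmx E -> posdefmx (D *t S) ->
  posdefmx (kraus_dual Kt E).
Proof.
move=> /posdefP[hE E0] /posdefP[hS S0]; apply/posdefP; split.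
  by rewrite -kraus_dual_adj hE.
have quad (X : 'M[C]_(n * m)) (v : 'rV_(n * m)) : (v *m kraus_dual Kt X *m v ^H) 0 0 =
    \sum_j ((v *m (Kt j) ^H) *m X *m (v *m (Kt j) ^H) ^H) 0 0.
  rewrite /kraus_dual mulmx_sumr mulmx_suml summxE; apply: eq_bigr => j _.
  by rewrite adjmxM adjmxK !mulmxA.
move=> v v0; rewrite quad.
have Epos (w : 'rV_(n * m)) : 0 <= (w *m E *m w ^H) 0 0.
  by have [->|w0] := eqVneq w 0; [rewrite !mul0mx mxE | apply/ltW/E0].
rewrite lt_def sumr_ge0 ?andbT //; apply/eqP => sum0.
have : 0 < (v *m (D *t S) *m v ^H) 0 0 by apply: S0.
rewrite -[D *t S](_ : kraus_dual Kt (D *t S) = _); last by rewrite kraus_dual_tens KD.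
rewrite quad big1 ?ltxx // => j _.
suff -> : v *m (Kt j) ^H = 0 by rewrite !mul0mx mxE.
apply/eqP/negPn/negP => /E0; rewrite lt_def => /andP[/negP + _]; apply.
move/eqP: sum0; rewrite psumr_eq0 => [/allP/(_ j (mem_index_enum j))|i _]; last exact: Epos.
by [].
Qed.

(** Both entropies are compared with one form [N] whose weights involve only the second marginal:
    H(E|sigma) <= a^-1 N(E - sigma), kappa N(E - sigma) <= N(A - E), and N(A - E) / (2n) <=
    H(A|E). *)
Lemma entropy_production_ge E (kappa : R) (sigma := D *t partial_trace E) :
  (0 < n)%N -> posdefmx E -> \tr E = 1 -> 0 <= kappa ->
  (forall Y : 'M[C]_n, \tr Y = 0 -> kappa * frobsq Y <= frobsq (Y - kraus_dual K Y)) ->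
  a * kappa / (2 * n%:R) * relative_entropy E sigma <=
    Re (\tr ((E - kraus_dual Kt E) *m (logmx E - logmx sigma))).
Proof.
move=> n0 posE trE kappa0 gap.
have posr := posdef_partial_trace n0 posE.
have [V [r [uV rE r0 _]]] := posdef_specmx posr.
have uU := unitary_tens uW uV.
have d0 i : 0 < d i by apply: lt_le_trans (ad i).
pose sk (k : 'I_(n * m)) := d (mxtens_unindex k).1 * r (mxtens_unindex k).2.
pose wk (k : 'I_(n * m)) := r (mxtens_unindex k).2.
have sk0 k : 0 < sk k by rewrite mulr_gt0.
have wk0 k : 0 < wk k by apply: r0.
have sigmaE : sigma = specmx (W *t V) sk by rewrite /sigma rE DE specmx_tens.
have omegaE : 1%:M *t partial_trace E = specmx (W *t V) wk.
  by rewrite rE -(specmx1 uW) specmx_tens; apply: eq_specmx => k; rewrite mul1r.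
have posS : posdefmx sigma by rewrite sigmaE; apply: specmx_posdef.
pose A := kraus_dual Kt E.
have posA : posdefmx A by apply: (@posdef_kraus_dual_tens E (partial_trace E)).
have Kt1 := @kraus_tens1 R n m J K K1.
have trA : \tr A = \tr E by rewrite mxtrace_kraus_dual.
have ptS : partial_trace sigma = partial_trace E.
  by apply/matrixP => b c; rewrite mxE mxtens_block_tens mxtraceZ trD mulr1.
have trS : \tr sigma = \tr E by rewrite (mxtrace_tens_sum sigma) ptS -(mxtrace_tens_sum E).
have KS : kraus_dual Kt sigma = sigma by rewrite /sigma kraus_dual_tens KD.
have dpi : relative_entropy A sigma <= relative_entropy E sigma.
  by have := entropy_monotone posE posS (esym trS) Kt1; rewrite KS => /(_ posA posS).
have nR0 : 0 < n%:R :> R by rewrite ltr0n.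
(* One reference matrix dominates both [E] and [A], since the map preserves the second marginal. *)
have le_omega (B : 'M[C]_(n * m)) : psdmx B -> partial_trace B = partial_trace E -> forall Z,
    Re (\tr (B *m (Z *m Z ^H))) <= n%:R * Re (\tr (specmx (W *t V) wk *m (Z *m Z ^H))).
  by move=> psdB ptB Z; rewrite -omegaE -ptB; apply: le_partial_trace.
have lower := entropy_lower posA posE trA uU wk0 nR0
  (le_omega A (posdef_psd posA) (partial_trace_kraus_dual _ K1))
  (le_omega E (posdef_psd posE) erefl).
have upper := entropy_upper uU sk0 posE (_ : \tr E = \tr (specmx (W *t V) sk)).
rewrite -sigmaE in upper; have {}upper := upper (esym trS).
pose L b c := inv_logmean (r b) (r c).
have L0 b c : 0 <= L b c by apply: inv_logmean_ge0.
pose N Y := \sum_b \sum_c L b c * frobsq (rotated_block V Y b c).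
have upper' : relative_entropy E sigma <= a^-1 * N (E - sigma).
  apply: le_trans upper _; rewrite /N -block_norm mulr_sumr; apply: ler_sum => k _.
  rewrite mulr_sumr; apply: ler_sum => l _; rewrite mulrCA.
  apply: ler_wpM2l; first exact: normsq_ge0.
  by apply: inv_logmean_le => //; rewrite ler_wpM2r // ltW.
have lower' : (2 * n%:R)^-1 * N (A - E) <= relative_entropy A E.
  by apply: le_trans lower; rewrite /N -block_norm.
(* As sigma is fixed, A - E is minus the defect of E - sigma. The blocks of E - sigma are traceless
   because both matrices have the same second marginal. *)
have gapN : kappa * N (E - sigma) <= N (A - E).
  rewrite /N mulr_sumr; apply: ler_sum => b _; rewrite mulr_sumr; apply: ler_sum => c _.
  rewrite mulrCA; apply: ler_wpM2l => //.
  have -> : rotated_block V (A - E) b c =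
      - (rotated_block V (E - sigma) b c - kraus_dual K (rotated_block V (E - sigma) b c)).
    rewrite -rotated_block_kraus_dual -rotated_blockB kraus_dualB KS -/A.
    have -> : E - sigma - (A - sigma) = - (A - E) by rewrite opprB addrA subrK opprB.
    by rewrite rotated_blockN opprK.
  rewrite frobsqN; apply: gap; apply: mxtrace_rotated_block.
  apply/matrixP => e f; rewrite mxE mxtens_blockB raddfB /= [RHS]mxE.
  by move/matrixP/(_ e f): ptS; rewrite !mxE => ->; rewrite subrr.
rewrite -/A entropy_production_split; apply: (@le_trans _ _ (relative_entropy A E)); last first.
  move: dpi; move: (relative_entropy E _) (relative_entropy A sigma) (relative_entropy A E).
  by move=> x y z yx; rewrite lerDr subr_ge0.
apply: le_trans lower'.
have n2 : 0 <= (2 * n%:R)^-1 :> R by rewrite invr_ge0 mulr_ge0 // ltW.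
apply: le_trans (ler_wpM2l n2 gapN).
rewrite [leLHS](_ : _ = (2 * n%:R)^-1 * (kappa * (a * relative_entropy E sigma))); last first.
  by move: (relative_entropy _ _) => x; field; rewrite gt_eqF.
rewrite (ler_pdivlMl _ _ a0) in upper'.
by apply: (ler_wpM2l n2); apply: (ler_wpM2l kappa0); exact: upper'.
Qed.

End CMLSI.

(** * Extreme eigenvalues and the constants of the generator *)

Section ExtremeEigenvalues.
Context {R : realType} {n : nat}.
Local Notation C := R[i].
Context (U : 'M[C]_n) (a : 'I_n -> R) (uU : unitary U).

Lemma eigenvalue_specmx x : eigenvalue (specmx U a) x%:C <-> exists i, x = a i.
Proof.
have [U1 U2] := uU; have vE (v : 'rV[C]_n) : v *m specmx U a *m U ^H = v *m U ^H *m diagR a.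
  by rewrite specmxE -!mulmxA U1 mulmx1.
split=> [/eigenvalueP[v vx v0]|[i ->]].
  have w0 : v *m U ^H != 0.
    by apply: contra_neq v0 => w0; rewrite -[v]mulmx1 -U2 mulmxA w0 mul0mx.
  have /rV0Pn[i wi] := w0; exists i.
  have := congr1 (fun M => (M *m U ^H) 0 i) vx.
  rewrite vE mul_mx_diagR -scalemxAl [RHS]mxE => /(mulIf wi) ax.
  by have := congr1 (@complex.Re R) ax.
have [v0 _] := specmx_eigen a i uU.
apply/eigenvalueP; exists (row i U); last exact: v0.
rewrite -row_mul specmxE !mulmxA U1 mul1mx.
by apply/rowP => j; rewrite mxE mul_diagR !mxE.
Qed.

Lemma min_eigenvalue_specmx i : min_eigenvalue (specmx U a) <= a i.
Proof.
apply: ge_inf; last by apply/eigenvalue_specmx; exists i.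
case: (arg_minP (i0 := i) a erefl) => k _ ak.
by exists (a k) => x /eigenvalue_specmx[j ->]; exact: ak.
Qed.

Lemma max_eigenvalue_specmx i : a i <= max_eigenvalue (specmx U a).
Proof.
apply: ub_le_sup; last by apply/eigenvalue_specmx; exists i.
case: (arg_maxP (i0 := i) a erefl) => k _ ak.
by exists (a k) => x /eigenvalue_specmx[j ->]; exact: ak.
Qed.

Lemma min_eigenvalue_gt0 : (0 < n)%N -> (forall i, 0 < a i) ->
  0 < min_eigenvalue (specmx U a).
Proof.
move=> n0 a0; pose i0 : 'I_n := Ordinal n0.
case: (@arg_minP _ _ _ i0 xpredT a erefl) => k _ ak.
apply: lt_le_trans (a0 k) _; apply: lb_le_inf.
  by exists (a i0); apply/eigenvalue_specmx; exists i0.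
by move=> x /eigenvalue_specmx[j ->]; exact: ak.
Qed.

End ExtremeEigenvalues.

Lemma inf_ge0 {R : realType} (S : set R) : (forall x, S x -> 0 <= x) -> 0 <= inf S.
Proof.
move=> S0; have [->|/set0P S1] := eqVneq S classical_sets.set0; first by rewrite inf0.
exact: lb_le_inf.
Qed.

Lemma krausB {R : realType} {n : nat} {J : finType} (K : J -> 'M[R[i]]_n) X Y :
  kraus K (X - Y) = kraus K X - kraus K Y.
Proof. by rewrite krausD -scaleN1r krausZ scaleN1r. Qed.

Section Generator.
Context {R : realType} {n : nat} {J : finType}.
Local Notation C := R[i].
Context (D W : 'M[C]_n) (d : 'I_n -> R).
Context (uW : unitary W) (DE : D = specmx W d) (d0 : forall i, 0 < d i)
  (SE : sqrtmx D = specmx W (fun i => Num.sqrt (d i))) (trD : \tr D = 1).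
Context (K : J -> 'M[C]_n) (K1 : kraus K 1%:M = 1%:M) (KD : kraus_dual K D = D)
  (Ksym : forall X Y, kms_inner D (kraus K X) Y = kms_inner D X (kraus K Y)).
Context (g : R) (g0 : 0 < g) (L : 'End('M[C]_n))
  (LE : forall X, L X = g%:C *: (X - kraus K X)).
Implicit Types (X Y P : 'M[C]_n).

Lemma hs_adjoint_kraus (T : 'End('M[C]_n)) : (forall X, T X = kraus K X) ->
  forall X, hs_adjoint T X = kraus_dual K X.
Proof.
move=> TE X; apply: mxtrace_nondeg => Z.
have := hs_adjointP T X Z; rewrite /hs_inner !adjE => ->.
by rewrite TE -kraus_dualP kraus_dual_adj.
Qed.

Lemma hs_adjoint_generator X : hs_adjoint L X = g%:C *: (X - kraus_dual K X).
Proof.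
apply: mxtrace_nondeg => Z.
have := hs_adjointP L X Z; rewrite /hs_inner !adjE => ->.
rewrite LE adjmxZ conjc_real -scalemxAr -scalemxAl !mxtraceZ; congr (_ * _).
rewrite mulmxBr adjmxB mulmxBl !(raddfB (@mxtrace _ _)) /=; congr (_ - _).
by rewrite -kraus_dualP kraus_dual_adj.
Qed.

Lemma ampliation_generator m (E : 'M[C]_(n * m)) :
  ampliation (hs_adjoint L) E =
  g%:C *: (E - kraus_dual (fun j => K j *t (1%:M : 'M[C]_m)) E).
Proof.
apply/matrixP => p q; case: (mxtens_indexP p) => i j; case: (mxtens_indexP q) => k l.
rewrite ampliationE hs_adjoint_generator -mxtens_block_kraus_dual.
by rewrite !mxE.
Qed.

Lemma kms_norm_sqr X : kms_norm D X ^+ 2 = kmsb D X X.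
Proof. by rewrite sqr_sqrtr //; exact: kmsq_ge0 uW SE X. Qed.

Lemma kms_norm_ge0 X : 0 <= kms_norm D X.
Proof. exact: sqrtr_ge0. Qed.

Lemma kms_norm_gt0 X : X != 0 -> 0 < kms_norm D X.
Proof. by move=> X0; rewrite sqrtr_gt0; exact: kmsq_gt0 uW d0 SE _ X0. Qed.

Lemma dirichletE X : dirichlet D L X = g * kmsb D X (X - kraus K X).
Proof. by rewrite /dirichlet LE -kmsbZr. Qed.

Local Opaque kmsb kms_norm dirichlet.
Local Notation kmsb := (kmsb D).

Lemma dirichlet_ge0 X : 0 <= dirichlet D L X.
Proof.
rewrite dirichletE mulr_ge0 ?(ltW g0) // kmsbBr subr_ge0.
exact: kmsb_kraus_le uW DE d0 SE _ K1 KD Ksym X.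
Qed.

Lemma kmsb0 : kmsb 0 0 = 0.
Proof. by have := kmsbBr D 0 0 0; rewrite !subrr. Qed.

Lemma spectral_gap_ge0 : 0 <= spectral_gap D L.
Proof.
apply: inf_ge0 => _ [X _ <-]; rewrite divr_ge0 ?sqr_ge0 //.
exact: dirichlet_ge0.
Qed.

Lemma spectral_gap_le X : X ^H = X -> \tr (D *m X) = 0 ->
  spectral_gap D L * kmsb X X <= dirichlet D L X.
Proof.
move=> hX tX; have [->|X0] := eqVneq X 0.
  by rewrite kmsb0 mulr0 dirichlet_ge0.
have pX := kmsq_gt0 uW d0 SE X0.
rewrite -ler_pdivlMr // -kms_norm_sqr; apply: ge_inf; last first.
  by exists X; first by split; [exact: X0 | exact: hX | exact: tX].
exists 0 => _ [Y _ <-]; rewrite divr_ge0 ?sqr_ge0 //.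
exact: dirichlet_ge0.
Qed.

Lemma state_projection_ge0 P : P ^H = P -> P *m P = P -> 0 <= Re (\tr (D *m P)).
Proof.
move=> hP PP; apply: psd_mul_trace_ge0.
  by apply: posdef_psd; rewrite DE; exact: specmx_posdef.
by rewrite -PP -{1}hP; exact: factor_psd.
Qed.

Lemma state_projection_le1 P : P ^H = P -> P *m P = P -> Re (\tr (D *m P)) <= 1.
Proof.
move=> hP PP; have : 0 <= Re (\tr (D *m (1%:M - P))).
  apply: state_projection_ge0; first by rewrite adjmxB adjmx1 hP.
  by rewrite mulmxBl !mulmxBr !mul1mx mulmx1 PP subrr subr0.
by rewrite mulmxBr mulmx1 (raddfB (@mxtrace _ _)) /= trD ReB subr_ge0.
Qed.

Lemma cut_ge0 P : P ^H = P -> P *m P = P ->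
  0 <= Num.min (Re (\tr (D *m P))) (1 - Re (\tr (D *m P))).
Proof.
move=> hP PP; rewrite le_min subr_ge0.
by rewrite state_projection_ge0 // state_projection_le1.
Qed.

Lemma cut_quotient_ge0 P : is_projection P ->
  0 <= dirichlet D L P / Num.min (Re (state D P)) (1 - Re (state D P)).
Proof. by move=> [hP PP]; rewrite divr_ge0 ?dirichlet_ge0 ?cut_ge0. Qed.

Lemma conductance_ge0 : 0 <= conductance D L.
Proof. by apply: inf_ge0 => _ [P [pP _ _] <-]; exact: cut_quotient_ge0. Qed.

Lemma conductance_le P : P ^H = P -> P *m P = P -> P != 0 -> P != 1%:M ->
  conductance D L * Num.min (Re (\tr (D *m P))) (1 - Re (\tr (D *m P))) <= dirichlet D L P.
Proof.
move=> hP PP P0 P1; have := cut_ge0 hP PP; rewrite le_eqVlt => /predU1P[<-|c0].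
  by rewrite mulr0 dirichlet_ge0.
rewrite -ler_pdivlMr //; apply: ge_inf; last by exists P.
by exists 0 => _ [Q [pQ _ _] <-]; exact: cut_quotient_ge0.
Qed.

(** The parallelogram law and contractivity bound Id - Psi by 2. Without an upper bound on the
    quotients, the real [sup] defining [kms_opnorm] would say nothing about them. *)
Lemma generator_bounded X : kmsb (L X) (L X) <= (2 * g) ^+ 2 * kmsb X X.
Proof.
have g2 := sqr_ge0 g.
rewrite LE kmsbZr (kmsbZl uW SE) mulrA -expr2 exprMn [2 ^+ 2 * _]mulrC -[leRHS]mulrA.
apply: (ler_wpM2l g2).
have := kmsq_ge0 uW SE (X + kraus K X).
have := kraus_contraction uW DE d0 SE K1 KD Ksym X.
rewrite kmsbBr !(kmsbBl uW SE) kmsbDr !(kmsbDl uW SE) (kmsbC uW SE (kraus K X) X).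
move: (kmsb X X) (kmsb X _) (kmsb _ _) => x y z; lra.
Qed.

Lemma kms_opnorm_le X : kms_norm D (L X) <= kms_opnorm D L * kms_norm D X.
Proof.
have [->|X0] := eqVneq X 0.
  suff k0 : kms_norm D 0 = 0 by rewrite linear0 k0 mulr0.
  by apply/eqP; rewrite -sqrf_eq0 kms_norm_sqr kmsb0.
have pX := kms_norm_gt0 X0.
rewrite -(ler_pdivrMr _ _ pX); apply: ub_le_sup; last by exists X.
exists (2 * g) => _ [Y Y0 <-]; have pY := kms_norm_gt0 Y0.
have g2 : 0 <= 2 * g by rewrite mulr_ge0 ?(ltW g0).
rewrite (ler_pdivrMr _ _ pY); have := generator_bounded Y.
rewrite -(kms_norm_sqr (L Y)) -(kms_norm_sqr Y) -exprMn.
move: (kms_norm D (L Y)) (kms_norm D Y) pY => u v v0 uv.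
by apply: ge0_sqr_le; [exact: mulr_ge0 g2 (ltW v0) | rewrite -expr2].
Qed.

Lemma kms_opnorm_ge0 : 0 <= kms_opnorm D L.
Proof.
rewrite /kms_opnorm /opnorm; set S := (X in sup X).
have [->|/set0P[x Sx]] := eqVneq S classical_sets.set0; first by rewrite sup0.
have [Y Y0 xE] := Sx.
have pY := kms_norm_gt0 Y0.
rewrite -(pmulr_lge0 _ pY); apply: le_trans (kms_opnorm_le Y).
exact: kms_norm_ge0.
Qed.

Lemma dirichlet_le_opnorm X : dirichlet D L X <= kms_opnorm D L * kmsb X X.
Proof.
apply: ge0_sqr_le; first by rewrite mulr_ge0 ?kms_opnorm_ge0 // (kmsq_ge0 uW SE).
apply: le_trans (kms_CauchySchwarz uW d0 SE X (L X)) _.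
rewrite [leRHS]mulrACA mulrA mulrC -expr2; apply: ler_wpM2r.
  exact: kmsq_ge0 uW SE X.
rewrite -!kms_norm_sqr -exprMn.
move: (kms_norm D (L X)) (kms_norm_ge0 (L X)) (kms_opnorm_le X) => u u0 uX.
by rewrite lerXn2r ?nnegrE // (le_trans u0).
Qed.

(** It makes the set of quotients in the spectral gap nonempty, as a lower bound on [inf] requires.
    The two coefficients are crossed so that they cancel under the state. *)
Lemma centered_hermitian : (2 <= n)%N ->
  exists X : 'M[C]_n, [/\ X != 0, X ^H = X & \tr (D *m X) = 0].
Proof.
move=> n2; pose i0 : 'I_n := Ordinal (ltnW n2); pose i1 : 'I_n := Ordinal n2.
pose x i := if i == i0 then d i1 else if i == i1 then - d i0 else 0.
exists (specmx W x); split; last 2 first.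
- exact: specmx_adj.
- rewrite DE specmxM // mxtrace_specmx // (bigD1 i0) //= (bigD1 i1) //= big1.
    by rewrite /x /= mulrN [d i1 * _]mulrC addr0 -rmorphD /= subrr.
  by move=> i /andP[/negbTE ii0 /negbTE ii1]; rewrite /x ii0 ii1 mulr0.
apply/eqP => X0; have := conj_specmx x uW; rewrite X0 mulmx0 mul0mx => /matrixP/(_ i0 i0).
rewrite mxE diagRE eqxx /x /= => /eqP; rewrite eq_sym => /eqP x0.
by have /eqP := congr1 (@complex.Re R) x0; rewrite /= gt_eqF.
Qed.

Lemma spectral_gap_ge a b : (2 <= n)%N -> 0 < a -> (forall i, a <= d i) ->
  (forall i, d i <= b) -> 0 < kms_opnorm D L ->
  conductance D L ^+ 2 * a ^+ 2 / (2 * b ^+ 2 * kms_opnorm D L) <= spectral_gap D L.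
Proof.
move=> n2 a0 ad db L0; have [X [X0 hX tX]] := centered_hermitian n2.
have b0 : 0 < b.
  by apply: lt_le_trans (db (Ordinal n2)); exact: d0.
have den0 : 0 < 2 * b ^+ 2 * kms_opnorm D L by rewrite !mulr_gt0 ?exprn_gt0.
apply: lb_le_inf; first by exists (dirichlet D L X / kms_norm D X ^+ 2), X.
move=> _ [Y [Y0 hY tY] <-]; have pY := kmsq_gt0 uW d0 SE Y0.
rewrite (kms_norm_sqr Y) (ler_pdivlMr _ _ pY) mulrAC (ler_pdivrMr _ _ den0).
rewrite [leRHS]mulrC dirichletE.
apply: (kms_cheeger uW DE d0 SE K1 KD Ksym trD g0 conductance_ge0 L0 a0 ad db _ _ hY tY).
  by move=> P hP PP P0 P1; rewrite -dirichletE; exact: conductance_le.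
by move=> Z; rewrite -dirichletE; exact: dirichlet_le_opnorm.
Qed.

Lemma alpha_CMLSI_ge a b : (0 < n)%N -> 0 < a -> (forall i, a <= d i) ->
  (forall i, d i <= b) ->
  ((a ^+ 2 / (4 * n%:R * g * b) * spectral_gap D L ^+ 2)%:E <= alpha_CMLSI D L)%E.
Proof.
move=> n0 a0 ad db; have b0 : 0 < b.
  by apply: lt_le_trans (db (Ordinal n0)); exact: d0.
have nR0 : 0 < n%:R :> R by rewrite ltr0n.
have lam0 := spectral_gap_ge0.
apply: ereal_sup_ubound; exists (a ^+ 2 / (4 * n%:R * g * b) * spectral_gap D L ^+ 2) => //.
split; last first.
  move=> m E m0 [posE trE]; cbv zeta.
  rewrite ampliation_generator -scalemxAl mxtraceZ ReZ.
  set l := spectral_gap D L in lam0 *.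
  (* Dividing by gamma passes from the gap of L to that of Id - Psi. The entropy inequality is
     multiplied by gamma at the end, which leaves 1/gamma. *)
  have lg0 : 0 <= l / g by rewrite divr_ge0 // ltW.
  have k0 : 0 <= a / b * (l / g) ^+ 2 by rewrite mulr_ge0 ?sqr_ge0 // divr_ge0 // ltW.
  have gap Y : \tr Y = 0 ->
      a / b * (l / g) ^+ 2 * frobsq Y <= frobsq (Y - kraus_dual K Y).
    apply: (gap_frobsq uW DE d0 SE Ksym lg0 a0 ad db) => X hX tX.
    rewrite mulrAC (ler_pdivrMr _ _ g0) [leRHS]mulrC -dirichletE.
    exact: spectral_gap_le.
  have := entropy_production_ge uW DE a0 ad trD K1 KD n0 posE trE k0 gap.
  move=> /(ler_wpM2l (ltW g0)); apply: le_trans.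
  rewrite [leRHS]mulrA le_eqVlt; apply/orP; left; apply/eqP; congr (_ * _).
  by field; rewrite !gt_eqF.
rewrite mulr_ge0 ?sqr_ge0 // divr_ge0 ?sqr_ge0 // !mulr_ge0 ?ltW //.
Qed.

End Generator.

Lemma quotient_sqr_le {R : realType} (h a b g N lam l : R) :
  0 < a -> 0 < b -> 0 < g -> 0 < N -> 0 <= h -> 0 < lam ->
  h ^+ 2 * a ^+ 2 / (2 * b ^+ 2 * lam) <= l ->
  h ^+ 4 * a ^+ 6 / (16 * N * g * b ^+ 5 * lam ^+ 2) <=
    a ^+ 2 / (4 * N * g * b) * l ^+ 2.
Proof.
move=> a0 b0 g0 N0 h0 lam0 hl.
have c0 : 0 <= h ^+ 2 * a ^+ 2 / (2 * b ^+ 2 * lam).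
  by rewrite divr_ge0 ?mulr_ge0 ?sqr_ge0 // ltW.
have -> : h ^+ 4 * a ^+ 6 / (16 * N * g * b ^+ 5 * lam ^+ 2) =
    a ^+ 2 / (4 * N * g * b) * (h ^+ 2 * a ^+ 2 / (2 * b ^+ 2 * lam)) ^+ 2.
  by field; rewrite !gt_eqF.
rewrite ler_wpM2l ?divr_ge0 ?sqr_ge0 ?mulr_ge0 ?(ltW g0) ?(ltW N0) ?(ltW b0) //.
by rewrite lerXn2r ?nnegrE // (le_trans c0 hl).
Qed.

Theorem theorem6p5 (R : realType) (n : nat) (Drho : 'M[R[i]]_n)
    (Psi : 'End('M[R[i]]_n)) (gamma : R) (Phi : R -> 'End('M[R[i]]_n)) :
  (2 <= n)%N ->
  faithful_density Drho ->
  unital Psi ->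
  completely_positive Psi ->
  hs_adjoint Psi Drho = Drho ->
  kms_symmetric Drho Psi ->
  0 < gamma ->
  let L : 'End('M[R[i]]_n) := gamma%:C *: (\1%VF - Psi) in
  quantum_markov_semigroup Phi ->
  is_generator Phi L ->
  kms_symmetric_semigroup Drho Phi ->
  primitive_semigroup Phi L ->
  let s_min := min_eigenvalue Drho in
  let s_max := max_eigenvalue Drho in
  let bound :=
    s_min ^+ 2 / (4 * n%:R * gamma * s_max) * spectral_gap Drho L ^+ 2 in
  (bound%:E <= alpha_CMLSI Drho L)%E /\
  conductance Drho L ^+ 4 * s_min ^+ 6 /
    (16 * n%:R * gamma * s_max ^+ 5 * kms_opnorm Drho L ^+ 2) <= bound.
Proof.
move=> n2 [posD trD] uPsi cpPsi invD symPsi g0 L _ _ _ _ a b bound.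
have [W [d [uW DE d0 fE]]] := posdef_specmx posD.
have SE : sqrtmx Drho = specmx W (fun i => Num.sqrt (d i)) := fE _.
have [K PsiE] := kraus_of_cp cpPsi.
have K1 : kraus K 1%:M = 1%:M by rewrite -PsiE.
have KD : kraus_dual K Drho = Drho by rewrite -(hs_adjoint_kraus PsiE).
have Ksym X Y : kms_inner Drho (kraus K X) Y = kms_inner Drho X (kraus K Y).
  by rewrite -!PsiE; exact: symPsi.
have LE X : L X = gamma%:C *: (X - kraus K X).
  by rewrite scale_lfunE add_lfunE opp_lfunE id_lfunE PsiE.
have n0 : (0 < n)%N := ltnW n2.
have a0 : 0 < a by rewrite /a DE; exact: min_eigenvalue_gt0.
have ad i : a <= d i by rewrite /a DE; exact: min_eigenvalue_specmx.
have db i : d i <= b by rewrite /b DE; exact: max_eigenvalue_specmx.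
have b0 : 0 < b by apply: lt_le_trans (db (Ordinal n2)); exact: d0.
have nR0 : 0 < n%:R :> R by rewrite ltr0n.
split; first exact: (alpha_CMLSI_ge uW DE d0 SE trD K1 KD Ksym g0 LE n0 a0 ad db).
have := kms_opnorm_ge0 uW DE d0 SE K1 KD Ksym g0 LE.
rewrite le_eqVlt => /predU1P[L0|L0].
  (* If the operator norm is 0, the quotient is 0 because the inverse of 0 is 0, and only the sign
     of [bound] matters. *)
  rewrite -L0 expr0n /= mulr0 invr0 mulr0 mulr_ge0 ?sqr_ge0 //.
  by rewrite divr_ge0 ?sqr_ge0 // !mulr_ge0 ?ltW.
apply: quotient_sqr_le => //.
  exact: (conductance_ge0 uW DE d0 SE trD K1 KD Ksym g0 LE).
exact: (spectral_gap_ge uW DE d0 SE trD K1 KD Ksym g0 LE n2 a0 ad db L0).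
Qed.
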